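(* Let $n\in\omega$. For every true $\Pi_{2n+1}$ sentence $\varphi$ of first-order arithmetic there exists $a\in\mathcal O$ with $|a|=\omega^{n+1}+1$ such that $$\mathsf{RFN}^{a}(\mathsf{PA})\vdash\varphi .$$
   Context: $\mathsf{PA}$ is first-order Peano arithmetic; ''true'' means true in the standard model $\mathbb N$. $\{e\}$ is the $e$-th partial computable function. Kleene's $\mathcal O$ is the standard system of ordinal notations, with $|a|$ the ordinal denoted by $a\in\mathcal O$: $1\in\mathcal O$ denotes $0$; if $a\in\mathcal O$ then $2^a\in\mathcal O$ and $|2^a|=|a|+1$; if $\{e\}$ is total with $\{e\}(n)\in\mathcal O$ and $\{e\}(n)<_{\mathcal O}\{e\}(n+1)$ for all $n$, then $3\cdot 5^e\in\mathcal O$ and $|3\cdot5^e|=\sup_n|\{e\}(n)|$. Uniform reflection. For a c.e. axiomatizable arithmetical theory $T$ given by a $\Sigma_1$-formula $\mathsf{Ax}_T(x)$ defining its axioms, let $\mathsf{Prv}_T$ be the natural provability predicate. $\mathsf{RFN}(T)$ is the extension of $T$ by all sentences $\forall x\,(\mathsf{Prv}_T(\ulcorner\varphi(\dot x)\urcorner)\to\varphi(x))$, for $\varphi(x)$ an arbitrary arithmetical formula ($\dot x$ denotes substitution of the numeral of $x$). Iteration along notations. For an arbitrary number $a$ and a c.e. axiomatizable $T$ extending $\mathsf{PA}$: (1) $\mathsf{RFN}^{2^a}(T)=\mathsf{RFN}(\mathsf{RFN}^a(T))$; (2) $\mathsf{RFN}^{3\cdot 5^e}(T)=T+\bigcup\{\mathsf{RFN}(\mathsf{RFN}^a(T))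 : a=\{e\}(n)\text{ for some }n\}$; (3) $\mathsf{RFN}^a(T)=T$ for $a$ not of the form $3\cdot5^e$ or $2^{a'}$. Formally this is a uniformly c.e. axiomatizable family of theories: the Diagonal Lemma is used to produce a single $\Sigma_1$-formula $\mathsf{Ax}(x,y)$ such that $\mathsf{Ax}(\underline a,y)$ defines the axioms of $\mathsf{RFN}^a(T)$ according to clauses (1)–(3), where the provability predicate of $\mathsf{RFN}^{b}(T)$ occurring in reflection instances is the one built from the formula $\mathsf{Ax}(\underline b,\cdot)$. *)

(* Defs.v *)
From Stdlib Require Import Arith List.
Import ListNotations.

Set Implicit Arguments.

(** * First-order arithmetic *)

(** Variables are de Bruijn indices; [Bot], [Imp], [All] are primitive and
    the other connectives are classical abbreviations. *)

Inductive term : Type :=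
| Var (i : nat)
| Zero
| Succ (t : term)
| Plus (s t : term)
| Mult (s t : term).

Inductive form : Type :=
| Bot
| Eq (s t : term)
| Imp (p q : form)
| All (p : form).

Definition Neg (p : form) : form := Imp p Bot.
Definition And (p q : form) : form := Neg (Imp p (Neg q)).
Definition Or (p q : form) : form := Imp (Neg p) q.
Definition Ex (p : form) : form := Neg (All (Neg p)).

Definition scons {A : Type} (x : A) (f : nat -> A) (i : nat) : A :=
  match i with 0 => x | S j => f j end.

Fixpoint tsubst (sg : nat -> term) (t : term) : term :=
  match t with
  | Var i => sg i
  | Zero => Zero
  | Succ t => Succ (tsubst sg t)
  | Plus s t => Plus (tsubst sg s) (tsubst sg t)
  | Mult s t => Mult (tsubst sg s) (tsubst sg t)
  end.

Definition tlift (t : term) : term := tsubst (fun i => Var (S i)) t.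

Definition up (sg : nat -> term) : nat -> term :=
  scons (Var 0) (fun i => tlift (sg i)).

Fixpoint fsubst (sg : nat -> term) (p : form) : form :=
  match p with
  | Bot => Bot
  | Eq s t => Eq (tsubst sg s) (tsubst sg t)
  | Imp p q => Imp (fsubst sg p) (fsubst sg q)
  | All p => All (fsubst (up sg) p)
  end.

Lemma tsubst_ext sg sg' t :
  (forall i, sg i = sg' i) -> tsubst sg t = tsubst sg' t.
Proof. intros H; induction t; simpl; congruence. Qed.

Lemma fsubst_ext p : forall sg sg',
  (forall i, sg i = sg' i) -> fsubst sg p = fsubst sg' p.
Proof.
  induction p; intros sg sg' H; simpl; f_equal; auto using tsubst_ext.
  apply IHp. intros [|i]; simpl; congruence.
Qed.

Lemma tsubst_comp sg sg' t :
  tsubst sg (tsubst sg' t) = tsubst (fun i => tsubst sg (sg' i)) t.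
Proof. induction t; simpl; congruence. Qed.

Lemma fsubst_comp p : forall sg sg',
  fsubst sg (fsubst sg' p) = fsubst (fun i => tsubst sg (sg' i)) p.
Proof.
  induction p; intros sg sg'; simpl; f_equal; auto using tsubst_comp.
  rewrite IHp. apply fsubst_ext. intros [|i]; simpl; [reflexivity|].
  unfold tlift. rewrite !tsubst_comp. reflexivity.
Qed.

Definition flift (p : form) : form := fsubst (fun i => Var (S i)) p.

(** [inst p t] replaces variable [0] by [t] and lowers the other indices. *)
Definition inst (p : form) (t : term) : form := fsubst (scons t Var) p.

Definition Le (s t : term) : form := Ex (Eq (Plus (Var 0) (tlift s)) (tlift t)).

Fixpoint tbounded (k : nat) (t : term) : Prop :=
  match t with
  | Var i => i < k
  | Zero => True
  | Succ t => tbounded k t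
  | Plus s t | Mult s t => tbounded k s /\ tbounded k t
  end.

(** All free variables of [p] have index below [k]. *)
Fixpoint bounded (k : nat) (p : form) : Prop :=
  match p with
  | Bot => True
  | Eq s t => tbounded k s /\ tbounded k t
  | Imp p q => bounded k p /\ bounded k q
  | All p => bounded (S k) p
  end.

Definition sentence (p : form) : Prop := bounded 0 p.

Fixpoint eval (r : nat -> nat) (t : term) : nat :=
  match t with
  | Var i => r i
  | Zero => 0
  | Succ t => S (eval r t)
  | Plus s t => eval r s + eval r t
  | Mult s t => eval r s * eval r t
  end.

Fixpoint sat (r : nat -> nat) (p : form) : Prop :=
  match p with
  | Bot => False
  | Eq s t => eval r s = eval r t
  | Imp p q => sat r p -> sat r q
  | All p => forall x, sat (scons x r) p
  end.

Definition true_in_N (p : form) : Prop := forall r, sat r p.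

(** ** The arithmetical hierarchy *)

(** [Le] is an abbreviation here, so it is admitted among the atoms. *)
Inductive delta0 : form -> Prop :=
| delta0_bot : delta0 Bot
| delta0_eq s t : delta0 (Eq s t)
| delta0_le s t : delta0 (Le s t)
| delta0_imp p q : delta0 p -> delta0 q -> delta0 (Imp p q)
| delta0_all t p : delta0 p -> delta0 (All (Imp (Le (Var 0) (tlift t)) p)).

Inductive isSigma : nat -> form -> Prop :=
| Sigma_delta0 n p : delta0 p -> isSigma n p
| Sigma_Pi n p : isPi n p -> isSigma (S n) p
| Sigma_ex n p : isSigma (S n) p -> isSigma (S n) (Ex p)
with isPi : nat -> form -> Prop :=
| Pi_delta0 n p : delta0 p -> isPi n p
| Pi_Sigma n p : isSigma n p -> isPi (S n) p
| Pi_all n p : isPi (S n) p -> isPi (S n) (All p).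

(** ** Provability *)

Definition theory : Type := form -> Prop.

Inductive logical_axiom : theory :=
| ax_K p q : logical_axiom (Imp p (Imp q p))
| ax_S p q r :
    logical_axiom (Imp (Imp p (Imp q r)) (Imp (Imp p q) (Imp p r)))
| ax_DN p : logical_axiom (Imp (Neg (Neg p)) p)
| ax_inst p t : logical_axiom (Imp (All p) (inst p t))
| ax_dist p q : logical_axiom (Imp (All (Imp p q)) (Imp (All p) (All q)))
| ax_vac p : logical_axiom (Imp p (All (flift p)))
| ax_refl t : logical_axiom (Eq t t)
| ax_euclid s t u : logical_axiom (Imp (Eq s t) (Imp (Eq s u) (Eq t u)))
| ax_succ s t : logical_axiom (Imp (Eq s t) (Eq (Succ s) (Succ t)))
| ax_plus s t u w :
    logical_axiom (Imp (Eq s t) (Imp (Eq u w) (Eq (Plus s u) (Plus t w))))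
| ax_mult s t u w :
    logical_axiom (Imp (Eq s t) (Imp (Eq u w) (Eq (Mult s u) (Mult t w)))).

Inductive provable (T : theory) : theory :=
| provable_log p : logical_axiom p -> provable T p
| provable_ax p : T p -> provable T p
| provable_mp p q : provable T (Imp p q) -> provable T p -> provable T q
| provable_gen p : provable T p -> provable T (All p).

(** ** Peano arithmetic *)

Definition pa_axioms : list form :=
  [ All (Neg (Eq (Succ (Var 0)) Zero));
    All (All (Imp (Eq (Succ (Var 1)) (Succ (Var 0))) (Eq (Var 1) (Var 0))));
    All (Eq (Plus (Var 0) Zero) (Var 0));
    All (All (Eq (Plus (Var 1) (Succ (Var 0))) (Succ (Plus (Var 1) (Var 0)))));
    All (Eq (Mult (Var 0) Zero) Zero);
    All (All (Eq (Mult (Var 1) (Succ (Var 0)))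
                 (Plus (Mult (Var 1) (Var 0)) (Var 1)))) ].

(** [p(x+1)], where [x] is variable [0]. *)
Definition fsucc (p : form) : form :=
  fsubst (scons (Succ (Var 0)) (fun i => Var (S i))) p.

(** Parameters of an induction axiom are left free; generalization closes
    them. *)
Definition induction (p : form) : form :=
  Imp (inst p Zero) (Imp (All (Imp p (fsucc p))) (All p)).

Inductive PA : theory :=
| PA_basic p : In p pa_axioms -> PA p
| PA_induction p : PA (induction p).

(** * Goedel numbers and numerals *)

Definition pair (x y : nat) : nat := (x + y) * (x + y) + x.

Fixpoint tcode (t : term) : nat :=
  match t with
  | Var i => pair 0 i
  | Zero => pair 1 0
  | Succ t => pair 2 (tcode t)
  | Plus s t => pair 3 (pair (tcode s) (tcode t))
  | Mult s t => pair 4 (pair (tcode s) (tcode t))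
  end.

Fixpoint fcode (p : form) : nat :=
  match p with
  | Bot => pair 5 0
  | Eq s t => pair 6 (pair (tcode s) (tcode t))
  | Imp p q => pair 7 (pair (fcode p) (fcode q))
  | All p => pair 8 (fcode p)
  end.

Fixpoint num (n : nat) : term :=
  match n with 0 => Zero | S n => Succ (num n) end.

Lemma tsubst_num sg n : tsubst sg (num n) = num n.
Proof. induction n; simpl; congruence. Qed.

(** Numerals of Goedel numbers are far too large to be computed. *)
#[global] Opaque num tcode fcode.

(** * Partial computable functions and Kleene's O *)

(** [computes e x y] means [{e}(x) = y].  Indices [e] code unary programs
    (zero, successor, identity, projections, pairing, composition, primitive
    recursion, unbounded search) over [pair]; an [e] that is not such a code
    indexes the nowhere defined function.  Search applied to [pair x n] finds
    the least [m >= n] with [{f}(pair x m) = 0]. *)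
Inductive computes : nat -> nat -> nat -> Prop :=
| c_zero x : computes (pair 0 0) x 0
| c_succ x : computes (pair 1 0) x (S x)
| c_id x : computes (pair 2 0) x x
| c_fst x y : computes (pair 3 0) (pair x y) x
| c_snd x y : computes (pair 4 0) (pair x y) y
| c_pair f g x y z :
    computes f x y -> computes g x z ->
    computes (pair 5 (pair f g)) x (pair y z)
| c_comp f g x y z :
    computes g x y -> computes f y z -> computes (pair 6 (pair f g)) x z
| c_rec0 f g x y :
    computes f x y -> computes (pair 7 (pair f g)) (pair x 0) y
| c_recS f g x n y z :
    computes (pair 7 (pair f g)) (pair x n) y ->
    computes g (pair x (pair n y)) z ->
    computes (pair 7 (pair f g)) (pair x (S n)) z
| c_mu0 f x n :
    computes f (pair x n) 0 -> computes (pair 8 f) (pair x n) n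
| c_muS f x n y m :
    computes f (pair x n) (S y) -> computes (pair 8 f) (pair x (S n)) m ->
    computes (pair 8 f) (pair x n) m.

Inductive kleeneO : nat -> Prop :=
| O_one : kleeneO 1
| O_succ a : kleeneO a -> kleeneO (2 ^ a)
| O_lim e f :
    (forall n, computes e n (f n)) ->
    (forall n, kleeneO (f n)) ->
    (forall n, ltO (f n) (f (S n))) ->
    kleeneO (3 * 5 ^ e)
with ltO : nat -> nat -> Prop :=
| ltO_succ a : kleeneO a -> ltO a (2 ^ a)
| ltO_lim e n b : kleeneO (3 * 5 ^ e) -> computes e n b -> ltO b (3 * 5 ^ e)
| ltO_trans a b c : ltO a b -> ltO b c -> ltO a c.

(** * Countable ordinals *)

(** Trees for countable ordinals; [osup f] is the supremum of the [f n], and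
    the order compares the ordinals denoted. *)
Inductive ord : Type :=
| ozero
| osucc (x : ord)
| osup (f : nat -> ord).

Inductive ole : ord -> ord -> Prop :=
| ole_zero y : ole ozero y
| ole_succ x y : ole x y -> ole (osucc x) (osucc y)
| ole_sup f y : (forall n, ole (f n) y) -> ole (osup f) y
| ole_member x f n : ole x (f n) -> ole x (osup f).

Definition oeq (x y : ord) : Prop := ole x y /\ ole y x.

Fixpoint oadd (x y : ord) : ord :=
  match y with
  | ozero => x
  | osucc y => osucc (oadd x y)
  | osup f => osup (fun n => oadd x (f n))
  end.

Fixpoint omul (x y : ord) : ord :=
  match y with
  | ozero => ozero
  | osucc y => oadd (omul x y) x
  | osup f => osup (fun n => omul x (f n))
  end.

Fixpoint ofin (n : nat) : ord :=
  match n with 0 => ozero | S n => osucc (ofin n) end.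

Definition omega : ord := osup ofin.

Fixpoint opow (x : ord) (n : nat) : ord :=
  match n with 0 => ofin 1 | S n => omul (opow x n) x end.

Inductive denotes : nat -> ord -> Prop :=
| denotes_one : denotes 1 ozero
| denotes_succ a x : denotes a x -> denotes (2 ^ a) (osucc x)
| denotes_lim e f g :
    (forall n, computes e n (f n)) ->
    (forall n, denotes (f n) (g n)) ->
    denotes (3 * 5 ^ e) (osup g).

(** [|a| = x] *)
Definition has_ordinal (a : nat) (x : ord) : Prop :=
  exists y, denotes a y /\ oeq y x.

(** * Arithmetization *)

(** Formulas are written below in higher-order style: a [tm] or [fm] is a
    term or formula as a function of the number of binders above it, and
    [fall]/[fex] pass the bound variable (a de Bruijn level) to their body. *)

Definition tm : Type := nat -> term.
Definition fm : Type := nat -> form.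

Definition bvar (l : nat) : tm := fun d => Var (d - S l).
Definition fvar (i : nat) : tm := fun d => Var (i + d).

Definition tnum (n : nat) : tm := fun _ => num n.
Definition tsucc (t : tm) : tm := fun d => Succ (t d).
Definition tplus (s t : tm) : tm := fun d => Plus (s d) (t d).
Definition tmult (s t : tm) : tm := fun d => Mult (s d) (t d).

Definition feq (s t : tm) : fm := fun d => Eq (s d) (t d).
Definition fle (s t : tm) : fm := fun d => Le (s d) (t d).
Definition fimp (p q : fm) : fm := fun d => Imp (p d) (q d).
Definition fconj (p q : fm) : fm := fun d => And (p d) (q d).
Definition fdisj (p q : fm) : fm := fun d => Or (p d) (q d).
Definition fall (p : tm -> fm) : fm := fun d => All (p (bvar d) (S d)).
Definition fex (p : tm -> fm) : fm := fun d => Ex (p (bvar d) (S d)).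

(** [lamK p] is the formula [p] of its free variables [0 .. K-1], and
    [app P ts] substitutes [ts] for the free variables of such a [P]. *)
Definition lam1 (p : tm -> fm) : form := p (fvar 0) 0.
Definition lam2 (p : tm -> tm -> fm) : form := p (fvar 0) (fvar 1) 0.
Definition lam3 (p : tm -> tm -> tm -> fm) : form :=
  p (fvar 0) (fvar 1) (fvar 2) 0.
Definition lam4 (p : tm -> tm -> tm -> tm -> fm) : form :=
  p (fvar 0) (fvar 1) (fvar 2) (fvar 3) 0.
Definition app (P : form) (ts : list tm) : fm :=
  fun d => fsubst (fun i => nth i ts (tnum 0) d) P.

Declare Scope fm_scope.
Delimit Scope fm_scope with fm.
Notation "# n" := (tnum n) (at level 1, format "# n") : fm_scope.
Notation "s =' t" := (feq s t) (at level 70) : fm_scope.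
Notation "s <=' t" := (fle s t) (at level 70) : fm_scope.
Notation "s <' t" := (fle (tsucc s) t) (at level 70) : fm_scope.
Notation "p /\' q" := (fconj p q) (at level 80, right associativity) : fm_scope.
Notation "p \/' q" := (fdisj p q) (at level 85, right associativity) : fm_scope.
Notation "p ->' q" := (fimp p q) (at level 99, right associativity) : fm_scope.
Notation "∀' x .. y , p" :=
  (fall (fun x => .. (fall (fun y => p)) ..))
  (at level 200, x binder, y binder, right associativity) : fm_scope.
Notation "∃' x .. y , p" :=
  (fex (fun x => .. (fex (fun y => p)) ..))
  (at level 200, x binder, y binder, right associativity) : fm_scope.
Local Open Scope fm_scope.

(** ** Inductive definitions in arithmetic *)

(** [y] is the remainder of [c] modulo [1 + (i + 1) d]. *)
Definition Beta : form := lam4 (fun c d i y =>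
  let m := tsucc (tmult (tsucc i) d) in
  y <' m /\' ∃' q, c =' tplus (tmult q m) y).

(** The least predicate closed under [rule], for [rule] positive in its first
    argument: [x] is the last entry of a finite sequence (coded by [c], [d])
    each entry of which satisfies [rule] relative to the earlier ones. *)
Definition lfp (rule : (tm -> fm) -> tm -> fm) (x : tm) : fm :=
  ∃' c d n, app Beta [c; d; n; x] /\'
    ∀' i, i <=' n ->'
      ∃' y, app Beta [c; d; i; y] /\'
        rule (fun z => ∃' j, j <' i /\' app Beta [c; d; j; z]) y.

(** ** Syntax *)

Definition tpair (x y : tm) : tm :=
  tplus (tmult (tplus x y) (tplus x y)) x.
Definition tpair3 (x y z : tm) : tm := tpair x (tpair y z).
Definition tpair4 (x y z w : tm) : tm := tpair x (tpair3 y z w).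

Definition cVar (i : tm) : tm := tpair #0 i.
Definition cZero : tm := tpair #1 #0.
Definition cSucc (t : tm) : tm := tpair #2 t.
Definition cPlus (s t : tm) : tm := tpair #3 (tpair s t).
Definition cMult (s t : tm) : tm := tpair #4 (tpair s t).
Definition cBot : tm := tpair #5 #0.
Definition cEq (s t : tm) : tm := tpair #6 (tpair s t).
Definition cImp (p q : tm) : tm := tpair #7 (tpair p q).
Definition cAll (p : tm) : tm := tpair #8 p.
Definition cNeg (p : tm) : tm := cImp p cBot.

(** Closed terms denoting Goedel numbers. *)
Fixpoint tquote (t : term) : tm :=
  match t with
  | Var i => cVar #i
  | Zero => cZero
  | Succ t => cSucc (tquote t)
  | Plus s t => cPlus (tquote s) (tquote t)
  | Mult s t => cMult (tquote s) (tquote t)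
  end.

Fixpoint fquote (p : form) : tm :=
  match p with
  | Bot => cBot
  | Eq s t => cEq (tquote s) (tquote t)
  | Imp p q => cImp (fquote p) (fquote q)
  | All p => cAll (fquote p)
  end.

(** [c] codes the numeral of [n]. *)
Definition Num : form := lam2 (fun n c =>
  lfp (fun self x =>
         x =' tpair #0 cZero \/'
         ∃' n c, self (tpair n c) /\' x =' tpair (tsucc n) (cSucc c))
    (tpair n c)).

(** [c] codes a term, resp. formula, with free variables below [k]. *)
Definition TermB : form := lam2 (fun k c =>
  lfp (fun self x =>
         (∃' i, i <' k /\' x =' cVar i) \/'
         x =' cZero \/'
         (∃' t, self t /\' x =' cSucc t) \/'
         (∃' s t, self s /\' self t /\' (x =' cPlus s t \/' x =' cMult s t)))
    c).

Definition FormB : form := lam2 (fun k c =>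
  lfp (fun self x =>
         ∃' k c, x =' tpair k c /\'
           (c =' cBot \/'
            (∃' s t, app TermB [k; s] /\' app TermB [k; t] /\' c =' cEq s t) \/'
            (∃' p q, self (tpair k p) /\' self (tpair k q) /\'
                     c =' cImp p q) \/'
            (∃' p, self (tpair (tsucc k) p) /\' c =' cAll p)))
    (tpair k c)).

Definition isTerm (c : tm) : fm := ∃' k, app TermB [k; c].
Definition isForm (c : tm) : fm := ∃' k, app FormB [k; c].

(** [c] and [c'] have the same outermost constructor, not a variable, and
    their immediate parts are related by [R], or by [R'] under a quantifier. *)
Definition same_shape (R R' : tm -> tm -> fm) (c c' : tm) : fm :=
  (c =' cZero /\' c' =' cZero) \/'
  (c =' cBot /\' c' =' cBot) \/'
  (∃' t t', R t t' /\' c =' cSucc t /\' c' =' cSucc t') \/'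
  (∃' s t s' t', R s s' /\' R t t' /\'
     ((c =' cPlus s t /\' c' =' cPlus s' t') \/'
      (c =' cMult s t /\' c' =' cMult s' t') \/'
      (c =' cEq s t /\' c' =' cEq s' t') \/'
      (c =' cImp s t /\' c' =' cImp s' t'))) \/'
  (∃' p p', R' p p' /\' c =' cAll p /\' c' =' cAll p').

(** [c'] is [c] with all variable indices [>= k] raised by one. *)
Definition Lift : form := lam3 (fun k c c' =>
  lfp (fun self x =>
         ∃' k c c', x =' tpair3 k c c' /\'
           ((∃' i, i <' k /\' c =' cVar i /\' c' =' cVar i) \/'
            (∃' i, k <=' i /\' c =' cVar i /\' c' =' cVar (tsucc i)) \/'
            same_shape (fun p p' => self (tpair3 k p p'))
                       (fun p p' => self (tpair3 (tsucc k) p p')) c c'))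
    (tpair3 k c c')).

(** [c'] is [c] with variable [k] replaced by the term [u] and all larger
    indices lowered by one. *)
Definition Subst : form := lam4 (fun k u c c' =>
  lfp (fun self x =>
         ∃' k u c c', x =' tpair4 k u c c' /\'
           ((∃' i, i <' k /\' c =' cVar i /\' c' =' cVar i) \/'
            (c =' cVar k /\' c' =' u) \/'
            (∃' i, k <=' i /\' c =' cVar (tsucc i) /\' c' =' cVar i) \/'
            same_shape
              (fun p p' => self (tpair4 k u p p'))
              (fun p p' => ∃' u', app Lift [#0; u; u'] /\'
                                  self (tpair4 (tsucc k) u' p p')) c c'))
    (tpair4 k u c c')).

(** [c'] is [c] with the numeral of [n] substituted for variable [0]. *)
Definition InstNum : form := lam3 (fun c n c' =>
  ∃' u, app Num [n; u] /\' app Subst [#0; u; c; c']).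

(** ** Provability *)

Definition LogAx : form := lam1 (fun x =>
  (∃' p q, isForm p /\' isForm q /\' x =' cImp p (cImp q p)) \/'
  (∃' p q r, isForm p /\' isForm q /\' isForm r /\'
     x =' cImp (cImp p (cImp q r)) (cImp (cImp p q) (cImp p r))) \/'
  (∃' p, isForm p /\' x =' cImp (cNeg (cNeg p)) p) \/'
  (∃' p t p', isForm p /\' isTerm t /\' app Subst [#0; t; p; p'] /\'
     x =' cImp (cAll p) p') \/'
  (∃' p q, isForm p /\' isForm q /\'
     x =' cImp (cAll (cImp p q)) (cImp (cAll p) (cAll q))) \/'
  (∃' p p', isForm p /\' app Lift [#0; p; p'] /\' x =' cImp p (cAll p')) \/'
  (∃' t, isTerm t /\' x =' cEq t t) \/'
  (∃' s t u, isTerm s /\' isTerm t /\' isTerm u /\'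
     x =' cImp (cEq s t) (cImp (cEq s u) (cEq t u))) \/'
  (∃' s t, isTerm s /\' isTerm t /\'
     x =' cImp (cEq s t) (cEq (cSucc s) (cSucc t))) \/'
  (∃' s t u w, isTerm s /\' isTerm t /\' isTerm u /\' isTerm w /\'
     (x =' cImp (cEq s t) (cImp (cEq u w) (cEq (cPlus s u) (cPlus t w))) \/'
      x =' cImp (cEq s t) (cImp (cEq u w) (cEq (cMult s u) (cMult t w)))))).

(** Provability in the theory whose axioms are defined by [ax]. *)
Definition prv (ax : tm -> fm) (x : tm) : fm :=
  lfp (fun self x =>
         app LogAx [x] \/'
         ax x \/'
         (∃' y, self (cImp y x) /\' self y) \/'
         (∃' y, self y /\' x =' cAll y))
    x.

Definition PAAx : form := lam1 (fun x =>
  fold_right (fun p f => x =' fquote p \/' f)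
    (∃' p p0 p1 ps, isForm p /\' app Subst [#0; cZero; p; p0] /\'
       app Lift [#1; p; p1] /\' app Subst [#0; cSucc (cVar #0); p1; ps] /\'
       x =' cImp p0 (cImp (cAll (cImp p ps)) (cAll p)))
    pa_axioms).

(** ** Computations *)

Definition Comp : form := lam3 (fun e x y =>
  lfp (fun self w =>
         (∃' x, w =' tpair3 (tpair #0 #0) x #0) \/'
         (∃' x, w =' tpair3 (tpair #1 #0) x (tsucc x)) \/'
         (∃' x, w =' tpair3 (tpair #2 #0) x x) \/'
         (∃' x y, w =' tpair3 (tpair #3 #0) (tpair x y) x) \/'
         (∃' x y, w =' tpair3 (tpair #4 #0) (tpair x y) y) \/'
         (∃' f g x y z, self (tpair3 f x y) /\' self (tpair3 g x z) /\'
            w =' tpair3 (tpair #5 (tpair f g)) x (tpair y z)) \/'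
         (∃' f g x y z, self (tpair3 g x y) /\' self (tpair3 f y z) /\'
            w =' tpair3 (tpair #6 (tpair f g)) x z) \/'
         (∃' f g x y, self (tpair3 f x y) /\'
            w =' tpair3 (tpair #7 (tpair f g)) (tpair x #0) y) \/'
         (∃' f g x n y z,
            self (tpair3 (tpair #7 (tpair f g)) (tpair x n) y) /\'
            self (tpair3 g (tpair x (tpair n y)) z) /\'
            w =' tpair3 (tpair #7 (tpair f g)) (tpair x (tsucc n)) z) \/'
         (∃' f x n, self (tpair3 f (tpair x n) #0) /\'
            w =' tpair3 (tpair #8 f) (tpair x n) n) \/'
         (∃' f x n y m, self (tpair3 f (tpair x n) (tsucc y)) /\'
            self (tpair3 (tpair #8 f) (tpair x (tsucc n)) m) /\'
            w =' tpair3 (tpair #8 f) (tpair x n) m))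
    (tpair3 e x y)).

(** [y = k ^ n] *)
Definition Pow (k : nat) : form := lam2 (fun n y =>
  lfp (fun self x =>
         x =' tpair #0 #1 \/'
         ∃' n y, self (tpair n y) /\' x =' tpair (tsucc n) (tmult #k y))
    (tpair n y)).

(** * Iterated uniform reflection *)

(** [a] is [2^b], or [a] is [3*5^e] and [b = {e}(n)] for some [n]. *)
Definition Below : form := lam2 (fun b a =>
  app (Pow 2) [b; a] \/'
  ∃' e p n, app (Pow 5) [e; p] /\' a =' tmult #3 p /\' app Comp [e; n; b]).

(** The self-reference in the axioms of the iterates is resolved by
    diagonalization.  In [ReflV], [AxV] and [UPrvV] the variable [v] stands for
    the Goedel number of [UPrvV] itself, whose numeral replaces it in [Ax] and
    [UPrv].  Thus [InstNum(v, v, -)] is the Goedel number of [UPrv] (see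
    [UPrv_diag]), and [ReflV(v, b, y)] says that [y] codes [reflection b p] for
    some [p]. *)
Definition ReflV : form := lam3 (fun v b y =>
  ∃' p w w' w'', app FormB [#1; p] /\'
    app InstNum [v; v; w] /\' app InstNum [w; b; w'] /\'
    app InstNum [w'; p; w''] /\'
    y =' cAll (cImp w'' p)).

(** [y] codes an axiom of the [a]-th iterate.  As the axioms of PA belong to
    every iterate, they need not be restricted to the third clause. *)
Definition AxV : form := lam3 (fun v a y =>
  lfp (fun self x =>
         ∃' a y, x =' tpair a y /\'
           (app PAAx [y] \/'
            ∃' b, app Below [b; a] /\'
              (self (tpair b y) \/' app ReflV [v; b; y])))
    (tpair a y)).

Definition UPrvV : form := lam4 (fun v b p x =>
  ∃' z, app InstNum [p; x; z] /\' prv (fun y => app AxV [v; b; y]) z).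

(** [Ax(a, y)]: [y] codes an axiom of the [a]-th iterate. *)
Definition Ax : form := inst AxV (num (fcode UPrvV)).

(** [UPrv(b, p, x)]: the formula coded by [p], with the numeral of [x]
    substituted for its variable [0], is provable in the [b]-th iterate. *)
Definition UPrv : form := lam3 (fun b p x =>
  ∃' z, app InstNum [p; x; z] /\' prv (fun y => app Ax [b; y]) z).

Lemma fsubst_app sg P ts d P' ts' d' :
  fsubst (fun i => tsubst sg (nth i ts #0 d)) P =
    fsubst (fun i => nth i ts' #0 d') P' ->
  fsubst sg (app P ts d) = app P' ts' d'.
Proof. intros H. unfold app. rewrite <- H. apply fsubst_comp. Qed.

Lemma UPrv_diag : inst UPrvV (num (fcode UPrvV)) = UPrv.
Proof.
  unfold UPrv, Ax. generalize (fcode UPrvV). intros N.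
  pose proof (fun sg => tsubst_num sg N) as Hu. revert Hu.
  generalize (num N). intros u Hu.
  unfold inst, UPrvV, prv, lfp. generalize fsubst_app.
  generalize app as A, Beta as B, LogAx as L, AxV as X, InstNum as I.
  intros A B L X I HA.
  cbv -[num fsubst nth tnum tsubst Nat.sub]. cbn [fsubst].
  repeat match goal with
    | |- Imp _ _ = Imp _ _ => f_equal
    | |- All _ = All _ => f_equal
    | |- Eq _ _ = Eq _ _ => f_equal
    end.
  all: apply HA; clear A HA; rewrite ?fsubst_comp; apply fsubst_ext; intros i.
  all: do 5 (destruct i as [|i];
    [cbn; unfold tnum, tlift; rewrite ?tsubst_num, ?Hu; reflexivity|]).
  all: cbn; unfold tnum; rewrite ?tsubst_num; reflexivity.
Qed.

(** [forall x, Prv_b(p(x dot)) -> p(x)], where [Prv_b] is built from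
    [Ax(b, -)] and [b] is given by its numeral. *)
Definition reflection (b : nat) (p : form) : form :=
  All (Imp (inst (inst UPrv (num b)) (num (fcode p))) p).

(** [Rfn b T] is the extension of [T] by uniform reflection, for [T] the
    theory with axioms given by [Ax(b, -)]. *)
Definition Rfn (b : nat) (T : theory) : theory := fun q =>
  T q \/ exists p, bounded 1 p /\ q = reflection b p.

(** [RFN_PA a] is the [a]-th iterate over PA, for an arbitrary number [a].
    Since [1 = 2 ^ 0], clause [RFN_succ] makes [RFN_PA 1] the reflection
    extension of [RFN_PA 0], which is PA. *)
Inductive RFN_PA : nat -> theory :=
| RFN_succ a q : Rfn a (RFN_PA a) q -> RFN_PA (2 ^ a) q
| RFN_lim_PA e q : PA q -> RFN_PA (3 * 5 ^ e) q
| RFN_lim e n a q :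
    computes e n a -> Rfn a (RFN_PA a) q -> RFN_PA (3 * 5 ^ e) q
| RFN_other a q :
    (forall b, a <> 2 ^ b) -> (forall e, a <> 3 * 5 ^ e) ->
    PA q -> RFN_PA a q.

(* Main.v *)
From Stdlib Require Import Arith List Lia Classical ClassicalEpsilon
  FunctionalExtensionality PropExtensionality ProofIrrelevance Ring Setoid Cantor.
Require Import Defs.
Import ListNotations.

(** Write [T_a] for the [a]-th iterate. By the completeness theorem
    ([completeness]), PA proves what holds in all its models, so that provability
    in PA and in the iterates can be established by arguments about an arbitrary,
    possibly nonstandard, model.

    Descending sequences. Suppose that [S] is a formula such that, in all models of
    PA, every [a] with [S(a)] has some [b] with [S(b)] and [2 ^ b] immediately below
    [a]; and that [S(L)] holds wherever [phi] fails. Then [T_(2 ^ L)], which contains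
    reflection for [T_L], proves [phi] ([reflection_excludes_descent]). For let
    [diag(x)] say: if [S(x)], then [diag(c)] is not provable in [T_(2 ^ c)] for some
    [c] with [S(c)]. PA proves that reflection for [T_a] implies [diag(a)]
    ([refl_diag]): given [S(a)] and [b] as above, either [diag(b)] is unprovable in
    [T_(2 ^ b)], or it is provable in [T_a], hence true, and the conclusion of
    [diag(b)] is that of [diag(a)]. Since [T_(2 ^ c)] proves the instance of reflection
    for [T_c], it proves [diag(c)], and this holds in PA for all [c] uniformly
    ([internal_reflection]). If [phi] failed in a model of [T_(2 ^ L)], then [diag(b)],
    being provable in [T_L], would be true there for some [b] with [S(b)], and some
    [diag(c)] would be unprovable, a contradiction.

    Notations from graphs. It remains to produce notations that descend if [phi] is
    false, and that are honest notations of the right size as [phi] is true. Let [E] be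
    a graph defined by a bounded formula. By self-reference there are programs whose
    limits are notations for the nodes of [E] above given notations: the fundamental
    sequence for the node [t] above [b] begins with [b], and the [m]-th step goes to
    the successor of a notation for the node [m] above the present value if [E t m], and
    to the successor of the present value otherwise ([graph_code]). An infinite path in
    [E] gives descending notations in every model ([descending_next]), while in the
    standard model, if there is no such path, the notation of a node denotes an ordinal
    that adds up those of its successors ([small_above], [root_above]).

    Graphs from formulas. For [n = 0] the negation of [phi] is [exists x, R x] with [R]
    bounded, and the graph has a root with an edge to a loop for each [x] with [R x].
    In general such a graph is defined by a relation [n] levels up, where a level
    [k + 1] relation and its complement are of the form [exists w, forall u, exists v, Q]
    with [Q] of level [k] and [w] unique; [closed_jump] shows that these relations are
    closed under bounded quantification, and so two quantifiers are absorbed per level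
    ([isPi_level]). A graph of level [k + 1] is replaced by a graph of level [k] on the
    finite histories of its paths together with the claimed witnesses [w], where a move
    requires that the claims made so far have been confirmed for [u] up to a bound that
    grows with the history ([step]). A path of the old graph gives a path of right
    histories. In the standard model, a history with a wrong claim has finitely many
    continuations; and of the right continuations of a history there is only one for each
    successor of its last node, so that the ordinals go up by one power of omega only
    ([step_below_small]). If [phi] is true then the root of the first graph has no
    successors, and after [n] replacements the notation of the root denotes at most
    [omega ^ (n + 1)] ([lower], [graph]).

    If this ordinal is smaller than [omega ^ (n + 1)], then [omega ^ (n + 1)] is added to
    it on top ([add_power]), which absorbs it and only makes the theory stronger. *)

(** * Structures and the completeness theorem *)

Record model : Type := mkModel {
  car :> Type;
  mz : car;
  ms : car -> car;
  mp : car -> car -> car;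
  mm : car -> car -> car }.

Arguments mz {m}.
Arguments ms {m}.
Arguments mp {m}.
Arguments mm {m}.

Fixpoint ev (M : model) (r : nat -> M) (t : term) : M :=
  match t with
  | Var i => r i
  | Zero => mz
  | Succ t => ms (ev M r t)
  | Plus s t => mp (ev M r s) (ev M r t)
  | Mult s t => mm (ev M r s) (ev M r t)
  end.

Fixpoint st (M : model) (r : nat -> M) (p : form) : Prop :=
  match p with
  | Bot => False
  | Eq s t => ev M r s = ev M r t
  | Imp p q => st M r p -> st M r q
  | All p => forall x, st M (scons x r) p
  end.

Lemma ev_ext (M : model) (r r' : nat -> M) t :
  (forall i, r i = r' i) -> ev M r t = ev M r' t.
Proof. intros H; induction t; simpl; congruence. Qed.

Lemma st_ext (M : model) p : forall (r r' : nat -> M),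
  (forall i, r i = r' i) -> (st M r p <-> st M r' p).
Proof.
  induction p as [|s t|p IHp q IHq|p IH]; intros r r' H; simpl.
  - tauto.
  - rewrite (ev_ext M r r' s), (ev_ext M r r' t) by assumption. tauto.
  - rewrite (IHp r r' H), (IHq r r' H). tauto.
  - split; intros H1 x; [rewrite <- (IH (scons x r)) | rewrite (IH _ (scons x r'))]; auto;
      intros [|i]; simpl; congruence.
Qed.

Lemma ev_subst (M : model) (r : nat -> M) sg t :
  ev M r (tsubst sg t) = ev M (fun i => ev M r (sg i)) t.
Proof. induction t; simpl; congruence. Qed.

Lemma st_subst (M : model) p : forall (r : nat -> M) sg,
  st M r (fsubst sg p) <-> st M (fun i => ev M r (sg i)) p.
Proof.
  induction p as [|s t|p IHp q IHq|p IH]; intros r sg; simpl.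
  - tauto.
  - rewrite !ev_subst. tauto.
  - rewrite IHp, IHq. tauto.
  - assert (E : forall x, st M (scons x r) (fsubst (up sg) p) <->
        st M (scons x (fun i => ev M r (sg i))) p).
    { intros x. rewrite IH. apply st_ext. intros [|i]; simpl; [reflexivity|].
      unfold tlift. rewrite ev_subst. apply ev_ext. reflexivity. }
    split; intros H x; apply E, H.
Qed.

(** ** Substitution and free variables *)

Lemma tsubst_agree k t : forall sg sg',
  tbounded k t -> (forall i, i < k -> sg i = sg' i) -> tsubst sg t = tsubst sg' t.
Proof.
  induction t; simpl; intros sg sg' Hb H; auto.
  - f_equal; auto.
  - destruct Hb; f_equal; auto.
  - destruct Hb; f_equal; auto.
Qed.

Lemma fsubst_agree p : forall k sg sg',
  bounded k p -> (forall i, i < k -> sg i = sg' i) -> fsubst sg p = fsubst sg' p.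
Proof.
  induction p as [|s t|p IHp q IHq|p IH]; simpl; intros k sg sg' Hb H; auto.
  - destruct Hb; f_equal; eauto using tsubst_agree.
  - destruct Hb; f_equal; eauto.
  - f_equal. apply (IH (S k)); auto. intros [|i] Hi; simpl; auto.
    rewrite H by lia; auto.
Qed.

Lemma tsubst_Var t : tsubst Var t = t.
Proof. induction t; simpl; congruence. Qed.

Lemma fsubst_Var p : forall sg, (forall i, sg i = Var i) -> fsubst sg p = p.
Proof.
  induction p as [|s t|p IHp q IHq|p IH]; simpl; intros sg H; auto.
  - rewrite <- (tsubst_Var s), <- (tsubst_Var t) at 2.
    f_equal; apply tsubst_ext; auto.
  - f_equal; auto.
  - f_equal. apply IH. intros [|i]; simpl; auto. rewrite H; reflexivity.
Qed.

Lemma fsubst_closed k p sg :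
  bounded k p -> (forall i, i < k -> sg i = Var i) -> fsubst sg p = p.
Proof.
  intros Hb H. rewrite <- (fsubst_Var p Var) at 2 by auto.
  eapply fsubst_agree; eauto.
Qed.

Lemma st_agree (M : model) p : forall k (r r' : nat -> M),
  bounded k p -> (forall i, i < k -> r i = r' i) -> (st M r p <-> st M r' p).
Proof.
  intros k r r' Hb H.
  assert (E : forall q (ra rb : nat -> M) k, bounded k q ->
    (forall i, i < k -> ra i = rb i) -> st M ra q -> st M rb q).
  { assert (Et : forall t k (ra rb : nat -> M), tbounded k t ->
      (forall i, i < k -> ra i = rb i) -> ev M ra t = ev M rb t).
    { induction t; simpl; intros; auto; try destruct H0; f_equal; eauto. }
    intros q.
    enough (E : forall (ra rb : nat -> M) k, bounded k q ->
      (forall i, i < k -> ra i = rb i) -> (st M ra q <-> st M rb q)).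
    { intros ra rb k0 H1 H2. apply (E ra rb k0); auto. }
    induction q as [|s t|p1 IHp q IHq|q IH]; simpl; intros ra rb k0 Hq Hr.
    - tauto.
    - destruct Hq. rewrite (Et s k0 ra rb), (Et t k0 ra rb); tauto.
    - destruct Hq. rewrite (IHp ra rb k0), (IHq ra rb k0); tauto.
    - split; intros H1 x.
      + rewrite <- (IH (scons x ra) (scons x rb) (S k0)); auto.
        intros [|i] Hi; simpl; auto. apply Hr; lia.
      + rewrite (IH (scons x ra) (scons x rb) (S k0)); auto.
        intros [|i] Hi; simpl; auto. apply Hr; lia. }
  split; apply (E p _ _ k); auto. intros; symmetry; auto.
Qed.

Lemma tbounded_le t j k : tbounded j t -> j <= k -> tbounded k t.
Proof. induction t; simpl; intuition lia. Qed.

Lemma bounded_le p : forall j k, bounded j p -> j <= k -> bounded k p.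
Proof.
  induction p as [|s t|p IHp q IHq|p IH]; simpl; intros j k Hb H; auto.
  - intuition eauto using tbounded_le.
  - intuition eauto.
  - apply (IH (S j)); auto. lia.
Qed.

Lemma tbounded_ex t : exists k, tbounded k t.
Proof.
  induction t; simpl.
  - exists (S i); lia.
  - exists 0; auto.
  - auto.
  - destruct IHt1 as [a Ha], IHt2 as [b Hb]. exists (a + b).
    split; eapply tbounded_le; eauto; lia.
  - destruct IHt1 as [a Ha], IHt2 as [b Hb]. exists (a + b).
    split; eapply tbounded_le; eauto; lia.
Qed.

Lemma bounded_ex p : exists k, bounded k p.
Proof.
  induction p as [|s t|p [a Ha] q [b Hb]|p [a Ha]]; simpl.
  - exists 0; auto.
  - destruct (tbounded_ex s) as [a Ha], (tbounded_ex t) as [b Hb]. exists (a + b).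
    split; eapply tbounded_le; eauto; lia.
  - exists (a + b). split; eapply bounded_le; eauto; lia.
  - exists a. eapply bounded_le; eauto.
Qed.

(** ** Theorems are closed under substitution *)

Fixpoint alls (k : nat) (p : form) : form :=
  match k with 0 => p | S k => All (alls k p) end.

Fixpoint upn (k : nat) (sg : nat -> term) : nat -> term :=
  match k with 0 => sg | S k => up (upn k sg) end.

Lemma up_ext sg sg' : (forall i, sg i = sg' i) -> forall i, up sg i = up sg' i.
Proof. intros H [|i]; simpl; congruence. Qed.

Lemma upn_ext k sg sg' : (forall i, sg i = sg' i) -> forall i, upn k sg i = upn k sg' i.
Proof. intros H; induction k; simpl; auto using up_ext. Qed.

Lemma upn_up k sg : forall i, upn k (up sg) i = up (upn k sg) i.
Proof. induction k; simpl; intros i; auto. apply up_ext; auto. Qed.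

Lemma fsubst_alls k p : forall sg, fsubst sg (alls k p) = alls k (fsubst (upn k sg) p).
Proof.
  induction k; simpl; intros sg; auto. f_equal. rewrite IHk. f_equal.
  apply fsubst_ext. intros i. rewrite upn_up. reflexivity.
Qed.

Lemma up_comp sg sg' i :
  tsubst (up sg) (up sg' i) = up (fun j => tsubst sg (sg' j)) i.
Proof.
  destruct i; simpl; auto. unfold tlift. rewrite !tsubst_comp.
  apply tsubst_ext. reflexivity.
Qed.

Lemma upn_comp k sg sg' i :
  tsubst (upn k sg) (upn k sg' i) = upn k (fun j => tsubst sg (sg' j)) i.
Proof.
  revert i; induction k; simpl; intros i; auto.
  rewrite up_comp. apply up_ext; auto.
Qed.

Lemma upn_low k sg i : i < k -> upn k sg i = Var i.
Proof.
  revert i; induction k; simpl; intros i Hi; [lia|].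
  destruct i; simpl; auto. rewrite IHk by lia. reflexivity.
Qed.

(** Generalize over all free variables, then instantiate the quantifiers one
    at a time, the outermost first. *)
Lemma provable_subst T p sg : provable T p -> provable T (fsubst sg p).
Proof.
  intros Hp. destruct (bounded_ex p) as [K HK].
  assert (Hg : provable T (alls K p)).
  { clear HK. induction K; simpl; auto using provable_gen. }
  enough (H : forall j, j <= K ->
    provable T (alls j (fsubst (upn j (fun i => sg (j + i))) p))).
  { apply (H 0); lia. }
  intros j Hj. replace j with (K - (K - j)) by lia.
  generalize (K - j) as m. clear j Hj. intros m.
  induction m as [|m IH].
  - rewrite Nat.sub_0_r. rewrite (fsubst_closed K p); auto.
    intros i Hi. apply upn_low; auto.
  - destruct (le_lt_dec K m) as [Hm|Hm].
    { replace (K - S m) with (K - m) by lia. exact IH. }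
    replace (K - m) with (S (K - S m)) in IH by lia.
    set (j := K - S m) in *. simpl in IH.
    apply (provable_mp (q := inst (alls j (fsubst (up (upn j (fun i => sg (S j + i)))) p))
      (sg j))) in IH; [|apply provable_log, ax_inst].
    unfold inst in IH. rewrite fsubst_alls, fsubst_comp in IH.
    erewrite fsubst_ext; [exact IH|]. intros i. symmetry.
    rewrite <- upn_up, upn_comp. apply upn_ext. intros [|i']; simpl.
    + f_equal; lia.
    + unfold tlift. rewrite tsubst_comp. simpl.
      rewrite tsubst_Var. f_equal; lia.
Qed.

(** ** Derivations from hypotheses *)

Section Derivations.
Variable T : theory.

Inductive der (G : form -> Prop) : form -> Prop :=
| der_thm p : provable T p -> der G p
| der_hyp p : G p -> der G p
| der_mp p q : der G (Imp p q) -> der G p -> der G q.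

Definition ext (G : form -> Prop) (p : form) : form -> Prop := fun q => q = p \/ G q.

Lemma der_weaken G G' p : der G p -> (forall q, G q -> G' q) -> der G' p.
Proof.
  intros H HG; induction H.
  - apply der_thm; auto.
  - apply der_hyp; auto.
  - eapply der_mp; eauto.
Qed.

Lemma der_log G p : logical_axiom p -> der G p.
Proof. intros; apply der_thm, provable_log; auto. Qed.

Lemma der_K G p q : der G p -> der G (Imp q p).
Proof. intros H. eapply der_mp; [apply der_log, ax_K|exact H]. Qed.

Lemma der_id G p : der G (Imp p p).
Proof.
  eapply der_mp; [eapply der_mp|].
  - apply der_log, (ax_S p (Imp p p) p).
  - apply der_log, ax_K.
  - apply der_log, ax_K.
Qed.

Lemma deduction G p q : der (ext G p) q -> der G (Imp p q).
Proof.
  intros H; induction H as [q H|q H|q1 q2 _ IH1 _ IH2].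
  - apply der_K, der_thm; auto.
  - destruct H as [->|H]; [apply der_id|apply der_K, der_hyp; auto].
  - eapply der_mp; [eapply der_mp|]; [apply der_log, ax_S| |]; eauto.
Qed.

Lemma der_bot G p : der G Bot -> der G p.
Proof.
  intros H. eapply der_mp; [apply der_log, ax_DN|]. apply der_K; auto.
Qed.

Lemma der_contra G p : der (ext G (Neg p)) Bot -> der G p.
Proof. intros H. eapply der_mp; [apply der_log, ax_DN|]. apply deduction, H. Qed.

Definition ofl (l : list form) : form -> Prop := fun p => In p l.

Definition imps (l : list form) (p : form) : form := fold_right Imp p l.

(** Hypotheses are discharged one by one; the inner induction moves [a] across
    the hypotheses [l] that were discharged before it. *)
Lemma der_imps l p : der (ofl l) p -> provable T (imps l p).
Proof.
  revert p; induction l as [|a l IH]; intros p H; simpl.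
  - induction H as [q H|q H|q1 q2 _ IH1 _ IH2]; auto; [destruct H|].
    eapply provable_mp; eauto.
  - assert (E : der (ofl l) (Imp a p)).
    { apply deduction. apply (der_weaken _ _ _ H). intros q [Hq|Hq]; [left|right]; auto. }
    apply IH in E. clear -E. revert E. induction l as [|b l IH]; simpl; auto.
    intros E.
    assert (D : der (ofl [a; b]) (imps l p)).
    { assert (D1 : der (ofl [a; b]) (Imp b (imps l (Imp a p)))) by (apply der_thm; exact E).
      assert (D2 : der (ofl [a; b]) (imps l (Imp a p))).
      { eapply der_mp; eauto. apply der_hyp; simpl; auto. }
      assert (Da : der (ofl [a; b]) a) by (apply der_hyp; simpl; auto).
      revert D2 Da. generalize (ofl [a; b]). clear. induction l as [|c l IH]; simpl; intros G D Da.
      - eapply der_mp; eauto.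
      - apply deduction. apply IH.
        + eapply der_mp; [apply (der_weaken _ _ _ D); right; auto|]. apply der_hyp; left; auto.
        + apply (der_weaken _ _ _ Da); right; auto. }
    assert (D1 : der (fun _ => False) (Imp a (Imp b (imps l p)))).
    { apply deduction, deduction. apply (der_weaken _ _ _ D).
      intros q [<-|[<-|[]]]; unfold ext; auto. }
    clear -D1. induction D1; auto; [contradiction|]. eapply provable_mp; eauto.
Qed.

Lemma der_gen G l : forall q,
  der G (All (imps (map flift l) q)) -> (forall g, In g l -> der G g) -> der G (All q).
Proof.
  induction l as [|a l IH]; simpl; intros q H Hl; auto.
  apply IH; [|auto].
  eapply der_mp; [eapply der_mp; [apply der_log, ax_dist|exact H]|].
  eapply der_mp; [apply der_log, ax_vac|]. auto.
Qed.

(** The rule of generalization is available only without hypotheses. So these are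
    first moved into the formula, where renaming the fresh variable [k] to [0]
    lifts them; distribution and vacuous quantification move them back. *)
Lemma der_fresh l k q :
  (forall g, In g l -> bounded k g) -> bounded (S k) q ->
  der (ofl l) (inst q (Var k)) -> der (ofl l) (All q).
Proof.
  intros Hl Hq H. apply der_imps in H.
  set (sg := fun i => if Nat.eq_dec i k then Var 0 else Var (S i)).
  apply (provable_subst _ _ sg) in H.
  assert (E : fsubst sg (imps l (inst q (Var k))) = imps (map flift l) q).
  { clear H. induction l as [|a l IH]; simpl.
    - unfold inst. rewrite fsubst_comp. apply (fsubst_closed (S k)); auto.
      intros [|i] Hi; simpl.
      + unfold sg. destruct (Nat.eq_dec k k); congruence.
      + unfold sg. destruct (Nat.eq_dec i k); auto. lia.
    - f_equal; [|apply IH; simpl in Hl; auto].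
      apply (fsubst_agree _ k); [apply Hl; simpl; auto|].
      intros i Hi. unfold sg. destruct (Nat.eq_dec i k); auto. lia. }
  rewrite E in H. apply (der_gen _ l).
  - apply der_thm, provable_gen, H.
  - intros; apply der_hyp; auto.
Qed.

End Derivations.

(** ** Enumeration of formulas *)

Lemma pair_inj x y x' y' : pair x y = pair x' y' -> x = x' /\ y = y'.
Proof.
  unfold pair. intros H.
  assert (x + y = x' + y').
  { destruct (lt_eq_lt_dec (x + y) (x' + y')) as [[L|E]|L]; auto; exfalso.
    - assert ((x + y + 1) * (x + y + 1) <= (x' + y') * (x' + y')) by (apply Nat.mul_le_mono; lia). lia.
    - assert ((x' + y' + 1) * (x' + y' + 1) <= (x + y) * (x + y)) by (apply Nat.mul_le_mono; lia). lia. }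
  rewrite H0 in H. lia.
Qed.

Lemma tcode_inj t : forall t', tcode t = tcode t' -> t = t'.
Proof.
  induction t; intros []; cbn [tcode]; intros H;
    apply pair_inj in H; destruct H as [E H]; try discriminate E; auto.
  all: try (apply pair_inj in H; destruct H).
  all: f_equal; auto.
Qed.

Lemma fcode_inj p : forall q, fcode p = fcode q -> p = q.
Proof.
  induction p; intros []; cbn [fcode]; intros H;
    apply pair_inj in H; destruct H as [E H]; try discriminate E; auto.
  all: try (apply pair_inj in H; destruct H).
  all: f_equal; auto using tcode_inj.
Qed.

(** Goedel numbers enumerate all formulas; other numbers are sent to arbitrary
    formulas. *)
Definition enum (n : nat) : form := epsilon (inhabits Bot) (fun p => fcode p = n).

Lemma enum_fcode p : enum (fcode p) = p.
Proof.
  apply fcode_inj. unfold enum.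
  apply (epsilon_spec (inhabits Bot) (fun q => fcode q = fcode p)). exists p; auto.
Qed.

(** ** Henkin's construction *)

Section Henkin.
Variables (T : theory) (p0 : form).
Hypothesis Hp0 : ~ provable T p0.

Definition con (l : list form) : Prop := ~ der T (ofl l) Bot.

(** Free variables play the role of Henkin constants: there is always one that
    does not occur in the finitely many formulas of a stage. *)
Definition witness (l : list form) (p : form) : list form :=
  match p with
  | Imp (All q) Bot =>
      let k := epsilon (inhabits 0) (fun k => forall g, In g (p :: l) -> bounded k g) in
      [Neg (inst q (Var k))]
  | _ => []
  end.

Fixpoint stage (n : nat) : list form :=
  match n with
  | 0 => [Neg p0]
  | S n =>
      let p := enum n in
      if excluded_middle_informative (con (p :: stage n))
      then witness (stage n) p ++ p :: stage n
      else stage n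
  end.

Lemma bounded_list l : exists k, forall g, In g l -> bounded k g.
Proof.
  induction l as [|a l [k Hk]]; [exists 0; simpl; tauto|].
  destruct (bounded_ex a) as [j Hj]. exists (j + k).
  intros g [<-|Hg]; [eapply bounded_le; eauto|eapply bounded_le; [apply Hk|]; auto]; lia.
Qed.

(** If the witness refuted the stage, the instance at the fresh variable would be
    derivable, hence the universal formula that the stage denies. *)
Lemma con_witness l p : con (p :: l) -> con (witness l p ++ p :: l).
Proof.
  intros H. destruct p as [| | p q |]; auto. destruct p as [| | |p]; auto.
  destruct q; auto. cbn [witness app].
  set (k := epsilon _ _).
  assert (Hk : forall g, In g (Imp (All p) Bot :: l) -> bounded k g).
  { apply (epsilon_spec (inhabits 0) (fun k => forall g, In g (Imp (All p) Bot :: l) -> bounded k g)).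
    apply bounded_list. }
  intros D. apply H.
  apply (der_mp _ _ (All p)); [apply der_hyp; left; reflexivity|].
  apply (der_fresh _ _ k); auto.
  - specialize (Hk _ (or_introl eq_refl)). simpl in Hk. tauto.
  - apply der_contra. apply (der_weaken _ _ _ _ D).
    intros q [<-|Hq]; [left|right]; auto.
Qed.

Lemma con_stage n : con (stage n).
Proof.
  induction n; cbn [stage].
  - intros D. apply Hp0. apply (der_weaken _ _ (ext (fun _ => False) (Neg p0))) in D.
    + apply der_contra in D. clear -D. induction D; auto; [contradiction|].
      eapply provable_mp; eauto.
    + intros q [<-|[]]; left; auto.
  - destruct excluded_middle_informative; auto. apply con_witness; auto.
Qed.

Definition Delta (p : form) : Prop := exists n, In p (stage n).

Lemma stage_mono m n p : m <= n -> In p (stage m) -> In p (stage n).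
Proof.
  intros H Hp; induction H; auto. cbn [stage].
  destruct excluded_middle_informative; auto. apply in_or_app; simpl; auto.
Qed.

Lemma der_compact p : der T Delta p -> exists n, der T (ofl (stage n)) p.
Proof.
  intros H; induction H as [p H|p [n H]|p q _ [n IH1] _ [m IH2]].
  - exists 0; apply der_thm; auto.
  - exists n; apply der_hyp; auto.
  - exists (n + m). apply (der_mp _ _ p); eapply der_weaken; eauto;
      intros g; apply stage_mono; lia.
Qed.

Lemma Delta_con : ~ der T Delta Bot.
Proof. intros H. apply der_compact in H. destruct H as [n H]. eapply con_stage; eauto. Qed.

(** A formula consistent with the limit is consistent with the stage at which it
    is considered, and so it is added there together with its witness. *)
Lemma Delta_stage p : ~ der T (ext Delta p) Bot ->
  In p (stage (S (fcode p))) /\ forall g, In g (witness (stage (fcode p)) p) -> Delta g.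
Proof.
  intros H. cbn [stage]. rewrite enum_fcode.
  destruct excluded_middle_informative as [C|C].
  - split; [apply in_or_app; simpl; auto|]. intros g Hg.
    exists (S (fcode p)). cbn [stage]. rewrite enum_fcode.
    destruct excluded_middle_informative; [apply in_or_app; auto|contradiction].
  - exfalso. apply C. intros D. apply H. apply (der_weaken _ _ _ _ D).
    intros q [<-|Hq]; [left; auto|right; exists (fcode p); auto].
Qed.

Lemma Delta_der p : der T Delta p -> Delta p.
Proof.
  intros H. exists (S (fcode p)). apply Delta_stage.
  intros D. apply Delta_con. apply deduction in D. eapply der_mp; eauto.
Qed.

Lemma Delta_neg p : ~ Delta p -> Delta (Neg p).
Proof.
  intros H. apply Delta_der, deduction. apply NNPP. intros D.
  apply H. exists (S (fcode p)). apply Delta_stage; auto.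
Qed.

Lemma Delta_imp p q : Delta (Imp p q) <-> (Delta p -> Delta q).
Proof.
  split.
  - intros H Hp. apply Delta_der. eapply der_mp; apply der_hyp; eauto.
  - intros H. destruct (classic (Delta p)) as [Hp|Hp].
    + apply Delta_der, der_K, der_hyp; auto.
    + apply Delta_neg in Hp. apply Delta_der, deduction, der_bot.
      eapply der_mp; apply der_hyp; [right; exact Hp|left; auto].
Qed.

Lemma Delta_mp p q : Delta (Imp p q) -> Delta p -> Delta q.
Proof. intros H. apply Delta_imp, H. Qed.

Lemma Delta_all q : Delta (All q) <-> forall t, Delta (inst q t).
Proof.
  split.
  - intros H t. apply Delta_der. eapply der_mp; [apply der_log, ax_inst|apply der_hyp; auto].
  - intros H. apply NNPP. intros Hn. apply Delta_neg in Hn.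
    assert (D : ~ der T (ext Delta (Neg (All q))) Bot).
    { intros D. apply Delta_con. apply deduction in D.
      eapply der_mp; [exact D|apply der_hyp; auto]. }
    apply Delta_stage in D. destruct D as [_ D].
    specialize (D _ (or_introl eq_refl)).
    apply Delta_con. eapply der_mp; apply der_hyp; [exact D|]. apply H.
Qed.

Lemma Delta_thm p : provable T p -> Delta p.
Proof. intros; apply Delta_der, der_thm; auto. Qed.

Lemma Delta_refl t : Delta (Eq t t).
Proof. apply Delta_thm, provable_log, ax_refl. Qed.

Lemma Delta_euclid s t u : Delta (Eq s t) -> Delta (Eq s u) -> Delta (Eq t u).
Proof.
  intros H1 H2. pose proof (Delta_thm _ (provable_log T (ax_euclid s t u))) as H.
  rewrite !Delta_imp in H. auto.
Qed.

Lemma Delta_sym s t : Delta (Eq s t) -> Delta (Eq t s).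
Proof. intros H. apply (Delta_euclid s); auto using Delta_refl. Qed.

Lemma Delta_trans s t u : Delta (Eq s t) -> Delta (Eq t u) -> Delta (Eq s u).
Proof. intros H. apply Delta_euclid, Delta_sym, H. Qed.

(** The elements of the term model are canonical representatives of the
    classes of provably equal terms. *)
Definition rep (t : term) : term := epsilon (inhabits Zero) (fun s => Delta (Eq t s)).

Lemma rep_eq t : Delta (Eq t (rep t)).
Proof.
  apply (epsilon_spec (inhabits Zero) (fun s => Delta (Eq t s))).
  exists t. apply Delta_refl.
Qed.

Lemma rep_iff s t : rep s = rep t <-> Delta (Eq s t).
Proof.
  split; intros H.
  - apply (Delta_trans _ (rep s)); [apply rep_eq|]. rewrite H.
    apply Delta_sym, rep_eq.
  - unfold rep. f_equal. apply functional_extensionality. intros u.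
    apply propositional_extensionality. split; apply Delta_trans; auto using Delta_sym.
Qed.

Definition tmcar : Type := {t : term | rep t = t}.

Definition cls (t : term) : tmcar :=
  exist _ (rep t) (proj2 (rep_iff (rep t) t) (Delta_sym _ _ (rep_eq t))).

Lemma cls_iff s t : cls s = cls t <-> Delta (Eq s t).
Proof.
  rewrite <- rep_iff. split; intros H.
  - apply (f_equal (@proj1_sig _ _)) in H. exact H.
  - unfold cls. apply eq_sig_hprop; auto. intros; apply proof_irrelevance.
Qed.

Lemma cls_surj x : exists t, x = cls t.
Proof.
  destruct x as [t Ht]. exists t. unfold cls. apply eq_sig_hprop; auto.
  intros; apply proof_irrelevance.
Qed.

Definition tmodel : model :=
  mkModel tmcar (cls Zero) (fun x => cls (Succ (proj1_sig x)))
    (fun x y => cls (Plus (proj1_sig x) (proj1_sig y)))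
    (fun x y => cls (Mult (proj1_sig x) (proj1_sig y))).

Lemma tmodel_ev sg t : ev tmodel (fun i => cls (sg i)) t = cls (tsubst sg t).
Proof.
  assert (R : forall t, Delta (Eq (rep t) t)) by (intros; apply Delta_sym, rep_eq).
  induction t; simpl; auto.
  - rewrite IHt. apply cls_iff. simpl.
    eapply Delta_mp; [apply Delta_thm, provable_log, ax_succ|apply R].
  - rewrite IHt1, IHt2. apply cls_iff. simpl.
    eapply Delta_mp; [eapply Delta_mp; [apply Delta_thm, provable_log, ax_plus|apply R]|apply R].
  - rewrite IHt1, IHt2. apply cls_iff. simpl.
    eapply Delta_mp; [eapply Delta_mp; [apply Delta_thm, provable_log, ax_mult|apply R]|apply R].
Qed.

Lemma Delta_bot : ~ Delta Bot.
Proof. intros H. apply Delta_con, der_hyp, H. Qed.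

Lemma tmodel_st p : forall sg,
  st tmodel (fun i => cls (sg i)) p <-> Delta (fsubst sg p).
Proof.
  induction p as [|s t|p IHp q IHq|p IH]; intros sg; cbn [st fsubst].
  - pose proof Delta_bot; tauto.
  - rewrite !tmodel_ev. apply cls_iff.
  - rewrite IHp, IHq, Delta_imp. tauto.
  - assert (E : forall t, st tmodel (scons (cls t) (fun i => cls (sg i))) p <->
        Delta (inst (fsubst (up sg) p) t)).
    { intros t. rewrite (st_ext tmodel p _ (fun i => cls (scons t sg i))) by (intros [|i]; reflexivity).
      rewrite IH. unfold inst. rewrite fsubst_comp.
      erewrite (fsubst_ext p); [reflexivity|].
      intros [|i]; simpl; auto. unfold tlift. rewrite tsubst_comp. simpl.
      rewrite tsubst_Var. reflexivity. }
    rewrite Delta_all. split.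
    + intros H t. apply E, H.
    + intros H x. destruct (cls_surj x) as [t ->]. apply E, H.
Qed.

Lemma tmodel_T q (r : nat -> tmodel) : T q -> st tmodel r q.
Proof.
  intros H.
  set (sg := fun i => epsilon (inhabits Zero) (fun t => r i = cls t)).
  assert (E : forall i, r i = cls (sg i)).
  { intros i. apply (epsilon_spec (inhabits Zero) (fun t => r i = cls t)), cls_surj. }
  rewrite (st_ext tmodel q r _ E). apply tmodel_st, Delta_thm, provable_subst, provable_ax, H.
Qed.

Lemma tmodel_p0 : ~ st tmodel (fun i => cls (Var i)) p0.
Proof.
  rewrite (tmodel_st p0 Var), fsubst_Var by auto. intros H.
  apply Delta_con. eapply der_mp; apply der_hyp; [|exact H].
  exists 0. left. reflexivity.
Qed.

End Henkin.

(** Henkin's proof: if [p] is not provable, extend its negation to a maximal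
    consistent set with witnesses and take the terms modulo provable equality. *)
Theorem completeness (T : theory) (p : form) :
  (forall M : model, (forall q, T q -> forall r, st M r q) -> forall r, st M r p) ->
  provable T p.
Proof.
  intros H. apply NNPP. intros Hn.
  apply (tmodel_p0 T p Hn), H. intros q Hq r. apply tmodel_T; auto.
Qed.

(** * Models of Peano arithmetic *)

Record pam : Type := mkPam {
  pm :> model;
  pm_ax : forall q, PA q -> forall r, st pm r q }.

Declare Scope pa_scope.
Delimit Scope pa_scope with M.
Notation "x + y" := (mp x y) : pa_scope.
Notation "x * y" := (mm x y) : pa_scope.

Definition one {M : model} : M := ms mz.
Definition le {M : model} (x y : M) : Prop := exists z, mp z x = y.
Definition lt {M : model} (x y : M) : Prop := le (ms x) y.
Notation "x <= y" := (le x y) : pa_scope.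
Notation "x < y" := (lt x y) : pa_scope.

(** ** Definable predicates *)

Lemma even_double i : Nat.even (2 * i) = true.
Proof. apply Nat.even_spec. exists i. lia. Qed.

Lemma even_succ_double i : Nat.even (S (2 * i)) = false.
Proof. apply Bool.not_true_iff_false. rewrite Nat.even_spec. intros [k Hk]. lia. Qed.

Section Definability.
Variable M : model.
Implicit Types (r e : nat -> M).

(** Induction holds for formulas with parameters. Variables and parameters are
    interleaved, as the number of either is not known in advance. *)
Definition mix e r (i : nat) : M :=
  if Nat.even i then e (Nat.div2 i) else r (Nat.div2 i).

Definition Def (P : (nat -> M) -> Prop) : Prop :=
  exists p r, forall e, P e <-> st M (mix e r) p.

Definition dtm (f : (nat -> M) -> M) : Prop :=
  exists t r, forall e, f e = ev M (mix e r) t.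

Lemma mix_even e r i : mix e r (2 * i) = e i.
Proof.
  unfold mix. rewrite Nat.div2_double, even_double. reflexivity.
Qed.

Lemma mix_odd e r i : mix e r (S (2 * i)) = r i.
Proof.
  unfold mix. rewrite Nat.div2_succ_double, even_succ_double. reflexivity.
Qed.

Lemma mix_eq e r (f : nat -> M) :
  (forall i, f (2 * i) = e i) -> (forall i, f (S (2 * i)) = r i) -> forall i, f i = mix e r i.
Proof.
  intros H1 H2 i. destruct (Nat.Even_or_Odd i) as [[k ->]|[k ->]].
  - rewrite mix_even; auto.
  - rewrite Nat.add_1_r, mix_odd; auto.
Qed.

Definition ren (g : nat -> nat) (i : nat) : term :=
  if Nat.even i then Var i else Var (S (2 * g (Nat.div2 i))).

Lemma ren_ev e r1 r2 g : (forall i, r1 i = r2 (g i)) ->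
  forall i, ev M (mix e r2) (ren g i) = mix e r1 i.
Proof.
  intros H. apply mix_eq; intros i; unfold ren.
  - rewrite even_double.
    apply mix_even.
  - rewrite Nat.div2_succ_double.
    rewrite even_succ_double. cbn [ev]. rewrite mix_odd; auto.
Qed.

(** Definable predicates that are combined bring their own parameters. Countably
    many sequences of parameters are merged because a substitution may have
    countably many components, each with its own parameters. *)
Definition merge (rs : nat -> nat -> M) (n : nat) : M :=
  rs (fst (Cantor.of_nat n)) (snd (Cantor.of_nat n)).

Definition slot (k i : nat) : nat := Cantor.to_nat (k, i).

Lemma merge_slot rs k i : merge rs (slot k i) = rs k i.
Proof. unfold merge, slot. rewrite Cantor.cancel_of_to. reflexivity. Qed.

Lemma Def_iff P Q : (forall e, P e <-> Q e) -> Def P -> Def Q.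
Proof. intros H (p & r & Hp). exists p, r. intros e. rewrite <- H. apply Hp. Qed.

Definition two (r1 r2 : nat -> M) (k : nat) : nat -> M :=
  match k with 0 => r1 | _ => r2 end.

Lemma Def_imp P Q : Def P -> Def Q -> Def (fun e => P e -> Q e).
Proof.
  intros (p & r1 & Hp) (q & r2 & Hq).
  exists (Imp (fsubst (ren (slot 0)) p) (fsubst (ren (slot 1)) q)), (merge (two r1 r2)).
  intros e. cbn [st]. rewrite !st_subst, Hp, Hq.
  rewrite (st_ext M p (mix e r1)), (st_ext M q (mix e r2)); [reflexivity| |];
    intros i; symmetry; apply ren_ev; intros j; rewrite merge_slot; reflexivity.
Qed.

Definition vars_up (i : nat) : term :=
  if Nat.even i then match i with 0 => Var 0 | S j => Var j end else Var (S i).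

Lemma Def_all (Q : M -> (nat -> M) -> Prop) :
  Def (fun e => Q (e 0) (fun i => e (S i))) -> Def (fun e => forall x, Q x e).
Proof.
  intros (p & r & Hp). exists (All (fsubst vars_up p)), r. intros e. cbn [st].
  assert (E : forall x, st M (scons x (mix e r)) (fsubst vars_up p) <-> Q x e).
  { intros x. rewrite st_subst. specialize (Hp (scons x e)). cbn in Hp. rewrite Hp.
    apply st_ext. apply mix_eq; intros i; unfold vars_up.
    - rewrite even_double.
      destruct i; cbn [scons]; auto.
      replace (2 * S i) with (S (S (2 * i))) by lia. cbn [ev scons]. apply mix_even.
    - rewrite even_succ_double. cbn [ev scons]. apply mix_odd. }
  split; intros H x; apply E, H.
Qed.

Lemma Def_prop (A : Prop) : Def (fun _ => A).
Proof.
  destruct (classic A) as [H|H].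
  - exists (Eq Zero Zero), (fun _ => mz). simpl. tauto.
  - exists Bot, (fun _ => mz). simpl. tauto.
Qed.

Lemma Def_not P : Def P -> Def (fun e => ~ P e).
Proof. intros H. apply Def_imp; auto. apply Def_prop. Qed.

Lemma Def_and P Q : Def P -> Def Q -> Def (fun e => P e /\ Q e).
Proof.
  intros HP HQ. apply (Def_iff (fun e => ~ (P e -> ~ Q e))).
  - intros e; tauto.
  - auto using Def_not, Def_imp.
Qed.

Lemma Def_or P Q : Def P -> Def Q -> Def (fun e => P e \/ Q e).
Proof.
  intros HP HQ. apply (Def_iff (fun e => ~ P e -> Q e)).
  - intros e; tauto.
  - auto using Def_not, Def_imp.
Qed.

Lemma Def_equiv P Q : Def P -> Def Q -> Def (fun e => P e <-> Q e).
Proof. intros; apply Def_and; auto using Def_imp. Qed.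

Lemma Def_ex (Q : M -> (nat -> M) -> Prop) :
  Def (fun e => Q (e 0) (fun i => e (S i))) -> Def (fun e => exists x, Q x e).
Proof.
  intros H. apply (Def_iff (fun e => ~ forall x, ~ Q x e)).
  - intros e. split; [|firstorder]. intros H1. apply NNPP. firstorder.
  - apply Def_not, Def_all, Def_not, H.
Qed.

Lemma dtm_var i : dtm (fun e => e i).
Proof. exists (Var (2 * i)), (fun _ => mz). intros e. cbn [ev]. rewrite mix_even; auto. Qed.

Lemma dtm_const a : dtm (fun _ => a).
Proof. exists (Var 1), (fun _ => a). intros e. cbn. reflexivity. Qed.

Lemma dtm_ms f : dtm f -> dtm (fun e => ms (f e)).
Proof. intros (t & r & H). exists (Succ t), r. intros e. cbn. rewrite H; auto. Qed.

Lemma dtm_two f g : dtm f -> dtm g -> exists s t r,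
  forall e, f e = ev M (mix e r) s /\ g e = ev M (mix e r) t.
Proof.
  intros (s & r1 & Hs) (t & r2 & Ht).
  exists (tsubst (ren (slot 0)) s), (tsubst (ren (slot 1)) t), (merge (two r1 r2)).
  intros e. rewrite !ev_subst, Hs, Ht.
  split; apply ev_ext; intros i; symmetry; apply ren_ev; intros j; rewrite merge_slot; reflexivity.
Qed.

Lemma dtm_mp f g : dtm f -> dtm g -> dtm (fun e => mp (f e) (g e)).
Proof.
  intros Hf Hg. destruct (dtm_two f g Hf Hg) as (s & t & r & H).
  exists (Plus s t), r. intros e. destruct (H e). cbn. congruence.
Qed.

Lemma dtm_mm f g : dtm f -> dtm g -> dtm (fun e => mm (f e) (g e)).
Proof.
  intros Hf Hg. destruct (dtm_two f g Hf Hg) as (s & t & r & H).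
  exists (Mult s t), r. intros e. destruct (H e). cbn. congruence.
Qed.

Lemma Def_eq f g : dtm f -> dtm g -> Def (fun e => f e = g e).
Proof.
  intros Hf Hg. destruct (dtm_two f g Hf Hg) as (s & t & r & H).
  exists (Eq s t), r. intros e. destruct (H e) as [-> ->]. cbn. tauto.
Qed.

Lemma Def_subst P (s : (nat -> M) -> nat -> M) :
  Def P -> (forall i, dtm (fun e => s e i)) -> Def (fun e => P (s e)).
Proof.
  intros (p & r & Hp) Hs.
  assert (C : exists (t : nat -> term) (rs : nat -> nat -> M),
    forall i e, s e i = ev M (mix e (rs i)) (t i)).
  { set (tr := fun i => epsilon (inhabits (Zero, fun _ => mz))
      (fun tr => forall e, s e i = ev M (mix e (snd tr)) (fst tr))).
    exists (fun i => fst (tr i)), (fun i => snd (tr i)). intros i.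
    apply (epsilon_spec (inhabits (Zero, fun _ => mz))
      (fun tr => forall e, s e i = ev M (mix e (snd tr)) (fst tr))).
    destruct (Hs i) as (t & ri & H). exists (t, ri). exact H. }
  destruct C as (t & rs & C).
  set (rs' := fun k => match k with 0 => r | S k => rs k end).
  exists (fsubst (fun i => if Nat.even i then tsubst (ren (slot (S (Nat.div2 i)))) (t (Nat.div2 i))
       else Var (S (2 * slot 0 (Nat.div2 i)))) p), (merge rs').
  intros e. rewrite st_subst, Hp. apply st_ext. intros i; symmetry; revert i. apply mix_eq; intros i.
  - rewrite even_double.
    rewrite Nat.div2_double. rewrite ev_subst, C. apply ev_ext.
    apply ren_ev. intros j. rewrite merge_slot. reflexivity.
  - rewrite even_succ_double, Nat.div2_succ_double. cbn [ev]. rewrite mix_odd, merge_slot. reflexivity.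
Qed.

Lemma Def_st p (s : (nat -> M) -> nat -> M) :
  (forall i, dtm (fun e => s e i)) -> Def (fun e => st M (s e) p).
Proof.
  intros H. apply (Def_subst (fun e => st M e p)); auto.
  exists (fsubst (fun i => Var (2 * i)) p), (fun _ => mz). intros e. rewrite st_subst.
  apply st_ext. intros i. cbn [ev]. rewrite mix_even; auto.
Qed.

Lemma Def_app1 (P : M -> Prop) f :
  Def (fun e => P (e 0)) -> dtm f -> Def (fun e => P (f e)).
Proof.
  intros H Hf. apply (Def_subst _ (fun e => scons (f e) (fun _ => mz)) H).
  intros [|i]; cbn [scons]; auto using dtm_const.
Qed.

Lemma Def_app2 (P : M -> M -> Prop) f g :
  Def (fun e => P (e 0) (e 1)) -> dtm f -> dtm g -> Def (fun e => P (f e) (g e)).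
Proof.
  intros H Hf Hg.
  apply (Def_subst _ (fun e => scons (f e) (scons (g e) (fun _ => mz))) H).
  intros [|[|i]]; cbn [scons]; auto using dtm_const.
Qed.

End Definability.

(** The hooks are redefined when a new notion is shown to be definable. *)
Ltac dterm_hook k := fail.

Ltac dterm :=
  cbv beta;
  lazymatch goal with
  | |- dtm _ (fun e => e ?i) => apply dtm_var
  | |- dtm _ (fun e => ms _) => apply dtm_ms; dterm
  | |- dtm _ (fun e => mp _ _) => apply dtm_mp; dterm
  | |- dtm _ (fun e => mm _ _) => apply dtm_mm; dterm
  | |- dtm _ (fun e => scons _ _ ?i) =>
      is_var i; destruct i as [|i]; cbn [scons]; dterm
  | |- dtm _ _ => first [assumption | apply dtm_const | dterm_hook dterm | idtac]
  end.

Ltac dfn_hook := fail.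

Ltac dfn :=
  cbv beta;
  lazymatch goal with
  | |- Def _ (fun e => st _ _ _) => apply Def_st; let i := fresh "i" in intros i; dterm
  | |- Def _ (fun e => forall x : car _, _) => apply Def_all; dfn
  | |- Def _ (fun e => exists x, _) => apply Def_ex; dfn
  | |- Def _ (fun e => _ /\ _) => apply Def_and; dfn
  | |- Def _ (fun e => _ \/ _) => apply Def_or; dfn
  | |- Def _ (fun e => _ <-> _) => apply Def_equiv; dfn
  | |- Def _ (fun e => ~ _) => apply Def_not; dfn
  | |- Def _ (fun e => le _ _) => unfold le; dfn
  | |- Def _ (fun e => lt _ _) => unfold lt, le; dfn
  | |- Def _ (fun e => @eq (car _) _ _) => apply Def_eq; dterm
  | |- Def _ (fun e => ?A -> ?B) => apply Def_imp; dfn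
  | H : Def _ (fun e => ?P (e 0)) |- Def _ (fun e => ?P _) => apply (Def_app1 _ P _ H); dterm
  | H : Def _ (fun e => ?P (e 0) (e 1)) |- Def _ (fun e => ?P _ _) => apply (Def_app2 _ P _ _ H); dterm
  | |- Def _ _ => first [apply Def_prop | dfn_hook | idtac]
  end.

(** ** Elementary arithmetic *)

Section Arithmetic.
Variable M : pam.
Implicit Types x y z : M.
Local Open Scope pa_scope.

(** The induction axiom for [q], which is the defining formula with its variables
    beyond the first replaced by [0] and its parameters at the free places. *)
Lemma induct (P : M -> Prop) :
  Def M (fun e => P (e 0)) -> P mz -> (forall x, P x -> P (ms x)) -> forall x, P x.
Proof.
  intros (p & r & Hp) H0 HS.
  set (q := fsubst (fun i => match i with 0 => Var 0 | S j =>
       if Nat.even i then Var 1 else Var (S (S (Nat.div2 i))) end) p).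
  assert (E : forall a, st M (scons a (scons mz r)) q <-> P a).
  { intros a. unfold q. rewrite st_subst.
    specialize (Hp (scons a (fun _ => mz))). cbn [scons] in Hp. rewrite Hp.
    apply st_ext. apply mix_eq; intros i.
    - destruct i; auto. replace (2 * S i)%nat with (S (S (2 * i))) by lia. cbn [scons].
      rewrite (even_double i : Nat.even (S (S (2 * i))) = true). reflexivity.
    - cbn [scons]. rewrite Nat.div2_succ_double, even_succ_double. reflexivity. }
  intros x. apply E.
  pose proof (pm_ax M _ (PA_induction q) (scons mz r)) as I.
  cbn [induction st] in I. apply I.
  - unfold inst. rewrite st_subst. apply <- E in H0.
    erewrite st_ext; [exact H0|]. intros [|i]; reflexivity.
  - intros a Ha. apply E, HS, E in Ha. unfold fsucc. rewrite st_subst.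
    erewrite st_ext; [exact Ha|]. intros [|i]; reflexivity.
Qed.

Lemma basic p : In p pa_axioms -> st M (fun _ => mz) p.
Proof. intros H. apply pm_ax, PA_basic, H. Qed.

Lemma S_neq_0 x : ms x <> mz.
Proof.
  pose proof (basic _ (or_introl eq_refl)) as A. apply A.
Qed.

Lemma S_inj x y : ms x = ms y -> x = y.
Proof.
  exact (basic _ (or_intror (or_introl eq_refl)) x y).
Qed.

Lemma add_0_r x : x + mz = x.
Proof.
  exact (basic _ (or_intror (or_intror (or_introl eq_refl))) x).
Qed.

Lemma add_S_r x y : x + ms y = ms (x + y).
Proof.
  exact (basic _ (or_intror (or_intror (or_intror (or_introl eq_refl)))) x y).
Qed.

Lemma mul_0_r x : x * mz = mz.
Proof.
  exact (basic _ (or_intror (or_intror (or_intror (or_intror (or_introl eq_refl))))) x).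
Qed.

Lemma mul_S_r x y : x * ms y = x * y + x.
Proof.
  exact (basic _ (or_intror (or_intror (or_intror (or_intror (or_intror (or_introl eq_refl)))))) x y).
Qed.

Lemma add_0_l x : mz + x = x.
Proof.
  revert x. apply induct; [dfn| |]; intros.
  - apply add_0_r.
  - rewrite add_S_r; congruence.
Qed.

Lemma add_S_l x y : ms x + y = ms (x + y).
Proof.
  revert y. apply induct; [dfn| |]; intros.
  - rewrite !add_0_r; auto.
  - rewrite !add_S_r; congruence.
Qed.

Lemma add_comm x y : x + y = y + x.
Proof.
  revert y. apply induct; [dfn| |]; intros.
  - rewrite add_0_r, add_0_l; auto.
  - rewrite add_S_r, add_S_l; congruence.
Qed.

Lemma add_assoc x y z : x + (y + z) = (x + y) + z.
Proof.
  revert z. apply induct; [dfn| |]; intros.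
  - rewrite !add_0_r; auto.
  - rewrite !add_S_r; congruence.
Qed.

Lemma mul_0_l x : mz * x = mz.
Proof.
  revert x. apply induct; [dfn| |]; intros.
  - apply mul_0_r.
  - rewrite mul_S_r, add_0_r; congruence.
Qed.

Lemma mul_S_l x y : ms x * y = x * y + y.
Proof.
  revert y. apply induct; [dfn| |]; intros.
  - rewrite !mul_0_r, add_0_r; auto.
  - rewrite !mul_S_r, H, !add_S_r, <- !add_assoc, (add_comm x0 x); auto.
Qed.

Lemma mul_comm x y : x * y = y * x.
Proof.
  revert y. apply induct; [dfn| |]; intros.
  - rewrite mul_0_r, mul_0_l; auto.
  - rewrite mul_S_r, mul_S_l; congruence.
Qed.

Lemma mul_add_l x y z : (x + y) * z = x * z + y * z.
Proof.
  revert z. apply induct; [dfn| |]; intros.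
  - rewrite !mul_0_r, add_0_r; auto.
  - rewrite !mul_S_r, H, <- !add_assoc. f_equal.
    rewrite !add_assoc. f_equal. apply add_comm.
Qed.

Lemma mul_assoc x y z : x * (y * z) = (x * y) * z.
Proof.
  revert z. apply induct; [dfn| |]; intros.
  - rewrite !mul_0_r; auto.
  - rewrite !mul_S_r, <- H, (mul_comm x (y * x0 + y)), mul_add_l, (mul_comm _ x), (mul_comm y x); auto.
Qed.

Lemma mul_1_l x : one * x = x.
Proof. unfold one. rewrite mul_S_l, mul_0_l, add_0_l; auto. Qed.

Lemma ms_one x : ms x = x + one.
Proof. unfold one. rewrite add_S_r, add_0_r; auto. Qed.

Lemma pa_semiring : semi_ring_theory (@mz M) one mp mm eq.
Proof.
  constructor; auto using add_0_l, add_comm, add_assoc, mul_1_l, mul_0_l, mul_comm,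
    mul_assoc, mul_add_l.
Qed.

End Arithmetic.

Section Order.
Variable M : pam.
Implicit Types x y z : M.
Local Open Scope pa_scope.
Add Ring Mring : (pa_semiring M).
Ltac mring := repeat rewrite ms_one; ring.

Lemma add_cancel_r x y z : x + z = y + z -> x = y.
Proof.
  revert z. apply (induct M (fun z => x + z = y + z -> x = y)); [dfn| |]; intros.
  - rewrite !add_0_r in H; auto.
  - rewrite !add_S_r in H0. apply S_inj in H0; auto.
Qed.

Lemma add_cancel_l x y z : z + x = z + y -> x = y.
Proof. rewrite !(add_comm M z). apply add_cancel_r. Qed.

Lemma zero_or_S x : x = mz \/ exists y, x = ms y.
Proof.
  revert x. apply induct; [dfn| |]; intros; eauto.
Qed.

Lemma add_eq_0 x y : x + y = mz -> x = mz /\ y = mz.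
Proof.
  destruct (zero_or_S y) as [->|[z ->]].
  - rewrite add_0_r; auto.
  - rewrite add_S_r. intros H; destruct (S_neq_0 M _ H).
Qed.

Lemma le_refl x : x <= x.
Proof. exists mz. apply add_0_l. Qed.

Lemma le_trans x y z : x <= y -> y <= z -> x <= z.
Proof. intros [a <-] [b <-]. exists (b + a). mring. Qed.

Lemma le_add_l x y : x <= y + x.
Proof. exists y; auto. Qed.

Lemma le_add_r x y : x <= x + y.
Proof. exists y; mring. Qed.

Lemma le_0_l x : mz <= x.
Proof. exists x; mring. Qed.

Lemma le_S x : x <= ms x.
Proof. exists one; mring. Qed.

Lemma lt_le x y : x < y -> x <= y.
Proof. apply le_trans, le_S. Qed.

Lemma lt_S x : x < ms x.
Proof. apply le_refl. Qed.

Lemma le_antisym x y : x <= y -> y <= x -> x = y.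
Proof.
  intros [a <-] [b H]. rewrite add_assoc in H.
  rewrite <- (add_0_l M x) in H at 2. apply add_cancel_r, add_eq_0 in H.
  destruct H as [_ ->]. mring.
Qed.

Lemma lt_irrefl x : ~ x < x.
Proof.
  intros [a H]. rewrite add_S_r, <- add_S_l in H.
  rewrite <- (add_0_l M x) in H at 2. apply add_cancel_r in H.
  destruct (S_neq_0 M _ H).
Qed.

Lemma le_succ_mono x y : x <= y <-> ms x <= ms y.
Proof.
  split; intros [a H]; exists a; rewrite add_S_r in *; [congruence|apply S_inj; auto].
Qed.

Lemma lt_succ_r x y : x < ms y <-> x <= y.
Proof. unfold lt. rewrite <- le_succ_mono. tauto. Qed.

Lemma lt_succ_le x y : x < ms y -> x <= y.
Proof. apply lt_succ_r. Qed.

Lemma le_lt_succ x y : x <= y -> x < ms y.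
Proof. apply lt_succ_r. Qed.

Lemma le_lt_trans x y z : x <= y -> y < z -> x < z.
Proof. unfold lt. intros H. apply le_trans. rewrite <- le_succ_mono; auto. Qed.

Lemma lt_le_trans x y z : x < y -> y <= z -> x < z.
Proof. apply le_trans. Qed.

Lemma lt_trans x y z : x < y -> y < z -> x < z.
Proof. intros H1 H2. apply (lt_le_trans _ y); auto using lt_le. Qed.

Lemma lt_0_r x : ~ x < mz.
Proof. intros [a H]. rewrite add_S_r in H. destruct (S_neq_0 M _ H). Qed.

Lemma le_0_r x : x <= mz -> x = mz.
Proof. intros H. apply le_antisym; auto using le_0_l. Qed.

Lemma le_lt_dec x y : x <= y \/ y < x.
Proof.
  revert x. apply induct; [dfn| |]; intros.
  - left; apply le_0_l.
  - destruct H as [H|H]; [|right; apply (lt_trans _ x); auto using lt_S].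
    destruct H as [a <-]. destruct (zero_or_S a) as [->|[b ->]].
    + right. rewrite add_0_l. apply lt_S.
    + left. exists b. rewrite add_S_l, add_S_r; auto.
Qed.

Lemma lt_not_le x y : x < y -> ~ y <= x.
Proof. intros H1 H2. apply (lt_irrefl x). apply (lt_le_trans _ y); auto. Qed.

Lemma le_eq_lt x y : x <= y -> x = y \/ x < y.
Proof.
  intros [a <-]. destruct (zero_or_S a) as [->|[b ->]].
  - left. rewrite add_0_l; auto.
  - right. exists b. rewrite add_S_l, add_S_r; auto.
Qed.

Lemma trichotomy x y : x < y \/ x = y \/ y < x.
Proof.
  destruct (le_lt_dec x y) as [H|H]; auto. apply le_eq_lt in H. tauto.
Qed.

Lemma lt_or_eq x y : x < ms y <-> x < y \/ x = y.
Proof.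
  rewrite lt_succ_r. split.
  - intros H. apply le_eq_lt in H. tauto.
  - intros [H| ->]; [apply lt_le; auto|apply le_refl].
Qed.

Lemma strong_induct (P : M -> Prop) :
  Def M (fun e => P (e 0)) -> (forall x, (forall y, y < x -> P y) -> P x) -> forall x, P x.
Proof.
  intros HP H. enough (A : forall x y, y < x -> P y).
  { intros x. apply (A (ms x)), lt_S. }
  apply (induct M (fun x => forall y, y < x -> P y)); [dfn| |].
  - intros y Hy. destruct (lt_0_r _ Hy).
  - intros x IH y Hy. apply H. intros z Hz. apply IH.
    apply (proj1 (lt_succ_r _ _)) in Hy. apply (lt_le_trans _ y); auto.
Qed.

Lemma least_number (P : M -> Prop) :
  Def M (fun e => P (e 0)) -> (exists x, P x) -> exists x, P x /\ forall y, y < x -> ~ P y.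
Proof.
  intros HP [x Hx]. apply NNPP. intros Hn. revert x Hx.
  apply (strong_induct (fun x => ~ P x)); [dfn|].
  intros x IH Hx. apply Hn. eauto.
Qed.

(** The collection principle bounds the witnesses of the instances of a bounded
    quantifier; by induction on [n], as the sum of two bounds is a bound. *)
Lemma collect (P : M -> M -> Prop) n :
  Def M (fun e => P (e 0) (e 1)) ->
  (forall i, i < n -> exists y, P i y) -> exists b, forall i, i < n -> exists y, y <= b /\ P i y.
Proof.
  intros HP. revert n.
  apply (induct M (fun n => (forall i, i < n -> exists y, P i y) ->
    exists b, forall i, i < n -> exists y, y <= b /\ P i y)); [dfn| |].
  - intros _. exists mz. intros i Hi. destruct (lt_0_r _ Hi).
  - intros n IH H. destruct IH as [b Hb].
    { intros i Hi. apply H. apply lt_or_eq; auto. }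
    destruct (H n) as [y Hy]; [apply lt_S|].
    exists (b + y). intros i Hi. apply lt_or_eq in Hi. destruct Hi as [Hi| ->].
    + destruct (Hb i Hi) as (z & Hz & Hp). exists z; split; auto.
      apply (le_trans _ b); auto using le_add_r.
    + exists y; auto using le_add_l.
Qed.

(** ** Numerals and pairs *)

Fixpoint nm (n : nat) : M := match n with 0 => mz | S n => ms (nm n) end.

Lemma ev_num n (r : nat -> M) : ev M r (num n) = nm n.
Proof. induction n; cbn [ev num nm]; congruence. Qed.

Lemma nm_add m n : nm (m + n) = nm m + nm n.
Proof. induction m; simpl; [rewrite add_0_l|rewrite add_S_l]; congruence. Qed.

Lemma nm_mul m n : nm (m * n) = nm m * nm n.
Proof.
  induction m; simpl; [rewrite mul_0_l; auto|]. rewrite nm_add, mul_S_l, IHm. mring.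
Qed.

Definition pr x y : M := (x + y) * (x + y) + x.

Lemma nm_pair m n : nm (pair m n) = pr (nm m) (nm n).
Proof. unfold pair, pr. rewrite nm_add, nm_mul, !nm_add. reflexivity. Qed.

(** The square of [x + y] determines [x + y], since adding [x] does not reach
    the next square. *)
Lemma pr_inj x y x' y' : pr x y = pr x' y' -> x = x' /\ y = y'.
Proof.
  unfold pr.
  assert (L : forall a b a' b' : M, a + b < a' + b' ->
    (a + b) * (a + b) + a = (a' + b') * (a' + b') + a' -> False).
  { intros a b a' b' [c Hc] H. apply (lt_irrefl ((a + b) * (a + b) + a)).
    rewrite H at 2. rewrite <- Hc.
    exists (c * c + c * ms (a + b) + c * ms (a + b) + a + b + b + a').
    mring. }
  intros H. destruct (trichotomy (x + y) (x' + y')) as [T|[T|T]].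
  - destruct (L _ _ _ _ T H).
  - rewrite T in H. apply add_cancel_l in H. subst x'.
    apply add_cancel_l in T. auto.
  - destruct (L _ _ _ _ T (eq_sym H)).
Qed.

Lemma le_pr_l x y : x <= pr x y.
Proof. apply le_add_l. Qed.

Lemma le_sq x : x <= x * x.
Proof.
  destruct (zero_or_S x) as [->|[y ->]]; [apply le_0_l|].
  exists (y * y + y). mring.
Qed.

Lemma le_pr_r x y : y <= pr x y.
Proof.
  apply (le_trans _ (x + y)); [apply le_add_l|].
  apply (le_trans _ ((x + y) * (x + y))); [apply le_sq|]. apply le_add_r.
Qed.

End Order.

Ltac dterm_hook k ::=
  lazymatch goal with |- dtm _ (fun e => pr _ _ _) => unfold pr; k end.

(** * Sequences in models of arithmetic *)

Section Beta.
Variable M : pam.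
Implicit Types x y z : M.
Local Open Scope pa_scope.
Add Ring Mring : (pa_semiring M).
Ltac mring := repeat rewrite ms_one; ring.

Definition modulus (d i : M) : M := ms (ms i * d).

Definition beta (c d i y : M) : Prop :=
  y < modulus d i /\ exists q, c = q * modulus d i + y.

Lemma rem_unique m q q' y y' : y < m -> y' < m -> q * m + y = q' * m + y' -> y = y'.
Proof.
  assert (L : forall q q' y y' : M, q < q' -> y < m -> q * m + y = q' * m + y' -> False).
  { intros a a' b b' [k Hk] Hb H. apply (lt_not_le M b m Hb).
    exists (k * m + b'). apply (add_cancel_l M _ _ (a * m)). rewrite H, <- Hk. mring. }
  intros Hy Hy' H. destruct (trichotomy M q q') as [T|[->|T]].
  - destruct (L _ _ _ _ T Hy H).
  - apply add_cancel_l in H; auto.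
  - destruct (L _ _ _ _ T Hy' (eq_sym H)).
Qed.

Lemma beta_fun c d i y y' : beta c d i y -> beta c d i y' -> y = y'.
Proof.
  intros [H [q E]] [H' [q' E']]. apply (rem_unique (modulus d i) q q'); auto; congruence.
Qed.

(** The inverse modulo [m], with the differences moved to the other side because
    there are no negative elements. *)
Definition inv (a m : M) : Prop := exists u s t, a * u + s * m = one + t * m.

Lemma inv_mul a b m : inv a m -> inv b m -> inv (a * b) m.
Proof.
  intros (u & s & t & H) (u' & s' & t' & H').
  exists (u * u'), (s * (b * u' + s' * m) + s' * (a * u)), (t + t' + t * t' * m).
  transitivity ((a * u + s * m) * (b * u' + s' * m)); [mring|].
  rewrite H, H'. mring.
Qed.

(** With [t = (i + k + 1) d], the modulus at [i + k] is [1 + t] and divides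
    [1 + t ^ 3]; as [k] divides [d], this gives an inverse of the modulus at [i]. *)
Lemma inv_modulus (i k d' : M) : inv (modulus (k * d') i) (modulus (k * d') (i + k)).
Proof.
  unfold inv, modulus. set (d := k * d'). set (t := ms (i + k) * d).
  exists (ms (i + k) * ms (i + k) * d' * t), (t * t + one),
    (ms (i + k) * ms (i + k) * d' * t + t).
  unfold t, d. mring.
Qed.

Lemma common_multiple (n : M) : exists D, forall k, k < n -> exists e, ms D = ms k * e.
Proof.
  revert n. apply (induct M (fun n => exists D, forall k, k < n -> exists e, ms D = ms k * e)); [dfn| |].
  - exists mz. intros k Hk. destruct (lt_0_r M _ Hk).
  - intros n [D HD]. exists (D * ms n + n). intros k Hk.
    assert (E : ms (D * ms n + n) = ms D * ms n) by mring. rewrite E.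
    apply lt_or_eq in Hk. destruct Hk as [Hk| ->].
    + destruct (HD k Hk) as [e He]. exists (e * ms n). rewrite He. mring.
    + exists (ms D). mring.
Qed.

(** A congruence with a multiple of [m] on both sides determines the remainder. *)
Lemma rem_of_cong m a y A B : y < m -> a + A * m = y + B * m -> exists q, a = q * m + y.
Proof.
  intros Hy H. destruct (le_lt_dec M A B) as [[k Hk]|[k Hk]].
  - exists k. apply (add_cancel_r M _ _ (A * m)). rewrite H, <- Hk. mring.
  - exfalso. apply (lt_not_le M y m Hy). exists (a + k * m).
    apply (add_cancel_r M _ _ (B * m)). rewrite <- H, <- Hk. mring.
Qed.

(** Goedel's lemma: choose [d] above all values and divisible by all small
    numbers, so that the moduli are coprime, and solve the congruences one by one. *)
Theorem beta_exists (F : M -> M -> Prop) (n : M) :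
  Def M (fun e => F (e 0) (e 1)) -> (forall i, i < n -> exists y, F i y) ->
  exists c d, forall i, i < n -> exists y, beta c d i y /\ F i y.
Proof.
  intros HF H. destruct (collect M F n HF H) as [b Hb].
  destruct (common_multiple n) as [D HD]. set (d := ms D * ms b).
  assert (Hd : forall i y, y <= b -> y < modulus d i).
  { intros i y [z Hz]. unfold modulus, lt. apply le_succ_mono.
    exists (i * d + D * ms (z + y) + z + one). unfold d. rewrite <- Hz. mring. }
  assert (Hi : forall i j, i < j -> j < n -> inv (modulus d i) (modulus d j)).
  { intros i j [k Hk] Hj.
    assert (Hkn : k < n).
    { apply (le_lt_trans M _ j); auto. rewrite <- Hk. apply le_add_r. }
    destruct (HD k Hkn) as [e He].
    assert (E : d = ms k * (e * ms b)) by (unfold d; rewrite He; mring).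
    rewrite E, <- Hk. replace (k + ms i) with (i + ms k) by mring. apply inv_modulus. }
  (* [Q] is the product of the first [k] moduli. *)
  enough (E : forall k, k <= n -> exists c Q,
    (forall i, i < k -> exists y, beta c d i y /\ F i y) /\
    (forall i, i < k -> exists e, Q = modulus d i * e) /\
    (forall j, k <= j -> j < n -> inv Q (modulus d j))).
  { destruct (E n (le_refl M n)) as (c & _ & Hc & _). eauto. }
  unfold beta, inv, modulus in *. clearbody d. clear HD.
  apply (induct M (fun k => k <= n -> exists c Q,
    (forall i, i < k -> exists y, (y < ms (ms i * d) /\ (exists q, c = q * ms (ms i * d) + y)) /\ F i y) /\
    (forall i, i < k -> exists e, Q = ms (ms i * d) * e) /\
    (forall j, k <= j -> j < n -> exists u s t, Q * u + s * ms (ms j * d) = one + t * ms (ms j * d))));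
    [dfn| |].
  - intros _. exists mz, one. repeat split.
    + intros i Hlt. destruct (lt_0_r M _ Hlt).
    + intros i Hlt. destruct (lt_0_r M _ Hlt).
    + intros j _ _. exists one, mz, mz. mring.
  - intros k IH Hk. destruct IH as (c & Q & H1 & H2 & H3).
    { apply (le_trans M _ (ms k)); auto using le_S. }
    destruct (H3 k (le_refl M k) Hk) as (u & s & t & Hu).
    destruct (Hb k Hk) as (y & Hy & Hyk).
    set (m := ms (ms k * d)) in *.
    set (T := u * (y + c * (ms k * d))).
    (* [Q u = 1] modulo [m] and [k + 1] times [d] is [-1] modulo [m]; adding [Q T] thus replaces
       the remainder of [c] modulo [m] by [y] and keeps the earlier remainders. *)
    exists (c + Q * T), (Q * m). repeat split.
    + intros i Hik. apply lt_or_eq in Hik. destruct Hik as [Hik| ->].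
      * destruct (H1 i Hik) as (z & (Hz & q & Hq) & Hz').
        destruct (H2 i Hik) as [w Hw]. exists z; repeat split; auto.
        exists (q + w * T). rewrite Hq at 1. rewrite Hw. mring.
      * exists y; split; [split; [apply (Hd k y Hy)|]|exact Hyk].
        apply (rem_of_cong _ _ _ (s * (y + c * (ms k * d))) (t * (y + c * (ms k * d)) + c)); [apply (Hd k y Hy)|].
        fold m.
        transitivity (c + (Q * u + s * m) * (y + c * (ms k * d))); [unfold T; mring|].
        rewrite Hu. unfold m. mring.
    + intros i Hik. apply lt_or_eq in Hik. destruct Hik as [Hik| ->].
      * destruct (H2 i Hik) as [w Hw]. exists (w * m). rewrite Hw. mring.
      * exists Q. fold m. mring.
    + intros j Hkj Hj. apply inv_mul; [apply H3; auto|apply (Hi k j); auto].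
      apply (le_trans M _ (ms k)); auto using le_S.
Qed.

End Beta.

(** * Inductive definitions in models of arithmetic *)

Section Lfp.
Variable M : pam.
Implicit Types x y z : M.
Local Open Scope pa_scope.
Add Ring Mring : (pa_semiring M).
Ltac mring := repeat rewrite ms_one; ring.

(** The arithmetical fixed point of a rule is the set of the last entries of coded
    derivations. Derivations may have nonstandard length, so that it is not the
    least fixed point from outside; inside the model it is. *)
Definition seen (c d i z : M) : Prop := exists j, j < i /\ beta M c d j z.

Definition lfpM (rule : (M -> Prop) -> M -> Prop) (x : M) : Prop :=
  exists c d n, beta M c d n x /\
    forall i, i <= n -> exists y, beta M c d i y /\ rule (seen c d i) y.

Definition mono (rule : (M -> Prop) -> M -> Prop) : Prop :=
  forall (Q Q' : M -> Prop) y, (forall z, Q z -> Q' z) -> rule Q y -> rule Q' y.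

Definition derivation (rule : (M -> Prop) -> M -> Prop) (c d n : M) : Prop :=
  forall i, i < n -> exists y, beta M c d i y /\ rule (seen c d i) y.

Lemma concat (c1 d1 n1 c2 d2 n2 : M) :
  (forall i, i < n1 -> exists y, beta M c1 d1 i y) ->
  (forall i, i < n2 -> exists y, beta M c2 d2 i y) ->
  exists c d, (forall i y, i < n1 -> beta M c1 d1 i y -> beta M c d i y) /\
    (forall i y, i < n2 -> beta M c2 d2 i y -> beta M c d (n1 + i) y).
Proof.
  intros H1 H2.
  set (F := fun i y => (i < n1 /\ beta M c1 d1 i y) \/
    (exists k, i = n1 + k /\ k < n2 /\ beta M c2 d2 k y)).
  assert (Ffun : forall i y y', F i y -> F i y' -> y = y').
  { intros i y y' [[A B]|(k & A & B & C)] [[A' B']|(k' & A' & B' & C')].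
    - eapply beta_fun; eauto.
    - subst i. destruct (lt_not_le M _ _ A (le_add_r M n1 k')).
    - subst i. destruct (lt_not_le M _ _ A' (le_add_r M n1 k)).
    - rewrite A in A'. apply add_cancel_l in A'. subst k'. eapply beta_fun; eauto. }
  destruct (beta_exists M F (n1 + n2)) as (c & d & Hcd).
  { unfold F, beta, modulus. dfn. }
  { intros i Hi. destruct (le_lt_dec M n1 i) as [[k Hk]|L].
    - destruct (H2 k) as [y Hy].
      + destruct Hi as [w Hw]. exists w. apply (add_cancel_l M _ _ n1).
        rewrite <- Hw, <- Hk. mring.
      + exists y. right. exists k. split; [rewrite <- Hk; mring|]. split; auto.
        destruct Hi as [w Hw]. exists w. apply (add_cancel_l M _ _ n1).
        rewrite <- Hw, <- Hk. mring.
    - destruct (H1 i L) as (y & Hy). exists y; left; auto. }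
  assert (G : forall i y, i < n1 + n2 -> F i y -> beta M c d i y).
  { intros i y Hi HF. destruct (Hcd i Hi) as (y' & Hb & HF').
    rewrite (Ffun i y y'); auto. }
  exists c, d. split; intros i y Hi Hb.
  - apply G; [|left; auto]. apply (lt_le_trans M _ n1); auto using le_add_r.
  - apply G; [|right; exists i; auto].
    destruct Hi as [w Hw]. exists w. rewrite <- Hw. mring.
Qed.

(** The second derivation may use what the first one has derived. *)
Lemma derivation_app rule (c1 d1 n1 c2 d2 n2 : M) : mono rule ->
  derivation rule c1 d1 n1 ->
  (forall i, i < n2 -> exists y, beta M c2 d2 i y /\
    rule (fun z => seen c1 d1 n1 z \/ seen c2 d2 i z) y) ->
  exists c d, derivation rule c d (n1 + n2) /\
    (forall z, seen c1 d1 n1 z -> seen c d (n1 + n2) z) /\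
    (forall i y, i < n2 -> beta M c2 d2 i y -> beta M c d (n1 + i) y).
Proof.
  intros Hm H1 H2.
  destruct (concat c1 d1 n1 c2 d2 n2) as (c & d & A & B).
  { intros i Hi. destruct (H1 i Hi) as (y & ? & _); eauto. }
  { intros i Hi. destruct (H2 i Hi) as (y & ? & _); eauto. }
  exists c, d. split; [|split]; auto.
  - intros i Hi. destruct (le_lt_dec M n1 i) as [[k Hk]|L].
    + assert (Ek : i = n1 + k) by (rewrite <- Hk; mring). clear Hk; subst i.
      assert (Lk : k < n2).
      { destruct Hi as [w Hw]. exists w. apply (add_cancel_l M _ _ n1). rewrite <- Hw. mring. }
      destruct (H2 k Lk) as (y & Hy & R). exists y; split; auto.
      apply (Hm _ _ _) with (2 := R). intros z [(j & Hj & Hz)|(j & Hj & Hz)].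
      * exists j. split; auto. apply (lt_le_trans M _ n1); auto using le_add_r.
      * exists (n1 + j). split.
        -- destruct Hj as [w Hw]. exists w. rewrite <- Hw. mring.
        -- apply B; auto. apply (lt_trans M _ k); auto.
    + destruct (H1 i L) as (y & Hy & R). exists y; split; auto.
      apply (Hm _ _ _) with (2 := R). intros z (j & Hj & Hz). exists j; split; auto.
      apply A; auto. apply (lt_trans M _ i); auto.
  - intros z (j & Hj & Hz). exists j. split; auto.
    apply (lt_le_trans M _ n1); auto using le_add_r.
Qed.

Lemma lfp_derivation rule x : lfpM rule x ->
  exists c d n, derivation rule c d n /\ seen c d n x.
Proof.
  intros (c & d & n & E & H). exists c, d, (ms n). split.
  - intros i Hi. apply H, lt_succ_le, Hi.
  - exists n. split; auto using lt_S.
Qed.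

Lemma lfp_derivations rule l : mono rule -> (forall z, In z l -> lfpM rule z) ->
  exists c d n, derivation rule c d n /\ forall z, In z l -> seen c d n z.
Proof.
  intros Hm. induction l as [|a l IH]; intros H.
  - exists mz, mz, mz. split; [|intros z []]. intros i Hi. destruct (lt_0_r M _ Hi).
  - destruct IH as (c1 & d1 & n1 & H1 & S1); [intros; apply H; right; auto|].
    destruct (lfp_derivation rule a) as (c2 & d2 & n2 & H2 & j & Hj & Hb); [apply H; left; auto|].
    destruct (derivation_app rule c1 d1 n1 c2 d2 n2) as (c & d & A & B & C); auto.
    { intros i Hi. destruct (H2 i Hi) as (y & Hy & R). exists y; split; auto.
      apply (Hm _ _ _) with (2 := R). auto. }
    exists c, d, (n1 + n2). split; auto. intros z [<-|Hz]; auto.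
    exists (n1 + j). split; auto.
    destruct Hj as [w Hw]. exists w. rewrite <- Hw. mring.
Qed.

(** Each instance of a rule has finitely many premises, which are derived one after
    the other. This is a property of the rule and not of the model: the number of
    premises is standard even if the objects are not. *)
Definition finitary (A : (M -> Prop) -> Prop) : Prop :=
  (forall Q Q' : M -> Prop, (forall z, Q z -> Q' z) -> A Q -> A Q') /\
  (forall Q, A Q -> exists l, (forall z, In z l -> Q z) /\ A (fun z => In z l)).

Lemma fin_const (A : Prop) : finitary (fun _ => A).
Proof. split; auto. intros Q H. exists []. split; auto. intros z []. Qed.

Lemma fin_self z : finitary (fun Q => Q z).
Proof.
  split; auto. intros Q H. exists [z]. split; [intros z' [<-|[]]; auto|left; auto].
Qed.

Lemma fin_or A B : finitary A -> finitary B -> finitary (fun Q => A Q \/ B Q).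
Proof.
  intros [mA fA] [mB fB]. split.
  - intros Q Q' H [HA|HB]; eauto.
  - intros Q [H|H]; [apply fA in H|apply fB in H]; destruct H as (l & ? & ?); exists l; auto.
Qed.

Lemma fin_and A B : finitary A -> finitary B -> finitary (fun Q => A Q /\ B Q).
Proof.
  intros [mA fA] [mB fB]. split.
  - intros Q Q' H [HA HB]; eauto.
  - intros Q [HA HB]. apply fA in HA. apply fB in HB.
    destruct HA as (l & Hl & HA), HB as (l' & Hl' & HB).
    exists (l ++ l'). split.
    + intros z Hz. apply in_app_or in Hz. destruct Hz; auto.
    + split; [eapply mA; [|exact HA]|eapply mB; [|exact HB]]; intros; apply in_or_app; auto.
Qed.

Lemma fin_ex (T : Type) (A : T -> (M -> Prop) -> Prop) :
  (forall t, finitary (A t)) -> finitary (fun Q => exists t, A t Q).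
Proof.
  intros H. split.
  - intros Q Q' HQ [x Hx]. exists x. eapply (proj1 (H x)); eauto.
  - intros Q [x Hx]. apply (proj2 (H x)) in Hx. destruct Hx as (l & Hl & Hx). eauto.
Qed.

Definition fin_rule (rule : (M -> Prop) -> M -> Prop) : Prop :=
  forall x, finitary (fun Q => rule Q x).

Lemma fin_mono rule : fin_rule rule -> mono rule.
Proof. intros H Q Q' y HQ. apply (proj1 (H y)); auto. Qed.

(** The derivations of the premises are put in a row, followed by the conclusion. *)
Lemma lfp_fold rule x : fin_rule rule -> rule (lfpM rule) x -> lfpM rule x.
Proof.
  intros Hf H. pose proof (fin_mono rule Hf) as Hm.
  apply (proj2 (Hf x)) in H. destruct H as (l & Hl & H).
  destruct (lfp_derivations rule l Hm Hl) as (c1 & d1 & n1 & H1 & S1).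
  destruct (beta_exists M (fun i y => y = x) one) as (c2 & d2 & H2); [dfn|eauto|].
  destruct (H2 mz) as (y & Hy & ->); [apply le_refl|].
  destruct (derivation_app rule c1 d1 n1 c2 d2 one) as (c & d & A & B & C); auto.
  { intros i Hi. apply lt_succ_le, le_0_r in Hi. subst i. exists x; split; auto.
    apply (Hm _ _ _) with (2 := H). auto. }
  exists c, d, n1. split.
  - rewrite <- (add_0_r M n1). apply C; auto. apply le_refl.
  - intros i Hi. apply A. unfold one. rewrite add_S_r, add_0_r. apply le_lt_succ; auto.
Qed.

Lemma lfp_inv rule x : mono rule -> lfpM rule x -> rule (lfpM rule) x.
Proof.
  intros Hm (c & d & n & E & H).
  destruct (H n) as (y & Hy & R); [apply le_refl|].
  assert (y = x) by (eapply beta_fun; eauto). subst y.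
  apply (Hm _ _ _) with (2 := R). intros z (j & Hj & Hz). exists c, d, j. split; auto.
  intros i Hi. apply H. apply lt_le in Hj. eapply le_trans; eauto.
Qed.

Lemma lfp_mono (rule rule' : (M -> Prop) -> M -> Prop) x :
  (forall Q y, rule Q y -> rule' Q y) -> lfpM rule x -> lfpM rule' x.
Proof.
  intros Hr (c & d & n & E & H). exists c, d, n. split; auto.
  intros i Hi. destruct (H i Hi) as (y & ? & ?); eauto.
Qed.

(** Induction on the place of the entry. The schema of induction is a hypothesis:
    in a nonstandard model it holds for definable [P] only. *)
Lemma lfp_ind (P : M -> Prop) rule x : mono rule ->
  (forall Q : M -> Prop, (forall x, (forall y, y < x -> Q y) -> Q x) -> forall x, Q x) ->
  (forall y, rule P y -> P y) -> lfpM rule x -> P x.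
Proof.
  intros Hm Hind HP (c & d & n & E & H).
  assert (A : forall i, i <= n -> forall y, beta M c d i y -> P y).
  { apply (Hind (fun i => i <= n -> forall y, beta M c d i y -> P y)).
    intros i IH Hi y Hy. destruct (H i Hi) as (y' & Hy' & R).
    assert (y' = y) by (eapply beta_fun; eauto). subst y'. apply HP.
    apply (Hm _ _ _) with (2 := R). intros z (j & Hj & Hz). apply (IH j); auto.
    apply lt_le in Hj. eapply le_trans; eauto. }
  apply (A n (le_refl M n)); auto.
Qed.

End Lfp.

(** * The arithmetized notions in a model *)

Section Notions.
Variable M : pam.
Implicit Types (x y z : M) (r : nat -> M).
Local Open Scope pa_scope.

Lemma st_And r p q : st M r (And p q) <-> st M r p /\ st M r q.
Proof. cbn. tauto. Qed.

Lemma st_Ex r p : st M r (Ex p) <-> exists x, st M (scons x r) p.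
Proof.
  cbn. split; [|firstorder]. intros H. apply NNPP. firstorder.
Qed.

Lemma st_Le r s t : st M r (Le s t) <-> ev M r s <= ev M r t.
Proof.
  unfold Le, le. rewrite st_Ex. cbn. unfold tlift.
  split; intros [z H]; exists z; revert H; rewrite !ev_subst; auto.
Qed.

Lemma sem_and r p q A B : (st M r p <-> A) -> (st M r q <-> B) -> (st M r (And p q) <-> A /\ B).
Proof. rewrite st_And. tauto. Qed.

Lemma sem_or r p q A B : (st M r p <-> A) -> (st M r q <-> B) -> (st M r (Or p q) <-> A \/ B).
Proof. cbn. tauto. Qed.

Lemma sem_imp r p q A B : (st M r p <-> A) -> (st M r q <-> B) -> (st M r (Imp p q) <-> (A -> B)).
Proof. cbn. tauto. Qed.

Lemma sem_ex r p (Q : M -> Prop) :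
  (forall x, st M (scons x r) p <-> Q x) -> (st M r (Ex p) <-> exists x, Q x).
Proof. intros H. rewrite st_Ex. split; intros [x Hx]; exists x; apply H, Hx. Qed.

Lemma sem_all r p (Q : M -> Prop) :
  (forall x, st M (scons x r) p <-> Q x) -> (st M r (All p) <-> forall x, Q x).
Proof. intros H. cbn. split; intros Hx x; apply H, Hx. Qed.

Lemma sem_le r s t A : ((ev M r s <= ev M r t) <-> A) -> (st M r (Le s t) <-> A).
Proof. rewrite st_Le. auto. Qed.

Lemma sem_app r P ts d A :
  (st M (fun i => ev M r (nth i ts (tnum 0) d)) P <-> A) -> (st M r (app P ts d) <-> A).
Proof. unfold app. rewrite st_subst. auto. Qed.

End Notions.

Ltac fm_unfold :=
  cbv [lam1 lam2 lam3 lam4 fall fex fle feq fimp fconj fdisj lfp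
       tsucc tplus tmult tnum bvar fvar tpair tpair3 tpair4 cVar cZero cSucc
       cPlus cMult cBot cEq cImp cAll cNeg isTerm isForm same_shape prv Nat.sub Nat.add].

Ltac sem_leaf :=
  cbn [st ev scons nth]; repeat rewrite ev_num; reflexivity.

(** Follows a formula in higher-order style down to its atoms; [tac] knows the
    meaning of the formulas that occur in it as substituted parts. *)
Ltac sem tac :=
  lazymatch goal with
  | |- st _ _ (And _ _) <-> _ => apply sem_and; sem tac
  | |- st _ _ (Or _ _) <-> _ => apply sem_or; sem tac
  | |- st _ _ (Ex _) <-> _ => apply sem_ex; let x := fresh "x" in intros x; sem tac
  | |- st _ _ (Le _ _) <-> _ => apply sem_le; sem_leaf
  | |- st _ _ (app _ _ _) <-> _ =>
      apply sem_app; first [tac; cbn [ev scons nth]; repeat rewrite ev_num; reflexivity | idtac]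
  | |- st _ _ (Eq _ _) <-> _ => first [sem_leaf | idtac]
  | |- st _ _ Bot <-> _ => reflexivity
  | |- st _ _ (Imp _ _) <-> _ => apply sem_imp; sem tac
  | |- st _ _ (All _) <-> _ => apply sem_all; let x := fresh "x" in intros x; sem tac
  end.

Section Semantics.
Variable M : pam.
Implicit Types (x y z : M) (r : nat -> M).
Local Open Scope pa_scope.

(** The relations below are the meanings, in an arbitrary model, of the formulas
    whose names they resemble. *)
Notation k n := (nm M n) (only parsing).
Definition kVar x : M := pr M (k 0) x.
Definition kZero : M := pr M (k 1) (k 0).
Definition kSucc x : M := pr M (k 2) x.
Definition kPlus x y : M := pr M (k 3) (pr M x y).
Definition kMult x y : M := pr M (k 4) (pr M x y).
Definition kBot : M := pr M (k 5) (k 0).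
Definition kEq x y : M := pr M (k 6) (pr M x y).
Definition kImp x y : M := pr M (k 7) (pr M x y).
Definition kAll x : M := pr M (k 8) x.
Definition kNeg x : M := kImp x kBot.
Definition pr3 x y z : M := pr M x (pr M y z).
Definition pr4 x y z w : M := pr M x (pr3 y z w).

Ltac sunfold := unfold kNeg, kVar, kZero, kSucc, kPlus, kMult, kBot, kEq, kImp, kAll, pr4, pr3,
  lfpM, seen, lt in *; unfold pr in *.

Lemma sem_Beta r : st M r Beta <-> beta M (r 0) (r 1) (r 2) (r 3).
Proof. unfold Beta, beta, modulus, lt. fm_unfold. sem idtac. Qed.

Definition NumR (self : M -> Prop) x : Prop :=
  x = pr M (k 0) kZero \/ exists n c, self (pr M n c) /\ x = pr M (ms n) (kSucc c).
Definition numM x y : Prop := lfpM M NumR (pr M x y).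

Lemma sem_Num r : st M r Num <-> numM (r 0) (r 1).
Proof. unfold Num, numM, NumR. sunfold. fm_unfold. sem ltac:(rewrite sem_Beta). Qed.

Definition TermBR (b : M) (self : M -> Prop) x : Prop :=
  (exists i, i < b /\ x = kVar i) \/ x = kZero \/
  (exists t, self t /\ x = kSucc t) \/
  (exists s t, self s /\ self t /\ (x = kPlus s t \/ x = kMult s t)).
Definition termB (b c : M) : Prop := lfpM M (TermBR b) c.

Lemma sem_TermB r : st M r TermB <-> termB (r 0) (r 1).
Proof. unfold TermB, termB, TermBR. sunfold. fm_unfold. sem ltac:(rewrite sem_Beta). Qed.

Definition FormBR (self : M -> Prop) x : Prop :=
  exists b c, x = pr M b c /\
    (c = kBot \/
     (exists s t, termB b s /\ termB b t /\ c = kEq s t) \/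
     (exists p q, self (pr M b p) /\ self (pr M b q) /\ c = kImp p q) \/
     (exists p, self (pr M (ms b) p) /\ c = kAll p)).
Definition formB (b c : M) : Prop := lfpM M FormBR (pr M b c).

Lemma sem_FormB r : st M r FormB <-> formB (r 0) (r 1).
Proof.
  unfold FormB, formB, FormBR. sunfold. fm_unfold.
  sem ltac:(first [rewrite sem_Beta | rewrite sem_TermB]).
Qed.

Definition isTermM (c : M) : Prop := exists b, termB b c.
Definition isFormM (c : M) : Prop := exists b, formB b c.

Definition shape (R R' : M -> M -> Prop) (c c' : M) : Prop :=
  (c = kZero /\ c' = kZero) \/ (c = kBot /\ c' = kBot) \/
  (exists t t', R t t' /\ c = kSucc t /\ c' = kSucc t') \/
  (exists s t s' t', R s s' /\ R t t' /\
     ((c = kPlus s t /\ c' = kPlus s' t') \/ (c = kMult s t /\ c' = kMult s' t') \/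
      (c = kEq s t /\ c' = kEq s' t') \/ (c = kImp s t /\ c' = kImp s' t'))) \/
  (exists p p', R' p p' /\ c = kAll p /\ c' = kAll p').

Definition LiftR (self : M -> Prop) x : Prop :=
  exists b c c', x = pr3 b c c' /\
    ((exists i, i < b /\ c = kVar i /\ c' = kVar i) \/
     (exists i, b <= i /\ c = kVar i /\ c' = kVar (ms i)) \/
     shape (fun p p' => self (pr3 b p p')) (fun p p' => self (pr3 (ms b) p p')) c c').
Definition liftM (b c c' : M) : Prop := lfpM M LiftR (pr3 b c c').

Lemma sem_Lift r : st M r Lift <-> liftM (r 0) (r 1) (r 2).
Proof.
  unfold Lift, liftM, LiftR, shape. sunfold. fm_unfold. sem ltac:(rewrite sem_Beta).
Qed.

Definition SubstR (self : M -> Prop) x : Prop :=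
  exists b u c c', x = pr4 b u c c' /\
    ((exists i, i < b /\ c = kVar i /\ c' = kVar i) \/
     (c = kVar b /\ c' = u) \/
     (exists i, b <= i /\ c = kVar (ms i) /\ c' = kVar i) \/
     shape (fun p p' => self (pr4 b u p p'))
       (fun p p' => exists u', liftM (k 0) u u' /\ self (pr4 (ms b) u' p p')) c c').
Definition substM (b u c c' : M) : Prop := lfpM M SubstR (pr4 b u c c').

Lemma sem_Subst r : st M r Subst <-> substM (r 0) (r 1) (r 2) (r 3).
Proof.
  unfold Subst, substM, SubstR, shape. sunfold. fm_unfold.
  sem ltac:(first [rewrite sem_Beta | rewrite sem_Lift]).
Qed.

Definition instNumM (c n c' : M) : Prop := exists u, numM n u /\ substM (k 0) u c c'.

Lemma sem_InstNum r : st M r InstNum <-> instNumM (r 0) (r 1) (r 2).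
Proof.
  unfold InstNum, instNumM. fm_unfold.
  sem ltac:(first [rewrite sem_Num | rewrite sem_Subst]).
Qed.

Definition logAxM x : Prop :=
  (exists p q, isFormM p /\ isFormM q /\ x = kImp p (kImp q p)) \/
  (exists p q s, isFormM p /\ isFormM q /\ isFormM s /\
     x = kImp (kImp p (kImp q s)) (kImp (kImp p q) (kImp p s))) \/
  (exists p, isFormM p /\ x = kImp (kNeg (kNeg p)) p) \/
  (exists p t p', isFormM p /\ isTermM t /\ substM (k 0) t p p' /\ x = kImp (kAll p) p') \/
  (exists p q, isFormM p /\ isFormM q /\
     x = kImp (kAll (kImp p q)) (kImp (kAll p) (kAll q))) \/
  (exists p p', isFormM p /\ liftM (k 0) p p' /\ x = kImp p (kAll p')) \/
  (exists t, isTermM t /\ x = kEq t t) \/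
  (exists s t u, isTermM s /\ isTermM t /\ isTermM u /\
     x = kImp (kEq s t) (kImp (kEq s u) (kEq t u))) \/
  (exists s t, isTermM s /\ isTermM t /\
     x = kImp (kEq s t) (kEq (kSucc s) (kSucc t))) \/
  (exists s t u w, isTermM s /\ isTermM t /\ isTermM u /\ isTermM w /\
     (x = kImp (kEq s t) (kImp (kEq u w) (kEq (kPlus s u) (kPlus t w))) \/
      x = kImp (kEq s t) (kImp (kEq u w) (kEq (kMult s u) (kMult t w))))).

Lemma sem_LogAx r : st M r LogAx <-> logAxM (r 0).
Proof.
  unfold LogAx, logAxM, isFormM, isTermM, kNeg. sunfold. fm_unfold.
  sem ltac:(first [rewrite sem_FormB | rewrite sem_TermB | rewrite sem_Lift | rewrite sem_Subst]).
Qed.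

Definition PrvR (ax : M -> Prop) (self : M -> Prop) x : Prop :=
  logAxM x \/ ax x \/ (exists y, self (kImp y x) /\ self y) \/
  (exists y, self y /\ x = kAll y).
Definition prvM (ax : M -> Prop) x : Prop := lfpM M (PrvR ax) x.

Fixpoint qt (t : term) : M :=
  match t with
  | Var i => kVar (k i)
  | Zero => kZero
  | Succ t => kSucc (qt t)
  | Plus s t => kPlus (qt s) (qt t)
  | Mult s t => kMult (qt s) (qt t)
  end.

Fixpoint qf (p : form) : M :=
  match p with
  | Bot => kBot
  | Eq s t => kEq (qt s) (qt t)
  | Imp p q => kImp (qf p) (qf q)
  | All p => kAll (qf p)
  end.

Lemma ev_tquote t d r : ev M r (tquote t d) = qt t.
Proof.
  induction t; cbn [tquote qt]; fm_unfold; sunfold; cbn [ev]; repeat rewrite ev_num;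
    try rewrite IHt; try (rewrite IHt1, IHt2); reflexivity.
Qed.

Lemma ev_fquote p d r : ev M r (fquote p d) = qf p.
Proof.
  induction p; cbn [fquote qf]; fm_unfold; sunfold; cbn [ev]; repeat rewrite ev_num;
    rewrite ?ev_tquote; try rewrite IHp; try (rewrite IHp1, IHp2); reflexivity.
Qed.

Lemma nm_tcode t : nm M (tcode t) = qt t.
Proof.
  induction t; cbn [tcode qt]; unfold kVar, kZero, kSucc, kPlus, kMult;
    rewrite ?nm_pair; congruence.
Qed.

Lemma nm_fcode p : nm M (fcode p) = qf p.
Proof.
  induction p; cbn [fcode qf]; unfold kBot, kEq, kImp, kAll;
    rewrite ?nm_pair, ?nm_tcode; congruence.
Qed.

Definition indAxM x : Prop :=
  exists p p0 p1 ps, isFormM p /\ substM (k 0) kZero p p0 /\ liftM (k 1) p p1 /\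
    substM (k 0) (kSucc (kVar (k 0))) p1 ps /\
    x = kImp p0 (kImp (kAll (kImp p ps)) (kAll p)).
Definition paAxM x : Prop := (exists p, In p pa_axioms /\ x = qf p) \/ indAxM x.

Lemma sem_PAAx r : st M r PAAx <-> paAxM (r 0).
Proof.
  unfold PAAx, paAxM, lam1. generalize pa_axioms.
  induction l as [|p l IH]; cbn [fold_right In].
  - split; [intros H; right|intros [(p & [] & _)|H]]; revert H;
    [enough (E : st M r ((∃' p p0 p1 ps, isForm p /\' app Subst [#0; cZero; p; p0] /\'
       app Lift [#1; p; p1] /\' app Subst [#0; cSucc (cVar #0); p1; ps] /\'
       fvar 0 =' cImp p0 (cImp (cAll (cImp p ps)) (cAll p)))%fm 0) <-> indAxM (r 0)) by apply E
    |enough (E : st M r ((∃' p p0 p1 ps, isForm p /\' app Subst [#0; cZero; p; p0] /\'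
       app Lift [#1; p; p1] /\' app Subst [#0; cSucc (cVar #0); p1; ps] /\'
       fvar 0 =' cImp p0 (cImp (cAll (cImp p ps)) (cAll p)))%fm 0) <-> indAxM (r 0)) by apply E];
    unfold indAxM, isFormM; sunfold; fm_unfold;
    sem ltac:(first [rewrite sem_FormB | rewrite sem_Lift | rewrite sem_Subst]).
  - etransitivity; [unfold fdisj at 1; apply sem_or with (A := r 0 = qf p); [|apply IH]|].
    + unfold feq. cbn [st]. rewrite ev_fquote. reflexivity.
    + split.
      * intros [H|[(q & Hq & H)|H]]; [left; exists p|left; exists q|right]; auto.
      * intros [(q & [<-|Hq] & H)|H]; auto. right; left; exists q; auto.
Qed.

Definition CompR (self : M -> Prop) w : Prop :=
  (exists x, w = pr3 (pr M (k 0) (k 0)) x (k 0)) \/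
  (exists x, w = pr3 (pr M (k 1) (k 0)) x (ms x)) \/
  (exists x, w = pr3 (pr M (k 2) (k 0)) x x) \/
  (exists x y, w = pr3 (pr M (k 3) (k 0)) (pr M x y) x) \/
  (exists x y, w = pr3 (pr M (k 4) (k 0)) (pr M x y) y) \/
  (exists f g x y z, self (pr3 f x y) /\ self (pr3 g x z) /\
     w = pr3 (pr M (k 5) (pr M f g)) x (pr M y z)) \/
  (exists f g x y z, self (pr3 g x y) /\ self (pr3 f y z) /\
     w = pr3 (pr M (k 6) (pr M f g)) x z) \/
  (exists f g x y, self (pr3 f x y) /\ w = pr3 (pr M (k 7) (pr M f g)) (pr M x (k 0)) y) \/
  (exists f g x n y z, self (pr3 (pr M (k 7) (pr M f g)) (pr M x n) y) /\
     self (pr3 g (pr M x (pr M n y)) z) /\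
     w = pr3 (pr M (k 7) (pr M f g)) (pr M x (ms n)) z) \/
  (exists f x n, self (pr3 f (pr M x n) (k 0)) /\ w = pr3 (pr M (k 8) f) (pr M x n) n) \/
  (exists f x n y m, self (pr3 f (pr M x n) (ms y)) /\
     self (pr3 (pr M (k 8) f) (pr M x (ms n)) m) /\ w = pr3 (pr M (k 8) f) (pr M x n) m).
Definition compM (e x y : M) : Prop := lfpM M CompR (pr3 e x y).

Lemma sem_Comp r : st M r Comp <-> compM (r 0) (r 1) (r 2).
Proof. unfold Comp, compM, CompR. sunfold. fm_unfold. sem ltac:(rewrite sem_Beta). Qed.

Definition PowR (b : nat) (self : M -> Prop) x : Prop :=
  x = pr M (k 0) (k 1) \/ exists n y, self (pr M n y) /\ x = pr M (ms n) (k b * y).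
Definition powM (b : nat) (n y : M) : Prop := lfpM M (PowR b) (pr M n y).

Lemma sem_Pow b r : st M r (Pow b) <-> powM b (r 0) (r 1).
Proof. unfold Pow, powM, PowR. sunfold. fm_unfold. sem ltac:(rewrite sem_Beta). Qed.

Definition belowM (b a : M) : Prop :=
  powM 2 b a \/ exists e p n, powM 5 e p /\ a = k 3 * p /\ compM e n b.

Lemma sem_Below r : st M r Below <-> belowM (r 0) (r 1).
Proof.
  unfold Below, belowM. fm_unfold. sem ltac:(first [rewrite sem_Pow | rewrite sem_Comp]).
Qed.

Definition reflVM (v b y : M) : Prop :=
  exists p w w' w'', formB (k 1) p /\ instNumM v v w /\ instNumM w b w' /\
    instNumM w' p w'' /\ y = kAll (kImp w'' p).

Lemma sem_ReflV r : st M r ReflV <-> reflVM (r 0) (r 1) (r 2).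
Proof.
  unfold ReflV, reflVM. sunfold. fm_unfold.
  sem ltac:(first [rewrite sem_FormB | rewrite sem_InstNum]).
Qed.

Definition AxR (v : M) (self : M -> Prop) x : Prop :=
  exists a y, x = pr M a y /\
    (paAxM y \/ exists b, belowM b a /\ (self (pr M b y) \/ reflVM v b y)).
Definition axVM (v a y : M) : Prop := lfpM M (AxR v) (pr M a y).

Lemma sem_AxV r : st M r AxV <-> axVM (r 0) (r 1) (r 2).
Proof.
  unfold AxV, axVM, AxR. sunfold. fm_unfold.
  sem ltac:(first [rewrite sem_Beta | rewrite sem_PAAx | rewrite sem_Below | rewrite sem_ReflV]).
Qed.

Definition axM (a y : M) : Prop := axVM (qf UPrvV) a y.

Lemma sem_Ax r : st M r Ax <-> axM (r 0) (r 1).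
Proof.
  unfold Ax, inst. rewrite st_subst, sem_AxV. cbn [ev scons]. rewrite ev_num, nm_fcode. reflexivity.
Qed.

Definition uprvM (b p x : M) : Prop := exists z, instNumM p x z /\ prvM (axM b) z.

Lemma sem_UPrv r : st M r UPrv <-> uprvM (r 0) (r 1) (r 2).
Proof.
  unfold UPrv, uprvM, prvM, PrvR. sunfold. fm_unfold.
  sem ltac:(first [rewrite sem_Beta | rewrite sem_InstNum | rewrite sem_LogAx | rewrite sem_Ax]).
Qed.

End Semantics.

(** * Closure properties of the arithmetized notions *)

Section Closure.
Variable M : pam.
Implicit Types (x y z : M) (r : nat -> M).
Local Open Scope pa_scope.
Notation k n := (nm M n) (only parsing).

Notation kVar := (kVar M).
Notation kZero := (kZero M).
Notation kSucc := (kSucc M).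
Notation kPlus := (kPlus M).
Notation kMult := (kMult M).
Notation kBot := (kBot M).
Notation kEq := (kEq M).
Notation kImp := (kImp M).
Notation kAll := (kAll M).

Ltac fin_tac :=
  let x := fresh "x" in intros x;
  repeat first [apply fin_const | apply fin_self | apply fin_or | apply fin_and |
    (apply fin_ex; intro)].

Lemma fin_Num : fin_rule M (NumR M).
Proof. unfold NumR. fin_tac. Qed.
Lemma fin_TermB b : fin_rule M (TermBR M b).
Proof. unfold TermBR. fin_tac. Qed.
Lemma fin_FormB : fin_rule M (FormBR M).
Proof. unfold FormBR. fin_tac. Qed.
Lemma fin_Lift : fin_rule M (LiftR M).
Proof. unfold LiftR, shape. fin_tac. Qed.
Lemma fin_Subst : fin_rule M (SubstR M).
Proof. unfold SubstR, shape. fin_tac. Qed.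
Lemma fin_Prv ax : fin_rule M (PrvR M ax).
Proof. unfold PrvR. fin_tac. Qed.
Lemma fin_Comp : fin_rule M (CompR M).
Proof. unfold CompR. fin_tac. Qed.
Lemma fin_Pow b : fin_rule M (PowR M b).
Proof. unfold PowR. fin_tac. Qed.
Lemma fin_Ax v : fin_rule M (AxR M v).
Proof. unfold AxR. fin_tac. Qed.

(** ** Numerals *)

Lemma num_0 : numM M mz kZero.
Proof. apply lfp_fold; [apply fin_Num|]. left. reflexivity. Qed.

Lemma num_S n c : numM M n c -> numM M (ms n) (kSucc c).
Proof. intros H. apply lfp_fold; [apply fin_Num|]. right. exists n, c. auto. Qed.

Lemma num_std n : numM M (k n) (qt M (num n)).
Proof. induction n; [apply num_0|apply (num_S _ _ IHn)]. Qed.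

Lemma num_uniq n : forall u, numM M (k n) u -> u = qt M (num n).
Proof.
  induction n; intros u H; apply lfp_inv in H; try apply fin_mono, fin_Num;
    destruct H as [H|(m & c & H1 & H2)].
  - apply pr_inj in H. apply H.
  - apply pr_inj in H2. destruct H2 as [H2 _]. destruct (S_neq_0 M _ (eq_sym H2)).
  - apply pr_inj in H. destruct H as [H _]. destruct (S_neq_0 M _ H).
  - apply pr_inj in H2. destruct H2 as [H2 ->]. apply S_inj in H2. subst m.
    apply IHn in H1. subst c. reflexivity.
Qed.

(** Lifting and substitution leave such codes alone. The numerals of nonstandard
    elements do not code standard terms, but they have this property. *)
Definition closedc (u : M) : Prop :=
  (forall b, liftM M b u u) /\ (forall b s, substM M b s u u).

Lemma lift_var_lt b i : i < b -> liftM M b (kVar i) (kVar i).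
Proof.
  intros H. apply lfp_fold; [apply fin_Lift|]. exists b, (kVar i), (kVar i). split; auto.
  left. exists i; auto.
Qed.

Lemma lift_var_ge b i : b <= i -> liftM M b (kVar i) (kVar (ms i)).
Proof.
  intros H. apply lfp_fold; [apply fin_Lift|]. exists b, (kVar i), (kVar (ms i)). split; auto.
  right; left. exists i; auto.
Qed.

Lemma lift_shape b c c' :
  shape M (fun p p' => liftM M b p p') (fun p p' => liftM M (ms b) p p') c c' -> liftM M b c c'.
Proof.
  intros H. apply lfp_fold; [apply fin_Lift|]. exists b, c, c'. split; auto.
Qed.

Lemma subst_var_lt b u i : i < b -> substM M b u (kVar i) (kVar i).
Proof.
  intros H. apply lfp_fold; [apply fin_Subst|]. exists b, u, (kVar i), (kVar i). split; auto.
  left. exists i; auto.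
Qed.

Lemma subst_var_eq b u : substM M b u (kVar b) u.
Proof.
  apply lfp_fold; [apply fin_Subst|]. exists b, u, (kVar b), u. split; auto.
Qed.

Lemma subst_var_gt b u i : b <= i -> substM M b u (kVar (ms i)) (kVar i).
Proof.
  intros H. apply lfp_fold; [apply fin_Subst|]. exists b, u, (kVar (ms i)), (kVar i). split; auto.
  right; right; left. exists i; auto.
Qed.

Lemma subst_shape b u c c' :
  shape M (fun p p' => substM M b u p p')
    (fun p p' => exists u', liftM M (k 0) u u' /\ substM M (ms b) u' p p') c c' ->
  substM M b u c c'.
Proof.
  intros H. apply lfp_fold; [apply fin_Subst|]. exists b, u, c, c'. split; auto.
Qed.

Ltac shape_succ := right; right; left; do 2 eexists; split; [|split; reflexivity].
Ltac shape_bin := right; right; right; left; do 4 eexists; split; [|split].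
Ltac shape_all := right; right; right; right; do 2 eexists; split; [|split; reflexivity].

Lemma closed_zero : closedc kZero.
Proof. split; intros; [apply lift_shape|apply subst_shape]; left; auto. Qed.

Lemma closed_succ u : closedc u -> closedc (kSucc u).
Proof.
  intros [H1 H2]. split; intros; [apply lift_shape|apply subst_shape]; shape_succ; auto.
Qed.

Lemma term_zero b : termB M b kZero.
Proof. apply lfp_fold; [apply fin_TermB|]. right; left; auto. Qed.

Lemma term_succ b u : termB M b u -> termB M b (kSucc u).
Proof. intros H. apply lfp_fold; [apply fin_TermB|]. right; right; left; eauto. Qed.

(** The induction takes place inside the model, hence the detour by the formulas that
    express the claim. *)
Lemma numeral n : exists u, numM M n u /\ termB M mz u /\ closedc u.
Proof.
  enough (H : exists u, st M (scons n (scons u (fun _ => mz))) Num /\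
    st M (scons mz (scons u (fun _ => mz))) TermB /\
    (forall b, st M (scons b (scons u (scons u (fun _ => mz)))) Lift) /\
    (forall b s, st M (scons b (scons s (scons u (scons u (fun _ => mz))))) Subst)).
  { destruct H as (u & H1 & H2 & H3 & H4). exists u. rewrite sem_Num in H1. rewrite sem_TermB in H2.
    repeat split; auto; intros; [specialize (H3 b); rewrite sem_Lift in H3; auto|].
    specialize (H4 b s); rewrite sem_Subst in H4; auto. }
  revert n. apply induct; [dfn| |].
  - exists kZero. rewrite sem_Num, sem_TermB. repeat split; intros.
    + apply num_0.
    + apply term_zero.
    + apply sem_Lift. apply (proj1 closed_zero).
    + apply sem_Subst. apply (proj2 closed_zero).
  - intros n (u & H1 & H2 & H3 & H4). exists (kSucc u).
    assert (C : closedc u).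
    { split; intros; [specialize (H3 b); rewrite sem_Lift in H3; auto|].
      specialize (H4 b s); rewrite sem_Subst in H4; auto. }
    rewrite sem_Num, sem_TermB in *. repeat split; intros.
    + apply num_S, H1.
    + apply term_succ, H2.
    + apply sem_Lift. apply (proj1 (closed_succ _ C)).
    + apply sem_Subst. apply (proj2 (closed_succ _ C)).
Qed.

(** ** Terms and formulas with additional constants *)

(** The model applies its substitutions to formulas of standard shape in which
    numerals of nonstandard length occur; [XC u] is such a numeral, given by its
    code. For these formulas the operations of the model can be computed outside. *)
Inductive xt : Type :=
| XV (i : nat)
| X0
| XS (t : xt)
| XP (s t : xt)
| XM (s t : xt)
| XC (u : M) (H : closedc u).

Inductive xf : Type :=
| XB
| XE (s t : xt)
| XI (p q : xf)
| XA (p : xf).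

Fixpoint kt (t : xt) : M :=
  match t with
  | XV i => kVar (k i)
  | X0 => kZero
  | XS t => kSucc (kt t)
  | XP s t => kPlus (kt s) (kt t)
  | XM s t => kMult (kt s) (kt t)
  | XC u _ => u
  end.

Fixpoint kf (p : xf) : M :=
  match p with
  | XB => kBot
  | XE s t => kEq (kt s) (kt t)
  | XI p q => kImp (kf p) (kf q)
  | XA p => kAll (kf p)
  end.

Fixpoint xts (sg : nat -> xt) (t : xt) : xt :=
  match t with
  | XV i => sg i
  | X0 => X0
  | XS t => XS (xts sg t)
  | XP s t => XP (xts sg s) (xts sg t)
  | XM s t => XM (xts sg s) (xts sg t)
  | XC u H => XC u H
  end.

Definition xup (sg : nat -> xt) : nat -> xt :=
  scons (XV 0) (fun i => xts (fun j => XV (S j)) (sg i)).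

Fixpoint xfs (sg : nat -> xt) (p : xf) : xf :=
  match p with
  | XB => XB
  | XE s t => XE (xts sg s) (xts sg t)
  | XI p q => XI (xfs sg p) (xfs sg q)
  | XA p => XA (xfs (xup sg) p)
  end.

Definition shift (b i : nat) : xt := if lt_dec i b then XV i else XV (S i).
Definition single (b : nat) (s : xt) (i : nat) : xt :=
  if lt_dec i b then XV i else if Nat.eq_dec i b then s else XV (pred i).

Lemma xts_ext sg sg' t : (forall i, sg i = sg' i) -> xts sg t = xts sg' t.
Proof. intros H; induction t; simpl; congruence. Qed.

Lemma xfs_ext p : forall sg sg', (forall i, sg i = sg' i) -> xfs sg p = xfs sg' p.
Proof.
  induction p; intros sg sg' H; simpl; f_equal; auto using xts_ext.
  apply IHp. intros [|i]; simpl; congruence.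
Qed.

Lemma xts_comp sg sg' t : xts sg (xts sg' t) = xts (fun i => xts sg (sg' i)) t.
Proof. induction t; simpl; congruence. Qed.

Lemma xfs_comp p : forall sg sg', xfs sg (xfs sg' p) = xfs (fun i => xts sg (sg' i)) p.
Proof.
  induction p; intros sg sg'; simpl; f_equal; auto using xts_comp.
  rewrite IHp. apply xfs_ext. intros [|i]; simpl; auto. rewrite !xts_comp. reflexivity.
Qed.

Lemma xup_shift b i : xup (shift b) i = shift (S b) i.
Proof.
  destruct i; unfold shift; simpl; auto.
  destruct (lt_dec i b), (lt_dec (S i) (S b)); simpl; auto; lia.
Qed.

Lemma xup_single b s i : xup (single b s) i = single (S b) (xts (fun j => XV (S j)) s) i.
Proof.
  destruct i; unfold single; simpl; auto.
  destruct (lt_dec i b), (lt_dec (S i) (S b)); simpl; auto; try lia.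
  destruct (Nat.eq_dec i b), (Nat.eq_dec (S i) (S b)); simpl; auto; try lia.
  f_equal; lia.
Qed.

Lemma nm_lt i j : (i < j)%nat -> nm M i < nm M j.
Proof.
  intros H. exists (nm M (j - S i)). change (ms (nm M i)) with (nm M (S i)).
  rewrite <- nm_add. f_equal; lia.
Qed.

Lemma nm_le i j : (i <= j)%nat -> nm M i <= nm M j.
Proof. intros H. exists (nm M (j - i)). rewrite <- nm_add. f_equal; lia. Qed.

Lemma lift_xt b t : liftM M (k b) (kt t) (kt (xts (shift b) t)).
Proof.
  induction t; simpl.
  - unfold shift. destruct (lt_dec i b).
    + apply lift_var_lt, nm_lt; auto.
    + apply lift_var_ge, nm_le; lia.
  - apply closed_zero.
  - apply lift_shape. shape_succ. auto.
  - apply lift_shape. shape_bin; [exact IHt1|exact IHt2|]. left; auto.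
  - apply lift_shape. shape_bin; [exact IHt1|exact IHt2|]. right; left; auto.
  - apply H.
Qed.

Lemma lift_xf p : forall b, liftM M (k b) (kf p) (kf (xfs (shift b) p)).
Proof.
  induction p; simpl; intros b.
  - apply lift_shape. right; left; auto.
  - apply lift_shape. shape_bin; [apply lift_xt|apply lift_xt|]. right; right; left; auto.
  - apply lift_shape. shape_bin; [apply IHp1|apply IHp2|]. right; right; right; auto.
  - apply lift_shape. shape_all. rewrite (xfs_ext p _ _ (xup_shift b)). apply (IHp (S b)).
Qed.

Lemma subst_xt b s t : substM M (k b) (kt s) (kt t) (kt (xts (single b s) t)).
Proof.
  induction t; simpl.
  - unfold single. destruct (lt_dec i b).
    + apply subst_var_lt, nm_lt; auto.
    + destruct (Nat.eq_dec i b) as [->|Hn]; [apply subst_var_eq|].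
      destruct i; [lia|]. apply subst_var_gt, nm_le; lia.
  - apply closed_zero.
  - apply subst_shape. shape_succ. auto.
  - apply subst_shape. shape_bin; [exact IHt1|exact IHt2|]. left; auto.
  - apply subst_shape. shape_bin; [exact IHt1|exact IHt2|]. right; left; auto.
  - apply H.
Qed.

Lemma subst_xf p : forall b s, substM M (k b) (kt s) (kf p) (kf (xfs (single b s) p)).
Proof.
  induction p; simpl; intros b u.
  - apply subst_shape. right; left; auto.
  - apply subst_shape. shape_bin; [apply subst_xt|apply subst_xt|]. right; right; left; auto.
  - apply subst_shape. shape_bin; [apply IHp1|apply IHp2|]. right; right; right; auto.
  - apply subst_shape. shape_all. exists (kt (xts (fun j => XV (S j)) u)). split.
    + apply (lift_xt 0).
    + rewrite (xfs_ext p _ _ (xup_single b u)). apply (IHp (S b)).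
Qed.

Fixpoint et (t : term) : xt :=
  match t with
  | Var i => XV i
  | Zero => X0
  | Succ t => XS (et t)
  | Plus s t => XP (et s) (et t)
  | Mult s t => XM (et s) (et t)
  end.

Fixpoint ef (p : form) : xf :=
  match p with
  | Bot => XB
  | Eq s t => XE (et s) (et t)
  | Imp p q => XI (ef p) (ef q)
  | All p => XA (ef p)
  end.

Lemma xts_num sg n : xts sg (et (num n)) = et (num n).
Proof.
  induction n; [reflexivity|]. change (num (S n)) with (Succ (num n)).
  simpl. congruence.
Qed.

Lemma kt_et t : kt (et t) = qt M t.
Proof. induction t; simpl; congruence. Qed.

Lemma kf_ef p : kf (ef p) = qf M p.
Proof. induction p; simpl; rewrite ?kt_et; congruence. Qed.

Lemma et_subst sg t : et (tsubst sg t) = xts (fun i => et (sg i)) (et t).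
Proof. induction t; simpl; congruence. Qed.

Lemma ef_subst p : forall sg, ef (fsubst sg p) = xfs (fun i => et (sg i)) (ef p).
Proof.
  induction p as [|s t|p IHp q IHq|p IH]; intros sg; simpl; rewrite ?et_subst; auto.
  { rewrite IHp, IHq. reflexivity. }
  rewrite IH. f_equal. apply xfs_ext. intros [|i]; simpl; auto.
  unfold tlift. rewrite et_subst. reflexivity.
Qed.

Lemma xts_et_id b t sg : tbounded b t -> (forall i, (i < b)%nat -> sg i = XV i) -> xts sg (et t) = et t.
Proof.
  induction t; simpl; intros Hb H; auto; try (f_equal; tauto).
Qed.

Lemma xfs_ef_id p : forall b sg,
  bounded b p -> (forall i, (i < b)%nat -> sg i = XV i) -> xfs sg (ef p) = ef p.
Proof.
  induction p as [|s t|p IHp q IHq|p IH]; simpl; intros b sg Hb H; auto.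
  - destruct Hb. f_equal; eapply xts_et_id; eauto.
  - destruct Hb. f_equal; eauto.
  - f_equal. apply (IH (S b)); auto. intros [|i] Hi; simpl; auto.
    rewrite H by lia. reflexivity.
Qed.

Lemma subst_std b t p sg :
  (forall i, et (sg i) = single b (et t) i) ->
  substM M (k b) (qt M t) (qf M p) (qf M (fsubst sg p)).
Proof.
  intros H. rewrite <- kt_et, <- !kf_ef, ef_subst, (xfs_ext _ _ _ H). apply subst_xf.
Qed.

Lemma lift_std b p sg :
  (forall i, et (sg i) = shift b i) -> liftM M (k b) (qf M p) (qf M (fsubst sg p)).
Proof.
  intros H. rewrite <- !kf_ef, ef_subst, (xfs_ext _ _ _ H). apply lift_xf.
Qed.

Lemma subst_inst t p : substM M (k 0) (qt M t) (qf M p) (qf M (inst p t)).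
Proof.
  apply subst_std. intros [|i]; reflexivity.
Qed.

Lemma lift_flift p : liftM M (k 0) (qf M p) (qf M (flift p)).
Proof. apply lift_std. intros [|i]; reflexivity. Qed.

Lemma termB_std b t : tbounded b t -> termB M (k b) (qt M t).
Proof.
  induction t; simpl; intros Hb; (apply lfp_fold; [apply fin_TermB|]).
  - left. exists (k i). split; auto. apply nm_lt; auto.
  - right; left; auto.
  - right; right; left. exists (qt M t). split; [apply IHt, Hb|reflexivity].
  - right; right; right. exists (qt M t1), (qt M t2). split; [apply IHt1, Hb|split; [apply IHt2, Hb|auto]].
  - right; right; right. exists (qt M t1), (qt M t2). split; [apply IHt1, Hb|split; [apply IHt2, Hb|auto]].
Qed.

Lemma formB_std p : forall b, bounded b p -> formB M (k b) (qf M p).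
Proof.
  induction p as [|s t|p IHp q IHq|p IH]; simpl; intros b Hb; (apply lfp_fold; [apply fin_FormB|]);
    eexists _, _; (split; [reflexivity|]).
  - left; auto.
  - right; left. exists (qt M s), (qt M t). split; [|split]; auto; apply termB_std; tauto.
  - right; right; left. exists (qf M p), (qf M q). split; [apply IHp, Hb|split; [apply IHq, Hb|auto]].
  - right; right; right. exists (qf M p). split; auto. apply (IH (S b)), Hb.
Qed.

Lemma isTerm_std t : isTermM M (qt M t).
Proof. destruct (tbounded_ex t) as [b Hb]. exists (k b). apply termB_std, Hb. Qed.

Lemma isForm_std p : isFormM M (qf M p).
Proof. destruct (bounded_ex p) as [b Hb]. exists (k b). apply formB_std, Hb. Qed.

(** ** Provability *)

Section Provability.
Variable ax : M -> Prop.
Hypothesis Hax : forall y, paAxM M y -> ax y.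

Lemma prv_log x : logAxM M x -> prvM M ax x.
Proof. intros H. apply lfp_fold; [apply fin_Prv|]. left; auto. Qed.

Lemma prv_ax x : ax x -> prvM M ax x.
Proof. intros H. apply lfp_fold; [apply fin_Prv|]. right; left; auto. Qed.

Lemma prv_mp x y : prvM M ax (kImp x y) -> prvM M ax x -> prvM M ax y.
Proof. intros H1 H2. apply lfp_fold; [apply fin_Prv|]. right; right; left; eauto. Qed.

Lemma prv_gen x : prvM M ax x -> prvM M ax (kAll x).
Proof. intros H. apply lfp_fold; [apply fin_Prv|]. right; right; right; eauto. Qed.

Lemma logAx_std p : logical_axiom p -> logAxM M (qf M p).
Proof.
  intros H. unfold logAxM. destruct H.
  - left. exists (qf M p), (qf M q). auto using isForm_std.
  - right; left. exists (qf M p), (qf M q), (qf M r). auto using isForm_std.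
  - do 2 right; left. exists (qf M p). auto using isForm_std.
  - do 3 right; left. exists (qf M p), (qt M t), (qf M (inst p t)).
    auto using isForm_std, isTerm_std, subst_inst.
  - do 4 right; left. exists (qf M p), (qf M q). auto using isForm_std.
  - do 5 right; left. exists (qf M p), (qf M (flift p)). auto using isForm_std, lift_flift.
  - do 6 right; left. exists (qt M t). auto using isTerm_std.
  - do 7 right; left. exists (qt M s), (qt M t), (qt M u). auto using isTerm_std.
  - do 8 right; left. exists (qt M s), (qt M t). auto using isTerm_std.
  - do 9 right. exists (qt M s), (qt M t), (qt M u), (qt M w). auto 10 using isTerm_std.
  - do 9 right. exists (qt M s), (qt M t), (qt M u), (qt M w). auto 10 using isTerm_std.
Qed.

Lemma paAx_std p : PA p -> paAxM M (qf M p).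
Proof.
  intros [q H|q].
  - left. eauto.
  - right. exists (qf M q), (qf M (inst q Zero)),
      (qf M (fsubst (fun i => match i with 0 => Var 0 | S j => Var (S (S j)) end) q)),
      (qf M (fsucc q)).
    split; [apply isForm_std|]. split; [apply (subst_inst Zero)|].
    split; [apply lift_std; intros [|i]; reflexivity|]. split; [|reflexivity].
    unfold fsucc. rewrite (fsubst_ext q (scons (Succ (Var 0)) (fun i => Var (S i)))
      (fun i => tsubst (scons (Succ (Var 0)) Var)
         (match i with 0 => Var 0 | S j => Var (S (S j)) end))) by (intros [|i]; reflexivity).
    rewrite <- fsubst_comp. apply (subst_inst (Succ (Var 0))).
Qed.

(** The first derivability condition. *)
Lemma prv_std p : provable PA p -> prvM M ax (qf M p).
Proof.
  intros H. induction H as [p H|p H|p q _ IH1 _ IH2|p _ IH].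
  - apply prv_log, logAx_std, H.
  - apply prv_ax, Hax, paAx_std, H.
  - exact (prv_mp _ _ IH1 IH2).
  - exact (prv_gen _ IH).
Qed.

(** Provability of an instance at a possibly nonstandard numeral. *)
Lemma prv_inst p u (Hu : closedc u) : isTermM M u -> provable PA p ->
  prvM M ax (kf (xfs (single 0 (XC u Hu)) (ef p))).
Proof.
  intros Ht H. apply (prv_mp (kAll (qf M p))).
  - apply prv_log. do 3 right; left. exists (qf M p), u, (kf (xfs (single 0 (XC u Hu)) (ef p))).
    split; [apply isForm_std|]. split; auto. split; auto.
    rewrite <- kf_ef. apply (subst_xf (ef p) 0 (XC u Hu)).
  - apply prv_gen, prv_std, H.
Qed.

End Provability.
End Closure.

(** * Reflection along descending sequences *)

Section Iterates.
Variable M : pam.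
Implicit Types (x y z : M) (r : nat -> M).
Local Open Scope pa_scope.

Lemma ax_PA a y : paAxM M y -> axM M a y.
Proof. intros H. apply lfp_fold; [apply fin_Ax|]. exists a, y. auto. Qed.

Lemma ax_below b a y : belowM M b a -> axM M b y -> axM M a y.
Proof.
  intros H H1. apply lfp_fold; [apply fin_Ax|]. exists a, y. split; auto.
  right. exists b. auto.
Qed.

Lemma ax_refl_instance b a y : belowM M b a -> reflVM M (qf M UPrvV) b y -> axM M a y.
Proof.
  intros H H1. apply lfp_fold; [apply fin_Ax|]. exists a, y. split; auto.
  right. exists b. auto.
Qed.

(** The iterates increase: an axiom of the lower one is an axiom of the higher one. *)
Lemma uprv_below b a p x : belowM M b a -> uprvM M b p x -> uprvM M a p x.
Proof.
  intros H (z & Hz & Hp). exists z. split; auto.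
  apply (lfp_mono M _ _ z) with (2 := Hp). intros Q y [A|[A|A]].
  - left; auto.
  - right; left. apply (ax_below b); auto.
  - right; right; auto.
Qed.

End Iterates.

Section Core.

(** The variables of [UPrv] are the index of the iterate, the code and the argument. *)
Definition refl_sub (D : form) (i : nat) : term :=
  match i with
  | 0 => Var 1
  | 1 => num (fcode D)
  | 2 => Var 0
  | S j => Var j
  end.

(** [forall x, Prv_a(D(x dot)) -> D(x)], with [a] as a free variable. *)
Definition refl_form (D : form) : form := All (Imp (fsubst (refl_sub D) UPrv) D).

Lemma sem_refl_form (M : pam) D (r : nat -> M) :
  st M r (refl_form D) <-> forall x, uprvM M (r 0) (qf M D) x -> st M (scons x r) D.
Proof.
  cbn [refl_form st].
  enough (E : forall x, st M (scons x r) (fsubst (refl_sub D) UPrv) <->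
       uprvM M (r 0) (qf M D) x).
  { split; intros H x Hx; apply H, E, Hx. }
  intros x. rewrite st_subst, sem_UPrv. cbn [refl_sub ev scons]. rewrite ev_num, nm_fcode. tauto.
Qed.

(** The instance of reflection for [T_a] and [D] is an axiom of [T_a'], and PA proves,
    uniformly in [a], that it implies [D(a)]. All this is formalized in PA, as it
    holds in an arbitrary model for nonstandard [a] too. *)
Lemma internal_reflection (M : pam) D : bounded 1 D ->
  provable PA (Imp (refl_form D) D) ->
  forall a a' : M, belowM M a a' -> uprvM M a' (qf M D) a.
Proof.
  intros HD HP a a' Hb.
  destruct (numeral M a) as (u & Hu & Ht & Hc).
  exists (kf M (xfs M (single M 0 (XC M u Hc)) (ef M D))). split.
  { exists u. split; auto. rewrite <- (kf_ef M D). apply (subst_xf M (ef M D) 0 (XC M u Hc)). }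
  pose proof (prv_inst M (axM M a') (ax_PA M a') (Imp (refl_form D) D) u Hc
    (ex_intro (fun b => termB M b u) _ Ht) HP) as H.
  apply (prv_mp M (axM M a') _ _ H). apply prv_ax.
  apply (ax_refl_instance M a a'); auto.
  set (w1 := xfs M (single M 0 (XC M u Hc)) (ef M UPrv)).
  set (w2 := xfs M (single M 0 (et M (num (fcode D)))) w1).
  exists (qf M D), (qf M UPrv), (kf M w1), (kf M w2).
  split; [apply (formB_std M D 1 HD)|]. split; [|split; [|split]].
  - exists (qt M (num (fcode UPrvV))). split.
    + rewrite <- nm_fcode. apply num_std.
    + rewrite <- UPrv_diag. apply subst_inst.
  - exists u. split; auto. rewrite <- (kf_ef M UPrv). apply (subst_xf M (ef M UPrv) 0 (XC M u Hc)).
  - exists (qt M (num (fcode D))). split.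
    + rewrite <- nm_fcode. apply num_std.
    + rewrite <- (kt_et M (num (fcode D))). apply (subst_xf M w1 0).
  - assert (E1 : xfs M (xup M (single M 0 (XC M u Hc))) (ef M (fsubst (refl_sub D) UPrv)) = w2).
    { unfold w2, w1. rewrite ef_subst, !xfs_comp. apply xfs_ext.
      intros [|[|[|[|i]]]]; cbn -[num]; rewrite ?xts_num. all: reflexivity. }
    assert (E2 : xfs M (xup M (single M 0 (XC M u Hc))) (ef M D) = ef M D).
    { apply (xfs_ef_id M D 1); auto. intros [|i] Hi; [reflexivity|lia]. }
    transitivity (kAll M (kImp M
      (kf M (xfs M (xup M (single M 0 (XC M u Hc))) (ef M (fsubst (refl_sub D) UPrv))))
      (kf M (xfs M (xup M (single M 0 (XC M u Hc))) (ef M D))))); [reflexivity|].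
    rewrite E1, E2, kf_ef. reflexivity.
Qed.

Lemma tbounded_subst k t sg : (forall i, tbounded k (sg i)) -> tbounded k (tsubst sg t).
Proof. intros H; induction t; simpl; auto. Qed.

Lemma tbounded_lift t : forall k, tbounded k t -> tbounded (S k) (tlift t).
Proof.
  unfold tlift. induction t; simpl; intros k H; auto; try lia.
  - destruct H; auto.
  - destruct H; auto.
Qed.

Lemma bounded_subst p : forall k sg, (forall i, tbounded k (sg i)) -> bounded k (fsubst sg p).
Proof.
  induction p as [|s t|p IHp q IHq|p IH]; simpl; intros k sg H; auto using tbounded_subst.
  apply IH. intros [|i]; simpl; [lia|]. apply tbounded_lift; auto.
Qed.

Lemma tbounded_num n k : tbounded k (num n).
Proof. induction n; [exact I|exact IHn]. Qed.

(** Makes the free variables of a formula known without computing them. *)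
Definition cut (k : nat) (p : form) : form :=
  fsubst (fun i => if lt_dec i k then Var i else Zero) p.

Lemma bounded_cut k p : bounded k (cut k p).
Proof.
  apply bounded_subst. intros i. destruct (lt_dec i k); simpl; auto.
Qed.

(** [S] defines the descending set of notations; its free variables other than the
    first are read as zero. *)
Variable S : form.

Definition holds (M : pam) (a : M) : Prop := st M (scons a (fun _ => mz)) S.

Definition diagV : form := cut 2 (lam2 (fun v x => (app S [x] ->'
  ∃' c z g u, app S [c] /\' app (Pow 2) [c; z] /\' app Num [v; u] /\'
    g =' cAll (cImp (cEq (cVar #0) u) v) /\' (app UPrv [z; g; c] ->' fun _ => Bot))%fm)).

(** In [diagV] the variable [v] stands for the code of [diagV] itself, from which the
    code [g] of [diag] is computed. Thus [diag(x)] speaks of the provability of [diag]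
    (see [sem_diag]), in the iterates [2 ^ c] for members [c] of the set. *)
Definition diag : form := All (Imp (Eq (Var 0) (num (fcode diagV))) diagV).

Lemma bounded_diag : bounded 1 diag.
Proof.
  cbn [diag bounded]. split; [split; [simpl; lia|apply tbounded_num]|]. apply bounded_cut.
Qed.

Lemma qf_diag (M : pam) :
  qf M diag = kAll M (kImp M (kEq M (kVar M (nm M 0)) (qt M (num (fcode diagV)))) (nm M (fcode diagV))).
Proof. rewrite nm_fcode. reflexivity. Qed.

Lemma sem_diag (M : pam) (x : M) r : st M (scons x r) diag <->
  (holds M x -> exists c z, holds M c /\ powM M 2 c z /\ ~ uprvM M z (qf M diag) c).
Proof.
  set (n := fcode diagV).
  assert (E1 : st M (scons x r) diag <-> st M (scons (nm M n) (scons x r)) diagV).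
  { cbn [diag st ev scons]. fold n. split.
    - intros H. apply H. rewrite ev_num. reflexivity.
    - intros H y ->. rewrite ev_num. exact H. }
  rewrite E1. unfold diagV, cut. rewrite st_subst.
  set (r' := fun i => ev M (scons (nm M n) (scons x r)) (if lt_dec i 2 then Var i else Zero)).
  assert (E2 : st M r' (lam2 (fun v x => (app S [x] ->'
  ∃' c z g u, app S [c] /\' app (Pow 2) [c; z] /\' app Num [v; u] /\'
    g =' cAll (cImp (cEq (cVar #0) u) v) /\' (app UPrv [z; g; c] ->' fun _ => Bot))%fm)) <->
    (holds M x -> exists c z g u, holds M c /\ powM M 2 c z /\ numM M (nm M n) u /\
      g = kAll M (kImp M (kEq M (kVar M (nm M 0)) u) (nm M n)) /\ (uprvM M z g c -> False))).
  { assert (ES : forall s : nat -> M, (forall i, s (Datatypes.S i) = mz) -> (st M s S <-> holds M (s 0))).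
    { intros s H. apply st_ext. intros [|i]; simpl; auto. }
    unfold kAll, kImp, kEq, kVar, pr. fm_unfold.
    sem ltac:(first [rewrite sem_Pow | rewrite sem_Num | rewrite sem_UPrv |
      (rewrite ES; [|intros [|i]; reflexivity])]). }
  rewrite E2. split; intros H Hx; specialize (H Hx).
  - destruct H as (c & z & g & u & Hc & Hz & Hu & -> & Hp). exists c, z.
    apply num_uniq in Hu. subst u. rewrite qf_diag. auto.
  - destruct H as (c & z & Hc & Hz & Hp).
    exists c, z, (qf M diag), (qt M (num n)). rewrite qf_diag in *.
    repeat split; auto. apply num_std.
Qed.

Hypothesis descend : forall (M : pam) (a : M), holds M a ->
  exists b z, holds M b /\ powM M 2 b z /\ belowM M z a.

(** If [diag(b)] is provable for the [b] next to [a] then so it is in [T_a], and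
    reflection for [T_a] gives [diag(b)], which has the conclusion of [diag(a)]. *)
Lemma refl_diag : provable PA (Imp (refl_form diag) diag).
Proof.
  apply completeness. intros M' HM r. set (M := mkPam M' HM). change (st M r (Imp (refl_form diag) diag)).
  cbn [st]. rewrite sem_refl_form. intros H.
  rewrite (st_ext M diag r (scons (r 0) (fun i => r (Datatypes.S i)))) by (intros [|i]; reflexivity).
  apply sem_diag. intros Ha. destruct (descend M (r 0) Ha) as (b & z & Hb & Hz & Hl).
  destruct (classic (uprvM M z (qf M diag) b)) as [Hp|Hp]; [|eauto].
  apply (uprv_below M _ _ _ _ Hl), H in Hp. apply sem_diag in Hp; auto.
Qed.

(** A descending sequence of notations starting at [L] is incompatible with
    reflection for the iterate [L]: this is Goedel's second theorem for [diag],
    with reflection in the place of the third derivability condition. *)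
Theorem reflection_excludes_descent (L : nat) (phi : form) (T : theory) :
  (forall (M : pam) (r : nat -> M), ~ st M r phi -> holds M (nm M L)) ->
  (forall q, PA q -> T q) -> (forall p, bounded 1 p -> T (reflection L p)) ->
  provable T phi.
Proof.
  intros HL HPA HR. apply completeness. intros M' HM r. apply NNPP. intros Hn.
  set (M := mkPam M' (fun q Hq => HM q (HPA q Hq))).
  apply (HL M r) in Hn.
  destruct (descend M _ Hn) as (b & z & Hb & Hz & Hl).
  (* As [2 ^ c] is above [c], the iterate [2 ^ c] proves [diag(c)] for all [c]. *)
  assert (I : forall c z : M, powM M 2 c z -> uprvM M z (qf M diag) c).
  { intros c w Hw. apply internal_reflection; [apply bounded_diag|apply refl_diag|].
    left. exact Hw. }
  pose proof (uprv_below M _ _ _ _ Hl (I b z Hz)) as Hp.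
  pose proof (HM _ (HR diag bounded_diag) r b) as R.
  change (st M (scons b r) (Imp (inst (inst UPrv (num L)) (num (fcode diag))) diag)) in R.
  cbn [st] in R. unfold inst in R. rewrite !st_subst, sem_UPrv in R.
  cbn [ev scons] in R.
  rewrite !ev_num, nm_fcode in R.
  (* The iterate [L] proves [diag(b)], so [diag(b)] holds: some [diag(c)] is unprovable. *)
  apply R in Hp. apply sem_diag in Hp; auto.
  destruct Hp as (c & w & _ & Hw & Hc). apply Hc, I, Hw.
Qed.

End Core.

(** * A hierarchy of uniformly defined relations *)

(** A relation is given in all models at once, and closure properties are proved
    uniformly, so that the witnessing formula does not depend on the model. *)
Definition rel : Type := forall M : pam, (nat -> M) -> Prop.

Definition poly (t : forall M : pam, (nat -> M) -> M) : Prop :=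
  exists t0, forall M r, t M r = ev M r t0.

Lemma poly_var i : poly (fun M e => e i).
Proof. exists (Var i). reflexivity. Qed.
Lemma poly_mz : poly (fun M e => mz).
Proof. exists Zero. reflexivity. Qed.
Lemma poly_ms t : poly t -> poly (fun M e => ms (t M e)).
Proof. intros [t0 H]. exists (Succ t0). intros; simpl; congruence. Qed.
Lemma poly_mp s t : poly s -> poly t -> poly (fun M e => mp (s M e) (t M e)).
Proof. intros [s0 H] [t0 H']. exists (Plus s0 t0). intros; simpl; congruence. Qed.
Lemma poly_mm s t : poly s -> poly t -> poly (fun M e => mm (s M e) (t M e)).
Proof. intros [s0 H] [t0 H']. exists (Mult s0 t0). intros; simpl; congruence. Qed.
Lemma poly_nm n : poly (fun M e => nm M n).
Proof. exists (num n). intros; symmetry; apply ev_num. Qed.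
Lemma poly_subst t s : poly t -> (forall i, poly (s i)) -> poly (fun M e => t M (fun i => s i M e)).
Proof.
  intros [t0 H] Hs.
  set (sg := fun i => epsilon (inhabits Zero) (fun t1 => forall M r, s i M r = ev M r t1)).
  exists (tsubst sg t0). intros M r. rewrite ev_subst, H. apply ev_ext. intros i.
  apply (epsilon_spec (inhabits Zero) (fun t1 => forall M r, s i M r = ev M r t1)), Hs.
Qed.

Ltac poly_tac :=
  cbv beta;
  lazymatch goal with
  | |- poly (fun M e => e ?i) => apply poly_var
  | |- poly (fun M e => ms _) => apply poly_ms; poly_tac
  | |- poly (fun M e => mp _ _) => apply poly_mp; poly_tac
  | |- poly (fun M e => mm _ _) => apply poly_mm; poly_tac
  | |- poly (fun M e => pr _ _ _) => unfold pr; poly_tac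
  | |- poly (fun M e => one) => unfold one; poly_tac
  | |- poly (fun M e => mz) => apply poly_mz
  | |- poly (fun M e => nm _ _) => apply poly_nm
  | |- poly (fun M e => scons _ _ ?i) =>
      is_var i; destruct i as [|i]; cbn [scons]; poly_tac
  | |- _ => first [assumption | eassumption]
  end.

(** The closure properties of the bounded formulas, shared by all levels of the
    hierarchy; what is proved from them can be iterated. *)
Record closed_class (C : rel -> Prop) : Prop := {
  g_iff : forall P Q : rel, (forall M r, P M r <-> Q M r) -> C P -> C Q;
  g_def : forall P, C P -> exists p, forall (M : pam) r, st M r p <-> P M r;
  g_eq : forall s t, poly s -> poly t -> C (fun M e => s M e = t M e);
  g_not : forall P, C P -> C (fun M e => ~ P M e);
  g_and : forall P Q, C P -> C Q -> C (fun M e => P M e /\ Q M e);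
  g_ball : forall (P : forall M : pam, M -> (nat -> M) -> Prop) t,
    C (fun M e => P M (e 0) (fun i => e (S i))) -> poly t ->
    C (fun M e => forall x, le x (t M e) -> P M x e);
  g_subst : forall P (s : nat -> forall M : pam, (nat -> M) -> M),
    C P -> (forall i, poly (s i)) -> C (fun M e => P M (fun i => s i M e)) }.

Arguments g_iff {C}.
Arguments g_def {C}.
Arguments g_eq {C}.
Arguments g_not {C}.
Arguments g_and {C}.
Arguments g_ball {C}.
Arguments g_subst {C}.

Section ClosedClass.
Variable C : rel -> Prop.
Hypothesis G : closed_class C.

Lemma g_imp P Q : C P -> C Q -> C (fun M e => P M e -> Q M e).
Proof.
  intros HP HQ. apply (g_iff G (fun M e => ~ (P M e /\ ~ Q M e))).
  - intros M e. tauto.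
  - apply (g_not G), (g_and G); auto. apply (g_not G); auto.
Qed.

Lemma g_or P Q : C P -> C Q -> C (fun M e => P M e \/ Q M e).
Proof.
  intros HP HQ. apply (g_iff G (fun M e => ~ P M e -> Q M e)).
  - intros M e. tauto.
  - apply g_imp; auto. apply (g_not G); auto.
Qed.

Lemma g_bex (P : forall M : pam, M -> (nat -> M) -> Prop) t :
  C (fun M e => P M (e 0) (fun i => e (S i))) -> poly t ->
  C (fun M e => exists x, le x (t M e) /\ P M x e).
Proof.
  intros HP Ht. apply (g_iff G (fun M e => ~ forall x, le x (t M e) -> ~ P M x e)).
  - intros M e. split; [|firstorder]. intros H. apply NNPP. firstorder.
  - apply (g_not G), (g_ball G (fun M x e => ~ P M x e)); auto. apply (g_not G), HP.
Qed.

Lemma g_le s t : poly s -> poly t -> C (fun M e => le (s M e) (t M e)).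
Proof.
  intros Hs Ht.
  apply (g_iff G (fun M e => exists x, le x (t M e) /\ mp x (s M e) = t M e)).
  - intros M e. split; [intros (x & _ & H); exists x; auto|].
    intros [x H]. exists x. split; auto. rewrite <- H. apply le_add_r.
  - apply (g_bex (fun M x e => mp x (s M e) = t M e)); auto.
    apply (g_eq G).
    + apply poly_mp; [apply poly_var|].
      apply (poly_subst s (fun i M e => e (S i))); auto. intros; apply poly_var.
    + apply (poly_subst t (fun i M e => e (S i))); auto. intros; apply poly_var.
Qed.

End ClosedClass.

(** Follows the definition of a relation down to atoms and hypotheses. *)
Ltac cc G :=
  cbv beta;
  lazymatch goal with
  | |- _ (fun M e => ~ _) => apply (g_not G); cc G
  | |- _ (fun M e => _ /\ _) => apply (g_and G); cc G
  | |- _ (fun M e => _ \/ _) => apply (g_or _ G); cc G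
  | |- _ (fun M e => forall x, le x _ -> _) => apply (g_ball G); [cc G|poly_tac]
  | |- _ (fun M e => exists x, le x _ /\ _) => apply (g_bex _ G); [cc G|poly_tac]
  | |- _ (fun M e => le _ _) => apply (g_le _ G); poly_tac
  | |- _ (fun M e => lt _ _) => unfold lt; apply (g_le _ G); poly_tac
  | |- _ (fun M e => @eq (car _) _ _) => apply (g_eq G); poly_tac
  | |- _ (fun M e => ?A -> ?B) => apply (g_imp _ G); cc G
  | H : ?C ?Q |- ?C (fun M e => ?Q M (@?env M e)) =>
      apply (g_subst G Q (fun i M e => env M e i) H); intros ?i; poly_tac
  | |- _ => try assumption
  end.

(** ** The lowest level *)

Lemma tsubst_tlift sg t : tsubst (up sg) (tlift t) = tlift (tsubst sg t).
Proof. unfold tlift. rewrite !tsubst_comp. apply tsubst_ext. reflexivity. Qed.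

Lemma delta0_subst p : delta0 p -> forall sg, delta0 (fsubst sg p).
Proof.
  induction 1; intros sg; cbn [fsubst].
  - constructor.
  - constructor.
  - unfold Le, Ex, Neg. cbn [fsubst tsubst]. rewrite !tsubst_tlift. apply (delta0_le (tsubst sg s)).
  - constructor; auto.
  - change (fsubst (up sg) (Le (Var 0) (tlift t))) with
      (Ex (Eq (Plus (Var 0) (tsubst (up (up sg)) (tlift (Var 0)))) (tsubst (up (up sg)) (tlift (tlift t))))).
    rewrite !tsubst_tlift. apply (delta0_all (tsubst sg t)). auto.
Qed.

Definition class0 (P : rel) : Prop := exists p, delta0 p /\ forall (M : pam) r, st M r p <-> P M r.

Lemma closed_class0 : closed_class class0.
Proof.
  split.
  - intros P Q H (p & Hp & E). exists p. split; auto. intros M r. rewrite E. auto.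
  - intros P (p & _ & E). eauto.
  - intros s t [s0 Hs] [t0 Ht]. exists (Eq s0 t0). split; [constructor|].
    intros M r. cbn. rewrite Hs, Ht. tauto.
  - intros P (p & Hp & E). exists (Neg p). split; [repeat constructor; auto|].
    intros M r. cbn. rewrite E. tauto.
  - intros P Q (p & Hp & E) (q & Hq & E'). exists (And p q). split; [repeat constructor; auto|].
    intros M r. rewrite st_And, E, E'. tauto.
  - intros P t (p & Hp & E) [t0 Ht]. exists (All (Imp (Le (Var 0) (tlift t0)) p)).
    split; [constructor; auto|]. intros M r.
    assert (E1 : forall x, st M (scons x r) (Imp (Le (Var 0) (tlift t0)) p) <->
      (le x (t M r) -> P M x r)).
    { intros x. cbn [st]. rewrite st_Le, E. cbn [ev scons]. unfold tlift. rewrite ev_subst.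
      cbn [ev scons]. rewrite Ht. rewrite (ev_ext M (fun i => r i) r) by auto. tauto. }
    split; intros H x; apply E1; exact (H x).
  - intros P s (p & Hp & E) Hs.
    set (sg := fun i => epsilon (inhabits Zero) (fun t1 => forall M r, s i M r = ev M r t1)).
    exists (fsubst sg p). split; [apply delta0_subst; auto|].
    intros M r. rewrite st_subst, <- E. apply st_ext. intros i. symmetry.
    apply (epsilon_spec (inhabits Zero) (fun t1 => forall M r, s i M r = ev M r t1)), Hs.
Qed.

Definition udef (P : rel) : Prop := exists p, forall (M : pam) r, st M r p <-> P M r.

Lemma Def_rel (M : pam) (P : rel) (s : (nat -> M) -> nat -> M) :
  udef P -> (forall i, dtm M (fun e => s e i)) -> Def M (fun e => P M (s e)).
Proof.
  intros [p Hp] Hs. apply (Def_iff M (fun e => st M (s e) p)).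
  - intros e. apply Hp.
  - apply Def_st, Hs.
Qed.

(** ** Codes of sequences *)

Section Entries.
Variable M : pam.
Local Open Scope pa_scope.

(** The entries of coded sequences, with all quantifiers bounded by the code. *)
Definition betaC (c d i y : M) : Prop :=
  y < modulus M d i /\ exists q, q <= c /\ c = q * modulus M d i + y.

Lemma betaC_iff c d i y : betaC c d i y <-> beta M c d i y.
Proof.
  unfold betaC, beta. split.
  - intros (H & q & _ & E). eauto.
  - intros (H & q & E). split; auto. exists q. split; auto.
    rewrite E. apply (le_trans M _ (q * modulus M d i)); [|apply le_add_r].
    exists (q * (ms i * d)). unfold modulus. rewrite mul_S_r. auto.
Qed.

Lemma beta_le (c d i y : M) : beta M c d i y -> y <= c.
Proof. intros (_ & q & ->). apply le_add_l. Qed.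

Definition entry (a i y : M) : Prop :=
  exists c, c <= a /\ exists d, d <= a /\ a = pr M c d /\ betaC c d i y.

Lemma entry_fun a i y y' : entry a i y -> entry a i y' -> y = y'.
Proof.
  intros (c & Hc & d & Hd & E & B) (c' & Hc' & d' & Hd' & E' & B').
  rewrite E in E'. apply pr_inj in E'. destruct E' as [<- <-].
  apply betaC_iff in B, B'. eapply beta_fun; eauto.
Qed.

Lemma entry_intro c d i y : beta M c d i y -> entry (pr M c d) i y.
Proof.
  intros B. exists c. split; [apply le_pr_l|]. exists d. split; [apply le_pr_r|].
  split; auto. apply betaC_iff; auto.
Qed.

Lemma entry_le a i y : entry a i y -> y <= a.
Proof.
  intros (c & Hc & d & Hd & E & B). apply betaC_iff, beta_le in B. eapply le_trans; eauto.
Qed.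

(** [i <= n] makes the quantifier bounded; the entries below [n] are meant. *)
Definition agree (n a b : M) : Prop :=
  forall i, i <= n -> i < n -> exists y, y <= a /\ (entry a i y /\ entry b i y).

(** A sequence has many codes; the least one is taken where a code has to be unique. *)
Definition canon (n a : M) : Prop := forall b, b <= a -> b <> a -> ~ agree n a b.

Lemma agree_sym n a b : agree n a b -> agree n b a.
Proof.
  intros H i Hi Hi'. destruct (H i Hi Hi') as (y & _ & A & B). exists y.
  split; auto. eapply entry_le; eauto.
Qed.

Lemma canon_unique n a b : canon n a -> canon n b -> agree n a b -> a = b.
Proof.
  intros Ha Hb H. destruct (trichotomy M a b) as [T|[T|T]]; auto; exfalso.
  - apply (Hb a (lt_le M _ _ T)).
    + intros ->. exact (lt_irrefl M _ T).
    + apply agree_sym, H.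
  - apply (Ha b (lt_le M _ _ T)); auto. intros ->. exact (lt_irrefl M _ T).
Qed.

Lemma agree_entry n a b i y : agree n a b -> i < n -> entry a i y -> entry b i y.
Proof.
  intros H Hi Hy. destruct (H i (lt_le M _ _ Hi) Hi) as (y' & _ & A & B).
  rewrite (entry_fun _ _ _ _ Hy A). auto.
Qed.

Lemma Def_entry f g h : dtm M f -> dtm M g -> dtm M h -> Def M (fun e => entry (f e) (g e) (h e)).
Proof.
  intros Hf Hg Hh.
  apply (Def_subst M (fun e => entry (e 0) (e 1) (e 2))
    (fun e => scons (f e) (scons (g e) (scons (h e) (fun _ => mz))))).
  - unfold entry, betaC, modulus. dfn.
  - intros i. dterm.
Qed.

End Entries.

Ltac dfn_hook ::=
  lazymatch goal with
  | H : udef ?P |- Def (pm ?M) (fun e => ?P ?M (@?s e)) =>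
      apply (Def_rel M P s H); let i := fresh "i" in intros i; dterm
  | |- Def _ (fun e => entry _ _ _ _) => apply Def_entry; dterm
  end.

(** ** Two quantifier alternations with a unique witness *)

Section Unique.
Variable C : rel -> Prop.
Hypothesis G : closed_class C.
Local Open Scope pa_scope.

Definition wit (Q : rel) (M : pam) (r : nat -> M) (w : M) : Prop :=
  forall u, exists v, Q M (scons v (scons u (scons w r))).

(** The witness of the outermost of three quantifiers is required to be unique.
    Uniqueness is what keeps the graphs of histories finitely branching where
    they have to be; the operations below are arranged to preserve it. *)
Definition USig (P : rel) : Prop := exists Q, C Q /\ forall (M : pam) (r : nat -> M),
  (P M r <-> exists w, wit Q M r w) /\
  (forall w w', wit Q M r w -> wit Q M r w' -> w = w').

Lemma U_iff (P P' : rel) : (forall M r, P M r <-> P' M r) -> USig P -> USig P'.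
Proof.
  intros E (Q & HQ & H). exists Q. split; auto. intros M r. rewrite <- E. apply H.
Qed.

Lemma U_base P : C P -> USig P.
Proof.
  intros HP. exists (fun M e => e 2 = mz /\ P M (fun i => e (S (S (S i))))). split.
  - cc G.
  - intros M r. unfold wit. cbn [scons]. split; [split|].
    + intros H. exists mz. intros u. exists mz. auto.
    + intros [w H]. destruct (H mz) as [v Hv]. apply Hv.
    + intros w w' H H'. destruct (H mz) as (? & -> & _), (H' mz) as (? & -> & _). auto.
Qed.

Lemma U_pi2 Q : C Q ->
  USig (fun M r => forall u, exists v, Q M (scons v (scons u r))).
Proof.
  intros HQ. exists (fun M e => e 2 = mz /\ Q M (scons (e 0) (scons (e 1) (fun i => e (S (S (S i))))))).
  split.
  - cc G.
  - intros M r. unfold wit. cbn [scons]. split; [split|].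
    + intros H. exists mz. intros u. destruct (H u) as [v Hv]. exists v. auto.
    + intros [w H] u. destruct (H u) as [v Hv]. exists v. apply Hv.
    + intros w w' H H'. destruct (H mz) as (? & -> & _), (H' mz) as (? & -> & _). auto.
Qed.

Lemma U_subst P (s : nat -> forall M : pam, (nat -> M) -> M) :
  USig P -> (forall i, poly (s i)) -> USig (fun M e => P M (fun i => s i M e)).
Proof.
  intros (Q & HQ & H) Hs.
  exists (fun M e => Q M (scons (e 0) (scons (e 1) (scons (e 2)
    (fun i => s i M (fun j => e (S (S (S j))))))))).
  split.
  - apply (g_subst G Q (fun i M e => scons (e 0) (scons (e 1) (scons (e 2)
      (fun i => s i M (fun j => e (S (S (S j))))))) i) HQ).
    intros [|[|[|i]]]; cbn [scons]; try apply poly_var.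
    apply (poly_subst (s i) (fun j M e => e (S (S (S j))))); auto. intros; apply poly_var.
  - intros M r. apply (H M).
Qed.

(** The witness is the pair of the witnesses. *)
Lemma U_and P1 P2 : USig P1 -> USig P2 -> USig (fun M r => P1 M r /\ P2 M r).
Proof.
  intros (Q1 & HQ1 & H1) (Q2 & HQ2 & H2).
  exists (fun M e => exists w1, w1 <= e 2 /\ exists w2, w2 <= e 2 /\ e 2 = pr M w1 w2 /\
    (exists v, v <= e 0 /\ Q1 M (scons v (scons (e 1) (scons w1 (fun i => e (S (S (S i)))))))) /\
    (exists v, v <= e 0 /\ Q2 M (scons v (scons (e 1) (scons w2 (fun i => e (S (S (S i))))))))).
  split; [cc G|].
  intros M r. unfold wit. cbn [scons]. destruct (H1 M r) as [E1 U1], (H2 M r) as [E2 U2].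
  assert (K : forall w, (forall u, exists v, exists w1, w1 <= w /\ exists w2, w2 <= w /\ w = pr M w1 w2 /\
    (exists v1, v1 <= v /\ Q1 M (scons v1 (scons u (scons w1 r)))) /\
    (exists v1, v1 <= v /\ Q2 M (scons v1 (scons u (scons w2 r))))) <->
    exists w1 w2, w = pr M w1 w2 /\ wit Q1 M r w1 /\ wit Q2 M r w2).
  { intros w. split.
    - intros H. destruct (H mz) as (_ & w1 & _ & w2 & _ & E & _). exists w1, w2. split; auto.
      split; intros u; destruct (H u) as (v & w1' & _ & w2' & _ & E' & (a & _ & A) & (b & _ & B));
        rewrite E in E'; apply pr_inj in E'; destruct E' as [-> ->]; eauto.
    - intros (w1 & w2 & -> & A & B) u. destruct (A u) as [a Ha], (B u) as [b Hb].
      exists (a + b), w1. split; [apply le_pr_l|]. exists w2. split; [apply le_pr_r|].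
      split; auto. split; [exists a|exists b]; auto using le_add_r, le_add_l. }
  split; [split|].
  - intros [A B]. apply E1 in A. apply E2 in B. destruct A as [w1 A], B as [w2 B].
    exists (pr M w1 w2). apply K. eauto.
  - intros [w H]. apply K in H. destruct H as (w1 & w2 & _ & A & B).
    split; [apply E1|apply E2]; eauto.
  - intros w w' H H'. apply K in H. apply K in H'.
    destruct H as (w1 & w2 & -> & A & B), H' as (w1' & w2' & -> & A' & B').
    rewrite (U1 _ _ A A'), (U2 _ _ B B'). auto.
Qed.

(** The witness also tells which side holds; only one of them does. *)
Lemma U_xor P1 P2 : USig P1 -> USig P2 -> (forall M r, P1 M r -> P2 M r -> False) ->
  USig (fun M r => P1 M r \/ P2 M r).
Proof.
  intros (Q1 & HQ1 & H1) (Q2 & HQ2 & H2) X.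
  exists (fun M e => exists w, w <= e 2 /\
    ((e 2 = pr M mz w /\ Q1 M (scons (e 0) (scons (e 1) (scons w (fun i => e (S (S (S i)))))))) \/
     (e 2 = pr M one w /\ Q2 M (scons (e 0) (scons (e 1) (scons w (fun i => e (S (S (S i)))))))))).
  split; [cc G|].
  intros M r. unfold wit. cbn [scons]. destruct (H1 M r) as [E1 U1], (H2 M r) as [E2 U2].
  assert (D : forall a b : M, pr M mz a = pr M one b -> False).
  { intros a b H. apply pr_inj in H. destruct H as [H _]. exact (S_neq_0 M _ (eq_sym H)). }
  assert (K : forall w, (forall u, exists v, exists w', w' <= w /\
     ((w = pr M mz w' /\ Q1 M (scons v (scons u (scons w' r)))) \/
      (w = pr M one w' /\ Q2 M (scons v (scons u (scons w' r)))))) <->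
    exists w', (w = pr M mz w' /\ wit Q1 M r w') \/ (w = pr M one w' /\ wit Q2 M r w')).
  { intros w. split.
    - intros H. destruct (H mz) as (_ & w' & _ & [[E _]|[E _]]); exists w'; [left|right]; split; auto;
      intros u; destruct (H u) as (v & w2 & _ & [[E' A]|[E' A]]); rewrite E in E'.
      + apply pr_inj in E'. destruct E' as [_ ->]. eauto.
      + destruct (D _ _ E').
      + destruct (D _ _ (eq_sym E')).
      + apply pr_inj in E'. destruct E' as [_ ->]. eauto.
    - intros (w' & [[-> A]|[-> A]]) u; destruct (A u) as [v Hv]; exists v, w';
        (split; [apply le_pr_r|]); auto. }
  split; [split|].
  - intros [A|A]; [apply E1 in A|apply E2 in A]; destruct A as [w A];
      [exists (pr M mz w)|exists (pr M one w)]; apply K; eauto.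
  - intros [w H]. apply K in H. destruct H as (w' & [[_ A]|[_ A]]); [left; apply E1|right; apply E2]; eauto.
  - intros w w' H H'. apply K in H. apply K in H'.
    destruct H as (a & [[-> A]|[-> A]]), H' as (b & [[-> B]|[-> B]]).
    + f_equal. eauto.
    + destruct (X M r); [apply E1|apply E2]; eauto.
    + destruct (X M r); [apply E1|apply E2]; eauto.
    + f_equal. eauto.
Qed.

Lemma U_ex (P : rel) : USig P ->
  (forall M r x x', P M (scons x r) -> P M (scons x' r) -> x = x') ->
  USig (fun M r => exists x, P M (scons x r)).
Proof.
  intros (Q & HQ & H) X.
  exists (fun M e => exists x, x <= e 2 /\ exists w, w <= e 2 /\ e 2 = pr M x w /\
    Q M (scons (e 0) (scons (e 1) (scons w (scons x (fun i => e (S (S (S i))))))))).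
  split; [cc G|].
  intros M r. unfold wit. cbn [scons].
  assert (K : forall w, (forall u, exists v, exists x, x <= w /\ exists w', w' <= w /\ w = pr M x w' /\
      Q M (scons v (scons u (scons w' (scons x r))))) <->
    exists x w', w = pr M x w' /\ wit Q M (scons x r) w').
  { intros w. split.
    - intros A. destruct (A mz) as (_ & x & _ & w' & _ & E & _). exists x, w'. split; auto.
      intros u. destruct (A u) as (v & x' & _ & w2 & _ & E' & B). rewrite E in E'.
      apply pr_inj in E'. destruct E' as [-> ->]. eauto.
    - intros (x & w' & -> & A) u. destruct (A u) as [v Hv]. exists v, x.
      split; [apply le_pr_l|]. exists w'. split; [apply le_pr_r|]. auto. }
  split; [split|].
  - intros [x Hx]. apply (H M (scons x r)) in Hx. destruct Hx as [w Hw].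
    exists (pr M x w). apply K. eauto.
  - intros [w Hw]. apply K in Hw. destruct Hw as (x & w' & _ & A). exists x.
    apply (H M (scons x r)). eauto.
  - intros w w' Hw Hw'. apply K in Hw. apply K in Hw'.
    destruct Hw as (x & a & -> & A), Hw' as (x' & b & -> & B).
    assert (x = x') by (apply (X M r); apply (H M (scons _ r)); eauto). subst x'.
    f_equal. eapply (proj2 (H M (scons x r))); eauto.
Qed.

(** Bounded universal quantification: the witness is the least code of the
    sequence of the witnesses of the instances. *)
Lemma U_ball (P : rel) t : USig P -> poly t ->
  USig (fun M r => forall x, x <= t M r -> P M (scons x r)).
Proof.
  intros (Q & HQ & H) Ht.
  exists (fun M e => canon M (ms (t M (fun i => e (S (S (S i)))))) (e 2) /\
    forall x, x <= t M (fun i => e (S (S (S i)))) -> exists y, y <= e 2 /\ (entry M (e 2) x y /\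
      exists v, v <= e 0 /\ Q M (scons v (scons (e 1) (scons y (scons x (fun i => e (S (S (S i)))))))))).
  assert (Htn : forall n, poly (fun M e => t M (fun i => e (n + i)%nat))).
  { intros n. apply (poly_subst t (fun i M e => e (n + i)%nat)); auto. intros; apply poly_var. }
  split.
  { unfold canon, agree, entry, betaC, modulus.
    pose proof (Htn 3). pose proof (Htn 4). pose proof (Htn 5). cbn [Nat.add] in *. cc G. }
  intros M r. unfold wit. cbn [scons]. change (fun i => r i) with r. set (b := t M r).
  assert (DQ : udef Q) by (apply (g_def G), HQ).
  set (good := fun w => forall x, x <= b -> exists y, entry M w x y /\ wit Q M (scons x r) y).
  assert (K : forall w, (forall u, exists v, canon M (ms b) w /\
      forall x, x <= b -> exists y, y <= w /\ (entry M w x y /\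
        exists v', v' <= v /\ Q M (scons v' (scons u (scons y (scons x r)))))) <->
    canon M (ms b) w /\ good w).
  { intros w. split.
    - intros A. split; [destruct (A mz) as (v0 & B & _); auto|]. intros x Hx.
      destruct (A mz) as (v0 & _ & B). destruct (B x Hx) as (y & _ & Hy & _).
      exists y. split; auto. intros u. destruct (A u) as (v & B0 & B').
      destruct (B' x Hx) as (y' & _ & Hy' & v' & _ & Hv').
      rewrite (entry_fun _ _ _ _ _ Hy Hy'). eauto.
    - intros [L A] u.
      destruct (collect M (fun x v => exists y, entry M w x y /\ Q M (scons v (scons u (scons y (scons x r))))) (ms b))
        as [v Hv].
      { dfn. }
      { intros x Hx. apply lt_succ_le in Hx. destruct (A x Hx) as (y & Hy & W).
        destruct (W u) as [v Hv]. eauto. }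
      exists v. split; auto. intros x Hx. destruct (Hv x) as (v' & Hv' & y & Hy & HQy); [apply le_lt_succ; auto|].
      exists y. split; [eapply entry_le; eauto|]. split; auto. eauto. }
  split; [split|].
  - intros A.
    assert (E : exists w, good w).
    { destruct (beta_exists M (fun x y => wit Q M (scons x r) y) (ms b)) as (c & d & B).
      { unfold wit. dfn. }
      { intros x Hx. apply (H M (scons x r)), A, lt_succ_le, Hx. }
      exists (pr M c d). intros x Hx. destruct (B x) as (y & Hy & W); [apply le_lt_succ; auto|].
      exists y. auto using entry_intro. }
    destruct (least_number M good) as (w & Hw & L); auto.
    { unfold good, wit. dfn. }
    exists w. apply K. split; auto. intros w' Hw' Hne E'.
    apply (L w'); [apply le_eq_lt in Hw'; tauto|].
    intros x Hx. destruct (Hw x Hx) as (y & E3 & W).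
    exists y. split; auto. apply (agree_entry M (ms b) w); auto. apply le_lt_succ, Hx.
  - intros [w Hw] x Hx. apply K in Hw. destruct Hw as [_ Hw].
    destruct (Hw x Hx) as (y & _ & W). apply (H M (scons x r)). eauto.
  - intros w w' Hw Hw'. apply K in Hw. apply K in Hw'. destruct Hw as [L A], Hw' as [L' A'].
    apply (canon_unique M (ms b)); auto. intros x _ Hx. apply lt_succ_le in Hx.
    destruct (A x Hx) as (y & E1 & W1), (A' x Hx) as (y' & E2 & W2).
    exists y. split; [eapply entry_le; eauto|]. split; auto.
    rewrite (proj2 (H M (scons x r)) y y'); auto.
Qed.

End Unique.

Section Jump.
Variable C : rel -> Prop.
Hypothesis G : closed_class C.
Local Open Scope pa_scope.

(** Relations that have, together with their complements, definitions with a unique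
    witness in front of two quantifiers over [C]. Such a class is closed again. *)
Definition jump (P : rel) : Prop := USig C P /\ USig C (fun M r => ~ P M r).

Lemma jump_base P : C P -> jump P.
Proof. intros H. split; apply U_base; auto. apply (g_not G), H. Qed.

Lemma jump_iff (P Q : rel) : (forall M r, P M r <-> Q M r) -> jump P -> jump Q.
Proof.
  intros E [A B]. split; eapply U_iff; eauto. intros M r. cbn. rewrite E. tauto.
Qed.

Lemma jump_not P : jump P -> jump (fun M r => ~ P M r).
Proof.
  intros [A B]. split; auto. apply (U_iff C P); auto. intros M r. tauto.
Qed.

Lemma jump_and P Q : jump P -> jump Q -> jump (fun M r => P M r /\ Q M r).
Proof.
  intros [A B] [A' B']. split; [apply (U_and C G); auto|].
  apply (U_iff C (fun M r => ~ P M r \/ (P M r /\ ~ Q M r))).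
  - intros M r. tauto.
  - apply (U_xor C G); auto.
    + apply (U_and C G); auto.
    + tauto.
Qed.

Lemma jump_subst P (s : nat -> forall M : pam, (nat -> M) -> M) :
  jump P -> (forall i, poly (s i)) -> jump (fun M e => P M (fun i => s i M e)).
Proof.
  intros [A B] Hs. split; [apply (U_subst C G P s); auto|].
  apply (U_subst C G (fun M r => ~ P M r) s); auto.
Qed.

Lemma jump_def P : jump P -> udef P.
Proof.
  intros [(Q & HQ & H) _]. destruct (g_def G Q HQ) as [q Hq].
  exists (Ex (All (Ex q))). intros M r. rewrite (proj1 (H M r)).
  rewrite st_Ex. cbn [st]. unfold wit.
  split; intros [w Hw]; exists w; intros u; specialize (Hw u).
  - apply st_Ex in Hw. destruct Hw as [v Hv]. exists v. apply Hq, Hv.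
  - apply st_Ex. destruct Hw as [v Hv]. exists v. apply Hq, Hv.
Qed.

(** A unique example is singled out as the least one. *)
Lemma U_least (P : rel) : jump P -> USig C (fun M r => exists x, P M (scons x r)).
Proof.
  intros HP.
  apply (U_iff C (fun M r => exists x, P M (scons x r) /\
    forall y, y <= x -> (y <> x -> ~ P M (scons y r)))).
  { intros M r. split; [intros [x [Hx _]]; eauto|]. intros [x Hx].
    destruct (least_number M (fun x => P M (scons x r))) as (y & Hy & L); eauto.
    { pose proof (jump_def P HP). dfn. }
    exists y. split; auto. intros z Hz Hne. apply L. apply le_eq_lt in Hz. tauto. }
  apply (U_ex C G (fun M e => P M e /\ forall y, y <= e 0 -> (y <> e 0 -> ~ P M (scons y (fun i => e (S i)))))).
  - apply (U_and C G); [apply HP|].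
    apply (U_ball C G (fun M e => e 0 <> e 1 -> ~ P M (scons (e 0) (fun i => e (S (S i))))) (fun M e => e 0));
      [|apply poly_var].
    apply (U_iff C (fun M e => e 0 = e 1 \/ (e 0 <> e 1 /\ ~ P M (scons (e 0) (fun i => e (S (S i))))))).
    + intros M e. tauto.
    + apply (U_xor C G); [| |tauto].
      * apply (U_base C G). cc G.
      * apply (U_and C G); [apply (U_base C G); cc G|].
        apply (U_subst C G (fun M r => ~ P M r) (fun i M e => scons (e 0) (fun i => e (S (S i))) i)); [apply HP|].
        intros [|i]; apply poly_var.
  - intros M r x x' [A B] [A' B']. cbn [scons] in *.
    destruct (trichotomy M x x') as [T|[T|T]]; auto; exfalso.
    + apply (B' x (lt_le M _ _ T)); auto. intros ->. exact (lt_irrefl M _ T).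
    + apply (B x' (lt_le M _ _ T)); auto. intros ->. exact (lt_irrefl M _ T).
Qed.

Lemma jump_ball (P : rel) t : jump P -> poly t ->
  jump (fun M r => forall x, x <= t M r -> P M (scons x r)).
Proof.
  intros HP Ht. split; [apply (U_ball C G); auto; apply HP|].
  apply (U_iff C (fun M r => exists x, x <= t M r /\ ~ P M (scons x r))).
  { intros M r. split; [intros (x & Hx & Hn) A; auto|].
    intros A. apply NNPP. intros Hn. apply A. intros x Hx. apply NNPP. eauto. }
  apply (U_least (fun M e => e 0 <= t M (fun i => e (S i)) /\ ~ P M e)).
  apply jump_and; [|apply jump_not, HP].
  apply jump_base, (g_le _ G); [apply poly_var|].
  apply (poly_subst t (fun i M e => e (S i))); auto. intros; apply poly_var.
Qed.

Lemma closed_jump : closed_class jump.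
Proof.
  split.
  - apply jump_iff.
  - apply jump_def.
  - intros s t Hs Ht. apply jump_base, (g_eq G); auto.
  - apply jump_not.
  - apply jump_and.
  - intros P t HP Ht. apply (jump_iff (fun M r => forall x, x <= t M r -> P M x r)); [tauto|].
    apply (jump_ball (fun M e => P M (e 0) (fun i => e (S i)))); auto.
  - apply jump_subst.
Qed.

(** The negation says that some [u] has no [v]; the least such [u] is unique, as having
    no [v] and, by way of the least [v], having one are both of the required form. *)
Lemma jump_ae Q : C Q -> jump (fun M r => forall u, exists v, Q M (scons v (scons u r))).
Proof.
  intros HQ. split; [apply (U_pi2 C G), HQ|].
  set (A := fun (M : pam) e => forall v : M, ~ Q M (scons v e)).
  apply (U_iff C (fun M r => exists u, A M (scons u r))).
  { intros M r. unfold A. split.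
    - intros [u Hu] B. destruct (B u) as [v Hv]. exact (Hu v Hv).
    - intros B. apply NNPP. intros Hn. apply B. intros u. apply NNPP. intros Hv. apply Hn.
      exists u. intros v Hq. eauto. }
  assert (HA : USig C A).
  { apply (U_iff C (fun M r => forall u, exists v, (fun M e => ~ Q M (fun i => e (S i))) M (scons v (scons u r)))).
    - intros M r. unfold A. cbn. split; [intros H v; destruct (H v); auto|]. intros H u. exists mz. apply H.
    - apply (U_pi2 C G (fun M e => ~ Q M (fun i => e (S i)))). cc G. }
  assert (HB : USig C (fun M e => ~ A M e)).
  { apply (U_iff C (fun M e => exists v, Q M (scons v e) /\ forall v', v' <= v -> v' <> v -> ~ Q M (scons v' e))).
    - intros M e. unfold A. split; [intros (v & Hv & _) B; exact (B v Hv)|]. intros B.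
      destruct (least_number M (fun v => Q M (scons v e))) as (v & Hv & L).
      + assert (udef Q) by exact (g_def G Q HQ). dfn.
      + apply NNPP. intros Hn. apply B. intros v Hv. apply Hn. eauto.
      + exists v. split; auto. intros v' Hv' Hne. apply L. apply le_eq_lt in Hv'. tauto.
    - apply (U_ex C G (fun M e => Q M e /\ forall v', v' <= e 0 -> v' <> e 0 -> ~ Q M (scons v' (fun i => e (S i))))).
      + apply (U_base C G). cc G.
      + intros M e v v' [H1 L1] [H2 L2]. cbn [scons] in *.
        destruct (trichotomy M v v') as [T|[T|T]]; auto; exfalso.
        * apply (L2 v (lt_le M _ _ T)); auto. intros ->. exact (lt_irrefl M _ T).
        * apply (L1 v' (lt_le M _ _ T)); auto. intros ->. exact (lt_irrefl M _ T). }
  apply (U_least A). split; auto.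
Qed.

End Jump.

(** Level [k] corresponds to the relations recursive in the [2 k]-th jump. *)
Fixpoint level (k : nat) : rel -> Prop :=
  match k with 0 => class0 | S k => jump (level k) end.

Lemma closed_level k : closed_class (level k).
Proof. induction k; [apply closed_class0|apply closed_jump, IHk]. Qed.

Lemma level_S k P : level k P -> level (S k) P.
Proof. apply jump_base, closed_level. Qed.

Lemma level_0 k P : class0 P -> level k P.
Proof. intros H. induction k; auto using level_S. Qed.

(** ** The arithmetical hierarchy *)

Section Hierarchy.
Local Open Scope pa_scope.

(** A level absorbs two quantifiers, so that Sigma relations have one or two
    quantifiers in front of a level. *)
Definition sigma (m : nat) (P : rel) : Prop :=
  (m = 0 /\ class0 P) \/
  (exists k Q, m = S (2 * k) /\ level k Q /\
     forall M r, P M r <-> exists x, Q M (scons x r)) \/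
  (exists k Q, m = S (S (2 * k)) /\ level k Q /\
     forall M r, P M r <-> exists x, forall y, Q M (scons y (scons x r))).

Lemma sigma_iff m (P P' : rel) : (forall M r, P M r <-> P' M r) -> sigma m P -> sigma m P'.
Proof.
  intros E [[-> H]|[(k & Q & -> & H & H')|(k & Q & -> & H & H')]].
  - left. split; auto. apply (g_iff closed_class0 P); auto.
  - right; left. exists k, Q. split; [auto|]. split; auto. intros M r. rewrite <- E. apply H'.
  - right; right. exists k, Q. split; [auto|]. split; auto. intros M r. rewrite <- E. apply H'.
Qed.

Lemma level_shift k Q n : level k Q -> level k (fun M e => Q M (fun i => e (n + i)%nat)).
Proof.
  intros H. apply (g_subst (closed_level k) Q (fun i M e => e (n + i)%nat) H).
  intros; apply poly_var.
Qed.

Lemma sigma_0 m P : class0 P -> sigma m P.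
Proof.
  intros H. destruct (Nat.Even_or_Odd m) as [[k ->]|[k ->]].
  - destruct k; [left; auto|]. right; right.
    exists k, (fun M e => P M (fun i => e (2 + i)%nat)). split; [lia|].
    split; [apply (level_shift k P 2), level_0, H|].
    intros M r. cbn. split; [intros A; exists mz; auto|intros [_ A]; apply (A mz)].
  - right; left. exists k, (fun M e => P M (fun i => e (1 + i)%nat)). split; [lia|].
    split; [apply (level_shift k P 1), level_0, H|].
    intros M r. cbn. split; [intros A; exists mz; auto|intros [_ A]; auto].
Qed.

(** A third quantifier is absorbed by the next level, by [jump_ae]. *)
Lemma sigma_neg m P : sigma m (fun M r => ~ P M r) -> sigma (S m) P.
Proof.
  intros [[-> H]|[(k & Q & -> & H & H')|(k & Q & -> & H & H')]].
  - apply sigma_0. apply (g_iff closed_class0 (fun M r => ~ ~ P M r)); [intros; tauto|].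
    apply (g_not closed_class0 (fun M r => ~ P M r)), H.
  - right; right. exists k, (fun M e => ~ Q M (scons (e 0) (fun i => e (2 + i)%nat))).
    split; [lia|]. split.
    + pose proof (closed_level k) as G. cc G.
    + intros M r. cbn. split.
      * intros A. exists mz. intros y B. apply (proj2 (H' M r)); eauto.
      * intros [_ A]. apply NNPP. intros B. apply H' in B. destruct B as [x Hx]. apply (A x Hx).
  - right; left.
    exists (S k), (fun M e => (fun M r => forall u, exists v, ~ Q M (scons v (scons u r))) M
      (fun i => e (1 + i)%nat)).
    split; [lia|]. split.
    + apply (level_shift (S k) (fun M r => forall u, exists v, ~ Q M (scons v (scons u r))) 1).
      apply (jump_ae (level k) (closed_level k) (fun M e => ~ Q M e)).
      apply (g_not (closed_level k)), H.
    + intros M r. cbn. split.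
      * intros A. exists mz. intros u. apply NNPP. intros B. apply (proj2 (H' M r)); auto.
        exists u. intros y. apply NNPP. intros C. apply B. eauto.
      * intros [_ A]. apply NNPP. intros B. apply H' in B. destruct B as [x Hx].
        destruct (A x) as [v Hv]. apply Hv, Hx.
Qed.

Lemma sigma_ex m P : sigma (S m) P -> sigma (S m) (fun M r => exists x, P M (scons x r)).
Proof.
  intros [[E _]|[(k & Q & E & H & H')|(k & Q & E & H & H')]]; [lia| |].
  - right; left. pose proof (closed_level k) as G.
    exists k, (fun M e => exists x, x <= e 0 /\ exists y, y <= e 0 /\
      Q M (scons y (scons x (fun i => e (1 + i)%nat)))).
    split; auto. split; [cc G|]. intros M r. cbn. split.
    + intros [x Hx]. apply H' in Hx. destruct Hx as [y Hy]. exists (x + y), x.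
      split; [apply le_add_r|]. exists y. split; [apply le_add_l|auto].
    + intros (w & x & _ & y & _ & Hy). exists x. apply H'. eauto.
  - right; right. pose proof (closed_level k) as G.
    exists k, (fun M e => exists x, x <= e 1 /\ exists y, y <= e 1 /\ e 1 = pr M x y /\
      Q M (scons (e 0) (scons y (scons x (fun i => e (2 + i)%nat))))).
    split; auto. split; [cc G|]. intros M r. cbn. split.
    + intros [x Hx]. apply H' in Hx. destruct Hx as [y Hy]. exists (pr M x y). intros z.
      exists x. split; [apply le_pr_l|]. exists y. split; [apply le_pr_r|auto].
    + intros (w & Hw). destruct (Hw mz) as (x & _ & y & _ & Ew & _). exists x. apply H'.
      exists y. intros z. destruct (Hw z) as (x' & _ & y' & _ & Ew' & Hz).
      rewrite Ew in Ew'. apply pr_inj in Ew'. destruct Ew' as [-> ->]. auto.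
Qed.

Scheme isSigma_mut := Minimality for isSigma Sort Prop
  with isPi_mut := Minimality for isPi Sort Prop.

Lemma isPi_sigma m p : isPi m p -> sigma m (fun M r => ~ st M r p).
Proof.
  assert (D : forall p, delta0 p -> class0 (fun M r => st M r p)).
  { intros q Hq. exists q. split; auto. tauto. }
  revert m p. apply (isPi_mut (fun m p => sigma m (fun M r => st M r p))
    (fun m p => sigma m (fun M r => ~ st M r p))).
  - intros m p H. apply sigma_0, D, H.
  - intros m p _ IH. apply sigma_neg, IH.
  - intros m p _ IH. apply (sigma_iff _ (fun M r => exists x, st M (scons x r) p)).
    + intros M r. symmetry. apply st_Ex.
    + apply (sigma_ex m (fun M r => st M r p)), IH.
  - intros m p H. apply sigma_0. apply (g_not closed_class0 (fun M r => st M r p)), D, H.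
  - intros m p _ IH. apply sigma_neg.
    apply (sigma_iff _ (fun M r => st M r p)); auto. intros M r. tauto.
  - intros m p _ IH. apply (sigma_iff _ (fun M r => exists x, ~ st M (scons x r) p)).
    + intros M r. cbn [st]. split; [intros [x Hx] A; exact (Hx (A x))|].
      intros A. apply NNPP. intros B. apply A. intros x. apply NNPP. eauto.
    + apply (sigma_ex m (fun M r => ~ st M r p)), IH.
Qed.

Lemma isPi_level n p : isPi (2 * n + 1) p -> exists R, level n R /\
  forall (M : pam) r, ~ st M r p <-> exists x, R M (scons x r).
Proof.
  intros H. apply isPi_sigma in H. destruct H as [[E _]|[(k & Q & E & H & H')|(k & Q & E & H & H')]]; try lia.
  assert (k = n) by lia. subst k. exists Q. auto.
Qed.

End Hierarchy.

(** ** Uniformly definable relations *)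

Lemma closed_udef : closed_class udef.
Proof.
  split.
  - intros P Q E [p H]. exists p. intros M r. rewrite H. apply E.
  - auto.
  - intros s t [s0 Hs] [t0 Ht]. exists (Eq s0 t0). intros M r. cbn. rewrite Hs, Ht. tauto.
  - intros P [p H]. exists (Neg p). intros M r. cbn. rewrite H. tauto.
  - intros P Q [p H] [q H']. exists (And p q). intros M r. rewrite st_And, H, H'. tauto.
  - intros P t [p H] [t0 Ht]. exists (All (Imp (Le (Var 0) (tlift t0)) p)). intros M r.
    apply (sem_all M r (Imp (Le (Var 0) (tlift t0)) p) (fun x => le x (t M r) -> P M x r)).
    intros x. cbn [st]. rewrite st_Le, H. cbn [ev scons]. unfold tlift. rewrite ev_subst.
    cbn [ev scons]. rewrite Ht. rewrite (ev_ext M (fun i => r i) r) by auto. tauto.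
  - intros P s [p H] Hs.
    set (sg := fun i => epsilon (inhabits Zero) (fun t1 => forall M r, s i M r = ev M r t1)).
    exists (fsubst sg p). intros M r. rewrite st_subst, <- H. apply st_ext. intros i. symmetry.
    apply (epsilon_spec (inhabits Zero) (fun t1 => forall M r, s i M r = ev M r t1)), Hs.
Qed.

Lemma udef_ex (P : forall M : pam, M -> (nat -> M) -> Prop) :
  udef (fun M e => P M (e 0) (fun i => e (S i))) -> udef (fun M e => exists x, P M x e).
Proof.
  intros [p H]. exists (Ex p). intros M r. apply sem_ex. intros x. apply (H M (scons x r)).
Qed.

Lemma udef_all (P : forall M : pam, M -> (nat -> M) -> Prop) :
  udef (fun M e => P M (e 0) (fun i => e (S i))) -> udef (fun M e => forall x, P M x e).
Proof.
  intros [p H]. exists (All p). intros M r. apply sem_all. intros x. apply (H M (scons x r)).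
Qed.

(** * Lowering the level of a graph *)

Section Records.
Variable M : pam.
Local Open Scope pa_scope.

Definition rec4 (t m w s : M) : M := pr M t (pr M m (pr M w s)).

Lemma rec4_inj t m w s t' m' w' s' :
  rec4 t m w s = rec4 t' m' w' s' -> t = t' /\ m = m' /\ w = w' /\ s = s'.
Proof.
  intros H. apply pr_inj in H. destruct H as [-> H]. apply pr_inj in H.
  destruct H as [-> H]. apply pr_inj in H. tauto.
Qed.

Lemma rec4_le t m w s : t <= rec4 t m w s /\ m <= rec4 t m w s /\ w <= rec4 t m w s /\ s <= rec4 t m w s.
Proof.
  unfold rec4.
  pose proof (le_pr_r M t (pr M m (pr M w s))) as A.
  pose proof (le_pr_r M m (pr M w s)) as B.
  repeat split.
  - apply le_pr_l.
  - eapply le_trans; [apply le_pr_l|exact A].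
  - eapply le_trans; [|exact A]. eapply le_trans; [|exact B]. apply le_pr_l.
  - eapply le_trans; [|exact A]. eapply le_trans; [|exact B]. apply le_pr_r.
Qed.

Lemma entry_rec4_le a i t m w s : entry M a i (rec4 t m w s) -> t <= a /\ m <= a /\ w <= a /\ s <= a.
Proof.
  intros H. apply entry_le in H. destruct (rec4_le t m w s) as (A & B & C & D).
  repeat split; eapply le_trans; eauto.
Qed.

Lemma extend n a x : (forall i, i < n -> exists y, entry M a i y) ->
  exists b, agree M n a b /\ entry M b n x /\ canon M (ms n) b.
Proof.
  intros Ha.
  set (good := fun b => (forall i, i < n -> exists y, entry M a i y /\ entry M b i y) /\ entry M b n x).
  destruct (least_number M good) as (b & [Hb Hx] & L).
  - unfold good. dfn.
  - destruct (beta_exists M (fun i y => (i < n /\ entry M a i y) \/ (i = n /\ y = x)) (ms n)) as (c & d & B).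
    + dfn.
    + intros i Hi. apply lt_or_eq in Hi. destruct Hi as [Hi| ->]; [|eauto].
      destruct (Ha i Hi) as [y Hy]. exists y; left; auto.
    + exists (pr M c d). split.
      * intros i Hi. destruct (B i) as (y & Hy & [[_ A]|[-> _]]).
        -- apply lt_or_eq; auto.
        -- exists y. split; auto. apply entry_intro; auto.
        -- destruct (lt_irrefl M _ Hi).
      * destruct (B n (lt_S M n)) as (y & Hy & [[A _]|[_ ->]]).
        -- destruct (lt_irrefl M _ A).
        -- apply entry_intro; auto.
  - exists b. split; [|split; auto].
    + intros i _ Hi. destruct (Hb i Hi) as (y & A & B). exists y. split; auto. eapply entry_le; eauto.
    + intros b' Hle Hne H. apply (L b').
      * apply le_eq_lt in Hle. tauto.
      * split.
        -- intros i Hi. destruct (Hb i Hi) as (y & A & B). exists y. split; auto.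
           apply (agree_entry M _ _ _ _ _ H); auto. apply lt_or_eq; auto.
        -- apply (agree_entry M _ _ _ _ _ H); auto. apply lt_S.
Qed.

End Records.

(** Suppose that [E t m] says that [forall u, exists v, Q] for some [w], which
    is then unique. The nodes of the new graph are histories of such triples
    [t, m, w]. A history is continued by [t, m, w] as soon as all its entries
    are confirmed for all [u] up to a bound exceeding the length and the new
    entry; [s] is the stage at which this happens. A history with a wrong entry
    has therefore only finitely many continuations. *)
Section Step.
Variable Q : rel.
Local Open Scope pa_scope.

Definition QQ (M : pam) (t m w u v : M) : Prop :=
  Q M (scons v (scons u (scons w (scons t (scons m (fun _ => mz)))))).

Definition right (M : pam) (t m w : M) : Prop := forall u, exists v, QQ M t m w u v.

(** The node that has been reached, after the [n] moves of the history [a]. *)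
Definition cur (M : pam) (n a t : M) : Prop :=
  (n = mz /\ t = mz) \/
  exists j, j <= n /\ (n = ms j /\ exists t0, t0 <= a /\ exists w, w <= a /\ exists s, s <= a /\
    entry M a j (rec4 M t0 t w s)).

(** The pair [pr n (pr m w)] exceeds [n], [m] and [w], so that longer histories are
    tested further and large [m] or [w] require a long test. *)
Definition ver (M : pam) (n a m w s : M) : Prop :=
  forall i, i <= n -> exists t, t <= a /\ exists m1, m1 <= a /\ exists w1, w1 <= a /\ exists s1, s1 <= a /\
    (entry M a i (rec4 M t m1 w1 s1) /\
     forall u, u <= pr M n (pr M m w) -> exists v, v <= s /\ QQ M t m1 w1 u v).

(** All components are determined by [x], [m] and [w]: the stage [s] is the least one
    and the code [a'] is canonical. *)
Definition child (M : pam) (x m w x' : M) : Prop :=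
  exists n, n <= x /\ exists a, a <= x /\ exists a', a' <= x' /\ exists t, t <= x' /\ exists s, s <= x' /\
    (x = pr M n a /\ x' = pr M (ms n) a' /\ cur M n a t /\ agree M n a a' /\
     entry M a' n (rec4 M t m w s) /\ canon M (ms n) a' /\ ver M n a' m w s /\
     forall s1, s1 <= s -> s1 <> s -> ~ ver M n a' m w s1).

Definition step (M : pam) (x x' : M) : Prop :=
  exists m, m <= x' /\ exists w, w <= x' /\ child M x m w x'.

(** Confirmation is bounded, so that the new graph is two quantifiers simpler than
    the old one. *)
Lemma step_class C : closed_class C -> C Q -> C (fun M e => step M (e 0) (e 1)).
Proof.
  intros G HQ.
  unfold step, child, cur, ver, canon, agree, QQ, entry, betaC, modulus, rec4. cc G.
Qed.

Definition hist (M : pam) (x t m w : M) : Prop :=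
  exists n a i s, x = pr M n a /\ i < n /\ entry M a i (rec4 M t m w s).

Definition at_node (M : pam) (x t : M) : Prop := exists n a, x = pr M n a /\ cur M n a t.

Definition valid (M : pam) (x : M) : Prop :=
  exists n a, x = pr M n a /\ forall i, i < n -> exists t m w s, entry M a i (rec4 M t m w s).

Section InModel.
Variable M : pam.
Add Ring Mring' : (pa_semiring M).
Ltac mring := repeat rewrite ms_one; ring.

Lemma cur_fun n a t t' : cur M n a t -> cur M n a t' -> t = t'.
Proof.
  intros [[A B]|(j & _ & A & t0 & _ & w & _ & s & _ & B)] [[A' B']|(j' & _ & A' & t0' & _ & w' & _ & s' & _ & B')].
  - congruence.
  - rewrite A in A'. destruct (S_neq_0 M _ (eq_sym A')).
  - rewrite A' in A. destruct (S_neq_0 M _ (eq_sym A)).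
  - rewrite A in A'. apply S_inj in A'. subst j'.
    pose proof (entry_fun M _ _ _ _ B B') as E. apply rec4_inj in E. tauto.
Qed.

Lemma at_fun x t t' : at_node M x t -> at_node M x t' -> t = t'.
Proof.
  intros (n & a & -> & A) (n' & a' & E & A'). apply pr_inj in E. destruct E as [<- <-].
  eapply cur_fun; eauto.
Qed.

Lemma ver_transfer n a a' m w s :
  (forall i t m1 w1 s1, i <= n -> entry M a i (rec4 M t m1 w1 s1) ->
     exists s2, entry M a' i (rec4 M t m1 w1 s2)) ->
  ver M n a m w s -> ver M n a' m w s.
Proof.
  intros H V i Hi. destruct (V i Hi) as (t & _ & m1 & _ & w1 & _ & s1 & _ & A & B).
  destruct (H _ _ _ _ _ Hi A) as [s2 A']. destruct (entry_rec4_le M _ _ _ _ _ _ A') as (? & ? & ? & ?).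
  exists t; split; auto. exists m1; split; auto. exists w1; split; auto. exists s2; split; auto.
Qed.

Lemma ver_extensions n a a' a'' t m w s s' s0 :
  agree M n a a' -> agree M n a a'' ->
  entry M a' n (rec4 M t m w s) -> entry M a'' n (rec4 M t m w s') ->
  ver M n a' m w s0 -> ver M n a'' m w s0.
Proof.
  intros A A' B B'. apply ver_transfer. intros i t1 m1 w1 s1 Hi H.
  apply le_eq_lt in Hi. destruct Hi as [-> |Hi].
  - pose proof (entry_fun M _ _ _ _ B H) as E. apply rec4_inj in E.
    destruct E as (-> & -> & -> & _). eauto.
  - exists s1. apply (agree_entry M n a); auto. apply (agree_entry M n a'); auto. apply agree_sym, A.
Qed.

Lemma child_unique x m w x1 x2 : child M x m w x1 -> child M x m w x2 -> x1 = x2.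
Proof.
  intros (n & _ & a & _ & a1 & _ & t1 & _ & s1 & _ & E1 & -> & C1 & A1 & N1 & K1 & V1 & L1)
    (n2 & _ & a' & _ & a2 & _ & t2 & _ & s2 & _ & E2 & -> & C2 & A2 & N2 & K2 & V2 & L2).
  rewrite E1 in E2. apply pr_inj in E2. destruct E2 as [<- <-].
  pose proof (cur_fun _ _ _ _ C1 C2) as <-.
  assert (E : s1 = s2).
  { destruct (trichotomy M s1 s2) as [T|[T|T]]; auto; exfalso.
    - apply (L2 s1 (lt_le M _ _ T)); [intros ->; exact (lt_irrefl M _ T)|].
      apply (ver_extensions n a a1 a2 t1 m w s1 s2); auto.
    - apply (L1 s2 (lt_le M _ _ T)); [intros ->; exact (lt_irrefl M _ T)|].
      apply (ver_extensions n a a2 a1 t1 m w s2 s1); auto. }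
  subst s2. f_equal. apply (canon_unique M (ms n)); auto.
  intros i _ Hi. apply lt_or_eq in Hi. destruct Hi as [Hi| ->].
  - destruct (A1 i (lt_le M _ _ Hi) Hi) as (y & _ & B & B').
    exists y. split; [eapply entry_le; eauto|]. split; auto. apply (agree_entry M n a); auto.
  - exists (rec4 M t1 m w s1). split; [eapply entry_le; eauto|]. auto.
Qed.

Lemma child_at x m w x' : child M x m w x' -> at_node M x' m.
Proof.
  intros (n & _ & a & _ & a' & _ & t & _ & s & _ & E & -> & C & A & N & K & V & L).
  exists (ms n), a'. split; auto. right. exists n. split; [apply le_S|]. split; auto.
  destruct (entry_rec4_le M _ _ _ _ _ _ N) as (? & ? & ? & ?).
  exists t. split; auto. exists w. split; auto. exists s. split; auto.
Qed.

Lemma child_hist x m w x' : child M x m w x' -> exists t, at_node M x t /\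
  forall t' m' w', hist M x' t' m' w' <->
    (hist M x t' m' w' \/ (t' = t /\ m' = m /\ w' = w)).
Proof.
  intros (n & _ & a & _ & a' & _ & t & _ & s & _ & E & -> & C & A & N & K & V & L).
  exists t. split; [exists n, a; auto|]. intros t' m' w'. split.
  - intros (n' & b & i & s' & E' & Hi & H). apply pr_inj in E'. destruct E' as [<- <-].
    apply lt_or_eq in Hi. destruct Hi as [Hi| ->].
    + left. exists n, a, i, s'. split; auto. split; auto.
      apply (agree_entry M n a'); auto. apply agree_sym, A.
    + right. pose proof (entry_fun M _ _ _ _ N H) as E'. apply rec4_inj in E'.
      destruct E' as (-> & -> & -> & _). auto.
  - intros [(n' & b & i & s' & E' & Hi & H)|(-> & -> & ->)].
    + rewrite E in E'. apply pr_inj in E'. destruct E' as [<- <-].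
      exists (ms n), a', i, s'. split; auto. split; [apply lt_or_eq; auto|].
      apply (agree_entry M n a); auto.
    + exists (ms n), a', n, s. split; auto. split; auto using lt_S.
Qed.

Lemma child_length x m w x' n a : child M x m w x' -> x = pr M n a -> exists a', x' = pr M (ms n) a'.
Proof.
  intros (n0 & _ & a0 & _ & a' & _ & t & _ & s & _ & E & -> & _) E'.
  rewrite E in E'. apply pr_inj in E'. destruct E' as [<- <-]. eauto.
Qed.

Lemma child_ver x m w x' n a t1 m1 w1 : child M x m w x' -> x = pr M n a ->
  hist M x' t1 m1 w1 -> forall u, u <= pr M n (pr M m w) -> exists v, QQ M t1 m1 w1 u v.
Proof.
  intros (n0 & _ & a0 & _ & a' & _ & t & _ & s & _ & E & -> & C & A & N & K & V & L) E'.
  rewrite E in E'. apply pr_inj in E'. destruct E' as [<- <-].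
  intros (n' & b & i & s' & E' & Hi & H) u Hu. apply pr_inj in E'. destruct E' as [<- <-].
  apply lt_succ_le in Hi. destruct (V i Hi) as (t2 & _ & m2 & _ & w2 & _ & s2 & _ & B & D).
  pose proof (entry_fun M _ _ _ _ H B) as E'. apply rec4_inj in E'. destruct E' as (-> & -> & -> & _).
  destruct (D u Hu) as (v & _ & Hv). eauto.
Qed.

Lemma child_valid x m w x' : child M x m w x' -> valid M x -> valid M x'.
Proof.
  intros (n & _ & a & _ & a' & _ & t & _ & s & _ & E & -> & C & A & N & K & V & L)
    (n0 & a0 & E' & H). rewrite E in E'. apply pr_inj in E'. destruct E' as [<- <-].
  exists (ms n), a'. split; auto. intros i Hi. apply lt_or_eq in Hi. destruct Hi as [Hi| ->]; [|eauto].
  destruct (H i Hi) as (t1 & m1 & w1 & s1 & H1). exists t1, m1, w1, s1.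
  apply (agree_entry M n a); auto.
Qed.

Lemma child_step x m w x' : child M x m w x' -> step M x x'.
Proof.
  intros H. pose proof H as (n & _ & a & _ & a' & _ & t & _ & s & _ & E & E' & C & A & N & _).
  destruct (entry_rec4_le M _ _ _ _ _ _ N) as (_ & B & D & _).
  assert (F : a' <= x') by (rewrite E'; apply le_pr_r).
  exists m. split; [eapply le_trans; eauto|]. exists w. split; auto. eapply le_trans; eauto.
Qed.

Hypothesis DQ : udef Q.

(** As all entries are right, each test succeeds at some stage, and by collection all
    succeed at a common one. *)
Lemma child_exists x t m w : valid M x -> at_node M x t ->
  (forall t1 m1 w1, hist M x t1 m1 w1 -> right M t1 m1 w1) -> right M t m w ->
  exists x', child M x m w x'.
Proof.
  intros (n & a & E & Hv) Hc Hh Hr.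
  assert (C : cur M n a t).
  { destruct Hc as (n' & a1 & E' & C). rewrite E in E'. apply pr_inj in E'.
    destruct E' as [<- <-]. auto. }
  assert (Ha : forall i, i < n -> exists y, entry M a i y).
  { intros i Hi. destruct (Hv i Hi) as (? & ? & ? & ? & H). eauto. }
  destruct (extend M n a (rec4 M t m w mz) Ha) as (a0 & A0 & N0 & _).
  assert (V : exists s, ver M n a0 m w s).
  { destruct (collect M (fun i s => exists t1 m1 w1 s1, entry M a0 i (rec4 M t1 m1 w1 s1) /\
      forall u, u <= pr M n (pr M m w) -> exists v, v <= s /\ QQ M t1 m1 w1 u v) (ms n)) as [s Hs].
    - unfold QQ, rec4. dfn.
    - intros i Hi.
      assert (X : exists t1 m1 w1 s1, entry M a0 i (rec4 M t1 m1 w1 s1) /\ right M t1 m1 w1).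
      { apply lt_or_eq in Hi. destruct Hi as [Hi| ->]; [|exists t, m, w, mz; auto].
        destruct (Hv i Hi) as (t1 & m1 & w1 & s1 & H). exists t1, m1, w1, s1. split.
        - apply (agree_entry M n a); auto.
        - apply Hh. exists n, a, i, s1. auto. }
      destruct X as (t1 & m1 & w1 & s1 & H & R).
      destruct (collect M (fun u v => QQ M t1 m1 w1 u v) (ms (pr M n (pr M m w)))) as [b Hb].
      + unfold QQ. dfn.
      + intros u _. apply R.
      + exists b, t1, m1, w1, s1. split; auto. intros u Hu. apply Hb, le_lt_succ, Hu.
    - exists s. intros i Hi. destruct (Hs i (le_lt_succ M _ _ Hi)) as (y & Hy & t1 & m1 & w1 & s1 & H & R).
      destruct (entry_rec4_le M _ _ _ _ _ _ H) as (? & ? & ? & ?).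
      exists t1; split; auto. exists m1; split; auto. exists w1; split; auto. exists s1; split; auto.
      split; auto. intros u Hu. destruct (R u Hu) as (v & Hv' & HQ'). exists v. split; auto.
      eapply le_trans; eauto. }
  destruct (least_number M (fun s => ver M n a0 m w s)) as (s & Vs & L); auto.
  { unfold ver, QQ, rec4. dfn. }
  destruct (extend M n a (rec4 M t m w s) Ha) as (a' & A & N & K).
  destruct (entry_rec4_le M _ _ _ _ _ _ N) as (B1 & B2 & B3 & B4).
  exists (pr M (ms n) a'). exists n. split; [rewrite E; apply le_pr_l|].
  exists a. split; [rewrite E; apply le_pr_r|]. exists a'. split; [apply le_pr_r|].
  exists t. split; [eapply le_trans; [exact B1|apply le_pr_r]|].
  exists s. split; [eapply le_trans; [exact B4|apply le_pr_r]|].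
  split; [exact E|]. split; [reflexivity|]. split; [exact C|]. split; [exact A|].
  split; [exact N|]. split; [exact K|]. split.
  - apply (ver_extensions n a a0 a' t m w mz s); auto.
  - intros s1 H1 H2 V1. apply (L s1).
    + apply le_eq_lt in H1. tauto.
    + apply (ver_extensions n a a' a0 t m w s mz); auto.
Qed.

Lemma root_at : at_node M mz mz.
Proof.
  exists mz, mz. split; [unfold pr; mring|]. left; auto.
Qed.

Lemma root_hist t m w : ~ hist M mz t m w.
Proof.
  intros (n & a & i & s & E & Hi & _). unfold pr in E. symmetry in E.
  apply add_eq_0 in E. destruct E as [_ ->]. exact (lt_0_r M _ Hi).
Qed.

Lemma root_valid : valid M mz.
Proof.
  exists mz, mz. split; [unfold pr; mring|]. intros i Hi. destruct (lt_0_r M _ Hi).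
Qed.

End InModel.
End Step.

(** * The standard model *)

Definition natm : model := mkModel nat 0 S Nat.add Nat.mul.

Lemma natm_PA q : PA q -> forall r, st natm r q.
Proof.
  intros [p H|p] r.
  - cbn [pa_axioms In] in H.
    repeat (destruct H as [<-|H]; [cbn; intros; nia|]). destruct H.
  - cbn [induction st]. intros H0 HS x.
    unfold inst in H0. apply (st_subst natm) in H0.
    induction x as [|x IH].
    + eapply (st_ext natm); [|exact H0]. intros [|i]; reflexivity.
    + specialize (HS x IH). unfold fsucc in HS. apply (st_subst natm) in HS.
      eapply (st_ext natm); [|exact HS]. intros [|i]; reflexivity.
Qed.

Definition NM : pam := mkPam natm natm_PA.

Lemma NM_le (x y : NM) : le x y <-> Peano.le x y.
Proof.
  unfold le. cbn. split; [intros [z <-]; lia|]. intros H. exists (y - x). lia.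
Qed.

Lemma NM_lt (x y : NM) : lt x y <-> Peano.lt x y.
Proof. unfold lt. rewrite NM_le. reflexivity. Qed.

Lemma NM_nm n : nm NM n = n.
Proof. induction n; cbn; congruence. Qed.

(** ** Small well-founded graphs *)

Section Small.
Variable E : nat -> nat -> Prop.

(** The size of a node is the ordinal obtained by adding up, in their order, the sizes of
    its successors (and at least omega, as it is the size of a limit notation). If nodes
    in [P] have sizes below [omega ^ (k + 1)], all but finitely many successors add up to
    at most that; so this node has size at most some [omega ^ (k + 1) * c]. *)
Inductive almost (P : nat -> Prop) (t : nat) : Prop :=
| almost_intro N :
    (forall m, E t m -> m < N -> almost P m) ->
    (forall m, E t m -> N <= m -> P m) -> almost P t.

(** These are the nodes of size at most some [omega ^ (k + 1) * c]; see [small_above]. *)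
Fixpoint small (k : nat) : nat -> Prop :=
  match k with
  | 0 => almost (fun _ => False)
  | S k => almost (small k)
  end.

Definition below_small (k : nat) : nat -> Prop :=
  match k with 0 => fun _ => False | S k => small k end.

Lemma small_eq k : small k = almost (below_small k).
Proof. destruct k; reflexivity. Qed.

Lemma almost_mono (P P' : nat -> Prop) t : (forall m, P m -> P' m) -> almost P t -> almost P' t.
Proof.
  intros H A; induction A as [t N H1 IH H2]. apply (almost_intro _ _ N); auto.
Qed.

Lemma small_S k t : small k t -> small (S k) t.
Proof.
  revert t. induction k as [|k IH]; intros t; simpl.
  - apply almost_mono. tauto.
  - apply almost_mono. apply IH.
Qed.

Lemma small_0 k t : small 0 t -> small k t.
Proof. intros H. induction k; auto using small_S. Qed.

End Small.

Lemma bound_family (P : nat -> nat -> Prop) B :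
  (forall i, i < B -> exists N, forall x, P i x -> x < N) ->
  exists N, forall i x, i < B -> P i x -> x < N.
Proof.
  induction B as [|B IH]; intros H.
  - exists 0. intros; lia.
  - destruct IH as [N HN]; [intros; apply H; lia|]. destruct (H B) as [N' HN']; [lia|].
    exists (N + N'). intros i x Hi Hx. destruct (Nat.eq_dec i B) as [->|Hne].
    + specialize (HN' x Hx). lia.
    + specialize (HN i x ltac:(lia) Hx). lia.
Qed.

Lemma bound_unique (P : nat -> Prop) : (forall x y, P x -> P y -> x = y) ->
  exists N, forall x, P x -> x < N.
Proof.
  intros H. destruct (classic (exists x, P x)) as [[x Hx]|Hn].
  - exists (S x). intros y Hy. rewrite (H y x); auto.
  - exists 0. intros x Hx. destruct Hn; eauto.
Qed.

(** ** The step on small graphs *)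

Section StepSmall.
Variable Q : rel.
Variable E : nat -> nat -> Prop.
Hypothesis HE : forall t m, E t m <-> exists w, right Q NM t m w.
Hypothesis HU : forall t m w w', right Q NM t m w -> right Q NM t m w' -> w = w'.

Let E' : nat -> nat -> Prop := step Q NM.

Lemma step_child x x' : E' x x' -> exists m w, child Q NM x m w x'.
Proof. intros (m & _ & w & _ & H). eauto. Qed.

(** A wrong entry fails at some [u0]. A continuation tests the entry up to a pair that
    exceeds its length and the new entry, so the length and the new entries are below
    [u0], which leaves finitely many continuations. *)
Lemma wrong_small x t m w : hist NM x t m w -> ~ right Q NM t m w -> small E' 0 x.
Proof.
  intros Hh Hr.
  assert (U : exists u0, forall v, ~ QQ Q NM t m w u0 v).
  { apply NNPP. intros Hn. apply Hr. intros u. apply NNPP. intros Hv. apply Hn. exists u. eauto. }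
  destruct U as [u0 Hu]. clear Hr.
  assert (K : forall d x n a, x = pr NM n a -> u0 <= n + d -> hist NM x t m w -> small E' 0 x).
  { clear x Hh. intros d; induction d as [|d IH]; intros x n a Ex Hd Hh; subst x.
    - apply (almost_intro _ _ _ 0); intros x' Hx'; [lia|]. exfalso.
      apply step_child in Hx'. destruct Hx' as (m1 & w1 & Hc).
      destruct (child_hist Q NM _ _ _ _ Hc) as (t1 & _ & Hh').
      destruct (child_ver Q NM _ _ _ _ n a t m w Hc eq_refl) with (u := u0) as [v Hv].
      + apply Hh'. auto.
      + apply NM_le. pose proof (proj1 (NM_le _ _) (le_pr_l NM n (pr NM m1 w1))). lia.
      + exact (Hu v Hv).
    - assert (B : forall x' m1 w1, child Q NM (pr NM n a) m1 w1 x' -> m1 < u0 /\ w1 < u0).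
      { intros x' m1 w1 Hc. destruct (child_hist Q NM _ _ _ _ Hc) as (t1 & _ & Hh').
        pose proof (child_ver Q NM _ _ _ _ n a t m w Hc eq_refl (proj2 (Hh' _ _ _) (or_introl Hh)) u0) as V.
        pose proof (proj1 (NM_le _ _) (le_pr_r NM n (pr NM m1 w1))) as L.
        pose proof (proj1 (NM_le _ _) (le_pr_l NM m1 w1)) as L1.
        pose proof (proj1 (NM_le _ _) (le_pr_r NM m1 w1)) as L2.
        destruct (Compare_dec.le_lt_dec u0 (pr NM n (pr NM m1 w1))) as [L3|L3].
        - destruct V as [v Hv]; [apply NM_le; auto|]. destruct (Hu v Hv).
        - split; lia. }
      destruct (bound_family (fun m1 x' => exists w1, child Q NM (pr NM n a) m1 w1 x') u0) as [N HN].
      { intros m1 _.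
        destruct (bound_family (fun w1 x' => child Q NM (pr NM n a) m1 w1 x') u0) as [N HN].
        - intros w1 _. apply bound_unique. intros x1 x2 A1 A2. exact (child_unique Q NM _ _ _ _ _ A1 A2).
        - exists N. intros x' [w1 Hc]. apply (HN w1); auto. apply (B _ _ _ Hc). }
      apply (almost_intro _ _ _ N); intros x' Hx' HxN; apply step_child in Hx';
        destruct Hx' as (m1 & w1 & Hc).
      + destruct (child_length Q NM _ _ _ _ n a Hc eq_refl) as [a' ->].
        apply (IH _ (S n) a' eq_refl); [lia|].
        destruct (child_hist Q NM _ _ _ _ Hc) as (t1 & _ & Hh'). apply Hh'. auto.
      + assert (x' < N); [|lia]. apply (HN m1); [apply (B _ _ _ Hc)|eauto]. }
  destruct Hh as (n & a & i & s & Ex & Hi & He).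
  apply (K u0 x n a Ex); [lia|]. exists n, a, i, s. auto.
Qed.

Definition all_right (x : nat) : Prop := forall t m w, hist NM x t m w -> right Q NM t m w.

Lemma child_all_right x m w x' t : child Q NM x m w x' -> at_node NM x t ->
  all_right x -> right Q NM t m w -> all_right x'.
Proof.
  intros Hc Ht Hx Hr t' m' w' Hh.
  destruct (child_hist Q NM _ _ _ _ Hc) as (t1 & Ht1 & Hh'). apply Hh' in Hh.
  rewrite (at_fun NM _ _ _ Ht1 Ht) in Hh. destruct Hh as [Hh|(-> & -> & ->)]; auto.
Qed.

Lemma child_wrong x m w x' t : child Q NM x m w x' -> at_node NM x t ->
  ~ right Q NM t m w -> small E' 0 x'.
Proof.
  intros Hc Ht Hr. apply (wrong_small x' t m w); auto.
  destruct (child_hist Q NM _ _ _ _ Hc) as (t1 & Ht1 & Hh'). apply Hh'.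
  rewrite (at_fun NM _ _ _ Ht1 Ht). auto.
Qed.

(** A history of right entries follows a path of [E]. Its continuations are right ones,
    to which the induction applies, or wrong ones, which are small. For each successor
    below [N] there is one right continuation, by uniqueness of [w]: so all but finitely
    many continuations are wrong or lead to nodes that are small for a smaller [k]. *)
Lemma step_small k : forall x t, at_node NM x t -> all_right x -> small E k t -> small E' (S k) x.
Proof.
  induction k as [k IHk] using lt_wf_ind. intros x t Ht Hx H.
  rewrite small_eq in H. revert x Ht Hx. induction H as [t N H1 IH H2]. intros x Ht Hx.
  destruct (bound_family (fun m x' => exists w, child Q NM x m w x' /\ right Q NM t m w) N) as [N' HN].
  { intros m _. apply bound_unique. intros a b (w & Ha & Ra) (w' & Hb & Rb).
    rewrite (HU _ _ _ _ Ra Rb) in Ha. exact (child_unique Q NM _ _ _ _ _ Ha Hb). }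
  cbn [small]. apply (almost_intro _ _ _ N'); intros x' Hx' HxN; apply step_child in Hx';
    destruct Hx' as (m & w & Hc); destruct (classic (right Q NM t m w)) as [Hr|Hr].
  - pose proof (child_all_right _ _ _ _ _ Hc Ht Hx Hr) as Hx'.
    pose proof (child_at Q NM _ _ _ _ Hc) as Ht'.
    assert (Em : E t m) by (apply HE; eauto).
    destruct (Compare_dec.le_lt_dec N m) as [L|L].
    + specialize (H2 m Em L). destruct k as [|k]; [destruct H2|].
      apply (small_S E' (S k)). apply (IHk k ltac:(lia) x' m); auto.
    + apply (IH m Em L); auto.
  - apply (small_0 E' (S k)). eapply child_wrong; eauto.
  - pose proof (child_all_right _ _ _ _ _ Hc Ht Hx Hr) as Hx'.
    pose proof (child_at Q NM _ _ _ _ Hc) as Ht'.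
    assert (Em : E t m) by (apply HE; eauto).
    destruct (Compare_dec.le_lt_dec N m) as [L|L].
    + specialize (H2 m Em L). destruct k as [|k]; [destruct H2|].
      apply (IHk k ltac:(lia) x' m); auto.
    + assert (x' < N'); [|lia]. apply (HN m); eauto.
  - apply small_0. eapply child_wrong; eauto.
Qed.

Lemma step_below_small k : (forall m, E 0 m -> below_small E k m) ->
  forall x, E' 0 x -> below_small E' (S k) x.
Proof.
  intros H x Hx. cbn [below_small]. apply step_child in Hx. destruct Hx as (m & w & Hc).
  assert (H0 : all_right 0).
  { intros t' m' w' Hh. destruct (root_hist NM _ _ _ Hh). }
  destruct (classic (right Q NM 0 m w)) as [Hr|Hr].
  - assert (Em : E 0 m) by (apply HE; eauto). apply H in Em. destruct k; [destruct Em|].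
    apply (step_small k x m); auto.
    + apply (child_at Q NM _ _ _ _ Hc).
    + apply (child_all_right 0 m w x 0); auto. apply (root_at NM).
  - apply small_0. apply (child_wrong 0 m w x 0); auto. apply (root_at NM).
Qed.

End StepSmall.

(** ** From a formula to a graph of the lowest level *)

(** As [cc], with unbounded quantifiers. *)
Ltac ud :=
  repeat match goal with
  | |- udef (fun M e => _ /\ _) => apply (g_and closed_udef)
  | |- udef (fun M e => _ \/ _) => apply (g_or _ closed_udef)
  | |- udef (fun M e => exists x, _) => apply udef_ex
  | |- udef (fun M e => forall x : car _, _) => apply udef_all
  | |- udef (fun M e => _ -> _) => apply (g_imp _ closed_udef)
  end;
  cc closed_udef.

Definition nil0 {M : pam} : nat -> M := fun _ => mz.
Definition un (P : rel) (M : pam) (t : M) : Prop := P M (scons t nil0).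
Definition bin (E : rel) (M : pam) (t m : M) : Prop := E M (scons t (scons m nil0)).

(** From a node in [P] there is an infinite path within [P]. Its nodes need not be given
    by a function; in nonstandard models it is the absence of a last node that counts. *)
Definition path (E P : rel) : Prop :=
  forall (M : pam) t, un P M t -> exists m, un P M m /\ bin E M t m.

(** Each step takes a graph from level [k + 1] to level [k] and raises the size of the
    root in the standard model by one power of omega. A path lifts to a path of right
    histories, in every model. *)
Lemma lower k : forall j E P, level k E -> udef P -> path E P ->
  exists E' P', class0 E' /\ udef P' /\ path E' P' /\
    (forall M, un P M mz -> un P' M mz) /\
    ((forall m, bin E NM 0 m -> below_small (bin E NM) j m) ->
     forall m, bin E' NM 0 m -> below_small (bin E' NM) (j + k) m).
Proof.
  induction k as [|k IH]; intros j E P HE HP Hpath.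
  { exists E, P. rewrite Nat.add_0_r. auto. }
  destruct HE as [(Q & HQ & HE) _].
  assert (DQ : udef Q) by (apply (g_def (closed_level k)), HQ).
  assert (HR : forall (M : pam) t m, bin E M t m <-> exists w, right Q M t m w).
  { intros M t m. apply (HE M (scons t (scons m nil0))). }
  assert (HU : forall (M : pam) t m w w', right Q M t m w -> right Q M t m w' -> w = w').
  { intros M t m. apply (HE M (scons t (scons m nil0))). }
  set (E1 := (fun M e => step Q M (e 0) (e 1)) : rel).
  set (P1 := (fun M e => valid M (e 0) /\ exists t, (at_node M (e 0) t /\ P M (scons t nil0)) /\
    forall t' m' w', hist M (e 0) t' m' w' -> right Q M t' m' w') : rel).
  destruct (IH (S j) E1 P1) as (E' & P' & A & B & C & D & F).
  - apply step_class; [apply closed_level|exact HQ].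
  - unfold P1, valid, at_node, hist, right, QQ, cur, entry, betaC, modulus, rec4, nil0. ud.
  - intros M x (Hv & t & (Ht & Hp) & Hh). destruct (Hpath M t Hp) as (m & Hm & He).
    apply HR in He. destruct He as [w Hw].
    destruct (child_exists Q M DQ x t m w Hv Ht Hh Hw) as [x' Hc].
    exists x'. split; [|apply child_step with (1 := Hc)].
    split; [exact (child_valid Q M _ _ _ _ Hc Hv)|]. exists m. split; [split; auto|].
    + exact (child_at Q M _ _ _ _ Hc).
    + intros t' m' w' H. destruct (child_hist Q M _ _ _ _ Hc) as (t1 & Ht1 & Hh').
      apply Hh' in H. rewrite (at_fun M _ _ _ Ht1 Ht) in H.
      destruct H as [H|(-> & -> & ->)]; auto.
  - exists E', P'. split; [exact A|]. split; [exact B|]. split; [exact C|]. split.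
    + intros M H. apply D. split; [apply root_valid|]. exists mz. split; [split; [apply root_at|exact H]|].
      intros t' m' w' Hh. destruct (root_hist M _ _ _ Hh).
    + intros H. replace (j + S k) with (S j + k) by lia. apply F.
      exact (step_below_small Q (bin E NM) (HR NM) (HU NM) j H).
Qed.

(** The first graph consists of the root [0] and of nodes [x + 1]. If [R x] then [x + 1]
    has a loop and can be reached from the root; otherwise it is isolated. *)
Lemma graph n (R : rel) : level n R -> exists E P,
  class0 E /\ udef P /\ path E P /\
  (forall M, (exists x, un R M x) -> un P M mz) /\
  ((forall x, ~ un R NM x) -> forall m, bin E NM 0 m -> below_small (bin E NM) n m).
Proof.
  intros HR. pose proof (closed_level n) as G.
  set (E := (fun M e => exists x, le x (e 1) /\ (e 1 = ms x /\ (e 0 = mz \/ e 0 = e 1) /\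
    R M (scons x nil0))) : rel).
  set (P := (fun M e => (e 0 = mz /\ exists x, R M (scons x nil0)) \/
    exists x, e 0 = ms x /\ R M (scons x nil0)) : rel).
  destruct (lower n 0 E P) as (E' & P' & A & B & C & D & F).
  - unfold E, nil0. cc G.
  - assert (udef R) by (apply (g_def G), HR). unfold P, nil0. ud.
  - intros M t Ht.
    assert (K : exists x, (t = mz \/ t = ms x) /\ R M (scons x nil0)).
    { destruct Ht as [[H0 [x Hx]]|(x & Hx & HRx)]; exists x; auto. }
    destruct K as (x & Ht' & Hx). exists (ms x).
    split; [right; exists x; split; auto; reflexivity|].
    exists x. split; [apply le_S|]. split; [reflexivity|]. split; auto.
  - exists E', P'. split; [exact A|]. split; [exact B|]. split; [exact C|]. split.
    + intros M Hx. apply D. left. auto.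
    + intros H. apply F. intros m (x & _ & _ & _ & Hx). destruct (H x Hx).
Qed.

(** * Programs *)

Section Computations.
Variable M : pam.
Implicit Types (x y z f g : M).
Local Open Scope pa_scope.
Notation k n := (nm M n) (only parsing).
Notation pr := (pr M).

Definition jId : M := pr (k 2) (k 0).
Definition jPair f g : M := pr (k 5) (pr f g).
Definition jComp f g : M := pr (k 6) (pr f g).
Definition jRec f g : M := pr (k 7) (pr f g).

Lemma comp_zero x : compM M (pr (k 0) (k 0)) x mz.
Proof. apply lfp_fold; [apply fin_Comp|]. left. exists x. reflexivity. Qed.

Lemma comp_succ x : compM M (pr (k 1) (k 0)) x (ms x).
Proof. apply lfp_fold; [apply fin_Comp|]. right; left. exists x. reflexivity. Qed.

Lemma comp_id x : compM M jId x x.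
Proof. apply lfp_fold; [apply fin_Comp|]. do 2 right; left. exists x. reflexivity. Qed.

Lemma comp_fst x y : compM M (pr (k 3) (k 0)) (pr x y) x.
Proof. apply lfp_fold; [apply fin_Comp|]. do 3 right; left. exists x, y. reflexivity. Qed.

Lemma comp_snd x y : compM M (pr (k 4) (k 0)) (pr x y) y.
Proof. apply lfp_fold; [apply fin_Comp|]. do 4 right; left. exists x, y. reflexivity. Qed.

Lemma comp_pair f g x y z : compM M f x y -> compM M g x z -> compM M (jPair f g) x (pr y z).
Proof.
  intros H1 H2. apply lfp_fold; [apply fin_Comp|]. do 5 right; left. exists f, g, x, y, z. auto.
Qed.

Lemma comp_comp f g x y z : compM M g x y -> compM M f y z -> compM M (jComp f g) x z.
Proof.
  intros H1 H2. apply lfp_fold; [apply fin_Comp|]. do 6 right; left. exists f, g, x, y, z. auto.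
Qed.

Lemma comp_rec0 f g x y : compM M f x y -> compM M (jRec f g) (pr x mz) y.
Proof.
  intros H1. apply lfp_fold; [apply fin_Comp|]. do 7 right; left. exists f, g, x, y. auto.
Qed.

Lemma comp_recS f g x n y z : compM M (jRec f g) (pr x n) y -> compM M g (pr x (pr n y)) z ->
  compM M (jRec f g) (pr x (ms n)) z.
Proof.
  intros H1 H2. apply lfp_fold; [apply fin_Comp|]. do 8 right; left. exists f, g, x, n, y, z. auto.
Qed.

Fixpoint tup (n : nat) (r : nat -> M) : M :=
  match n with 0 => mz | S n => pr (r 0) (tup n (fun i => r (S i))) end.

Lemma pow_0 b : powM M b mz (k 1).
Proof. apply lfp_fold; [apply fin_Pow|]. left. reflexivity. Qed.

Lemma pow_S b n y : powM M b n y -> powM M b (ms n) (k b * y).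
Proof. intros H. apply lfp_fold; [apply fin_Pow|]. right. exists n, y. auto. Qed.

Lemma Def_comp (f g h : (nat -> M) -> M) : dtm M f -> dtm M g -> dtm M h -> Def M (fun e => compM M (f e) (g e) (h e)).
Proof.
  intros Hf Hg Hh.
  apply (Def_iff M (fun e => st M (scons (f e) (scons (g e) (scons (h e) (fun _ => mz)))) Comp)).
  - intros e. apply sem_Comp.
  - apply Def_st. intros i. dterm.
Qed.

Lemma Def_pow b (f g : (nat -> M) -> M) : dtm M f -> dtm M g -> Def M (fun e => powM M b (f e) (g e)).
Proof.
  intros Hf Hg.
  apply (Def_iff M (fun e => st M (scons (f e) (scons (g e) (fun _ => mz))) (Pow b))).
  - intros e. apply sem_Pow.
  - apply Def_st. intros i. dterm.
Qed.

Definition isConst (x c : M) : Prop := forall z, compM M c z x.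

End Computations.

Ltac dfn_hook ::=
  lazymatch goal with
  | H : udef ?P |- Def (pm ?M) (fun e => ?P ?M (@?s e)) =>
      apply (Def_rel M P s H); let i := fresh "i" in intros i; dterm
  | |- Def _ (fun e => entry _ _ _ _) => apply Def_entry; dterm
  | |- Def _ (fun e => compM _ _ _ _) => apply Def_comp; dterm
  | |- Def _ (fun e => powM _ _ _ _) => apply Def_pow; dterm
  | |- Def _ (fun e => isConst _ _ _) => unfold isConst; dfn
  end.

(** A relation [A] between arguments and values, in all models, is realized by
    a program if the program finds a value for all arguments, nonstandard ones
    included. *)
Definition task : Type := forall M : pam, (nat -> M) -> M -> Prop.

Definition computesM (e K : nat) (A : task) : Prop :=
  forall (M : pam) (r : nat -> M), exists y, compM M (nm M e) (tup M K r) y /\ A M r y.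

Definition real (K : nat) (A : task) : Prop := exists e, computesM e K A.

Lemma real_impl K (A B : task) : (forall M r y, A M r y -> B M r y) -> real K A -> real K B.
Proof.
  intros H [e He]. exists e. intros M r. destruct (He M r) as (y & ? & ?). eauto.
Qed.

Lemma real_var K i : i < K -> real K (fun M r y => y = r i).
Proof.
  intros Hi.
  assert (H : exists e, forall (M : pam) (r : nat -> M), compM M (nm M e) (tup M K r) (r i)).
  { revert i Hi. induction K as [|K IH]; intros i Hi; [lia|]. destruct i as [|i].
    - exists (pair 3 0). intros M r. rewrite nm_pair. apply comp_fst.
    - destruct (IH i) as [e He]; [lia|]. exists (pair 6 (pair e (pair 4 0))).
      intros M r. rewrite !nm_pair. apply comp_comp with (tup M K (fun i => r (S i))).
      + apply comp_snd.
      + apply (He M (fun i => r (S i))). }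
  destruct H as [e He]. exists e. intros M r. eauto.
Qed.

Lemma real_zero K : real K (fun M r y => y = mz).
Proof. exists (pair 0 0). intros M r. rewrite nm_pair. eauto using comp_zero. Qed.

Lemma real_ms K A : real K A -> real K (fun M r z => exists y, A M r y /\ z = ms y).
Proof.
  intros [e He]. exists (pair 6 (pair (pair 1 0) e)). intros M r.
  destruct (He M r) as (y & Hy & Ha). exists (ms y). split; eauto.
  rewrite !nm_pair. eapply comp_comp; eauto using comp_succ.
Qed.

Lemma real_pr K A B : real K A -> real K B ->
  real K (fun M r z => exists x y, A M r x /\ B M r y /\ z = pr M x y).
Proof.
  intros [e He] [e' He']. exists (pair 5 (pair e e')). intros M r.
  destruct (He M r) as (x & Hx & Ha), (He' M r) as (y & Hy & Hb).
  exists (pr M x y). split; eauto 6. rewrite !nm_pair. apply comp_pair; auto.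
Qed.

Lemma real_nm K n : real K (fun M r y => y = nm M n).
Proof.
  induction n as [|n IH]; [apply real_zero|].
  apply (real_impl K _ _ (fun M r z H => match H with ex_intro _ y (conj H1 H2) => eq_trans H2 (f_equal ms H1) end)
    (real_ms K _ IH)).
Qed.

Lemma real_comp n K (A : task) (B : nat -> task) : real n A ->
  (forall i, i < n -> real K (B i)) ->
  real K (fun M r z => exists s, (forall i, i < n -> B i M r (s i)) /\ A M s z).
Proof.
  intros [e He] HB.
  assert (T : forall n (B : nat -> task), (forall i, i < n -> real K (B i)) -> exists t, forall (M : pam) (r : nat -> M),
    exists s, compM M (nm M t) (tup M K r) (tup M n s) /\ forall i, i < n -> B i M r (s i)).
  { clear. induction n as [|n IH]; intros B HB.
    - exists (pair 0 0). intros M r. exists (fun _ => mz). rewrite nm_pair.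
      split; [apply comp_zero|]. intros; lia.
    - destruct (IH (fun i => B (S i))) as [t Ht]; [intros; apply HB; lia|].
      destruct (HB 0) as [e0 He0]; [lia|]. exists (pair 5 (pair e0 t)). intros M r.
      destruct (Ht M r) as (s & Hs & Hb), (He0 M r) as (y & Hy & Hb0).
      exists (scons y s). split.
      + rewrite !nm_pair. apply comp_pair; auto.
      + intros [|i] Hi; cbn; auto. apply Hb. lia. }
  destruct (T n B HB) as [t Ht]. exists (pair 6 (pair e t)). intros M r.
  destruct (Ht M r) as (s & Hs & Hb), (He M s) as (y & Hy & Ha).
  exists y. split; eauto. rewrite !nm_pair. eapply comp_comp; eauto.
Qed.

(** Primitive recursion, with the recursion argument last. What is claimed are the
    start and the steps; that the program is defined everywhere follows by induction in
    the model, from which an invariant can be obtained if it is definable ([real_rec]). *)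
Lemma rec_code K (A S' : task) : real K A -> real (S (S K)) S' -> exists R : nat,
  forall (M : pam) (r : nat -> M),
  (exists y, compM M (nm M R) (pr M (tup M K r) mz) y /\ A M r y) /\
  (forall n y, compM M (nm M R) (pr M (tup M K r) n) y -> exists z,
     compM M (nm M R) (pr M (tup M K r) (ms n)) z /\ S' M (scons y (scons n r)) z).
Proof.
  intros [f Hf] [g Hg].
  set (snd := pair 4 0). set (fst := pair 3 0).
  set (re := pair 5 (pair (pair 6 (pair snd snd)) (pair 5 (pair (pair 6 (pair fst snd)) fst)))).
  exists (pair 7 (pair f (pair 6 (pair g re)))). intros M r.
  assert (E : nm M (pair 7 (pair f (pair 6 (pair g re)))) =
    jRec M (nm M f) (jComp M (nm M g) (nm M re))) by (rewrite !nm_pair; reflexivity).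
  rewrite E. split.
  - destruct (Hf M r) as (y & Hy & Ha). exists y. split; auto. apply comp_rec0, Hy.
  - intros n y Hy. destruct (Hg M (scons y (scons n r))) as (z & Hz & Hs).
    exists z. split; auto. apply (comp_recS _ _ _ _ _ y); auto.
    apply comp_comp with (tup M (S (S K)) (scons y (scons n r))); auto.
    cbn [tup scons]. unfold re, snd, fst. rewrite !nm_pair.
    apply comp_pair; [|apply comp_pair].
    + eapply comp_comp; apply comp_snd.
    + eapply comp_comp; [apply comp_snd|apply comp_fst].
    + apply comp_fst.
Qed.

Lemma real_rec K (A S' : task) (I : forall M : pam, (nat -> M) -> M -> M -> Prop) :
  real K A -> real (S (S K)) S' ->
  (forall (M : pam) r, Def M (fun e => I M r (e 0) (e 1))) ->
  (forall (M : pam) r y, A M r y -> I M r mz y) ->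
  (forall (M : pam) r n y z, I M r n y -> S' M (scons y (scons n r)) z -> I M r (ms n) z) ->
  real (S K) (fun M e y => I M (fun i => e (S i)) (e 0) y).
Proof.
  intros HA HS HD H0 H1. destruct (rec_code K A S' HA HS) as [R HR].
  exists (pair 6 (pair R (pair 5 (pair (pair 4 0) (pair 3 0))))). intros M e.
  destruct (HR M (fun i => e (S i))) as [B C].
  set (X := tup M K (fun i => e (S i))) in *.
  enough (D : forall n, exists y, compM M (nm M R) (pr M X n) y /\ I M (fun i => e (S i)) n y).
  { destruct (D (e 0)) as (y & Hy & Hi). exists y. split; auto. rewrite !nm_pair.
    eapply comp_comp; [|exact Hy]. cbn [tup]. apply comp_pair; [apply comp_snd|apply comp_fst]. }
  apply induct.
  - specialize (HD M (fun i => e (S i))). set (J := I M (fun i => e (S i))) in *.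
    change (Def M (fun e0 => exists y, compM M (nm M R) (pr M X (e0 0)) y /\ J (e0 0) y)). dfn.
  - destruct B as (y & Hy & Ha). eauto.
  - intros n (y & Hy & Hi). destruct (C n y Hy) as (z & Hz & Hs). eauto.
Qed.

(** ** Some arithmetical programs *)

Section Functions.
Local Open Scope pa_scope.

Lemma real_app2 K (F : forall M : pam, M -> M -> M -> Prop) (A B : task) :
  real 2 (fun M r z => F M (r 0) (r 1) z) -> real K A -> real K B ->
  real K (fun M r z => exists x y, A M r x /\ B M r y /\ F M x y z).
Proof.
  intros HF HA HB.
  apply (real_impl K (fun M r z => exists s, (forall i, (i < 2)%nat ->
    match i with 0 => A | _ => B end M r (s i)) /\ F M (s 0) (s 1) z)).
  - intros M r z (s & H & Hf). exists (s 0), (s 1).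
    split; [apply (H 0); lia|]. split; [apply (H 1); lia|auto].
  - apply (real_comp 2 K _ (fun i => match i with 0 => A | _ => B end) HF).
    intros [|i] _; auto.
Qed.

Lemma real_app3 K (F : forall M : pam, M -> M -> M -> M -> Prop) (A B C : task) :
  real 3 (fun M r z => F M (r 0) (r 1) (r 2) z) -> real K A -> real K B -> real K C ->
  real K (fun M r z => exists x y u, A M r x /\ B M r y /\ C M r u /\ F M x y u z).
Proof.
  intros HF HA HB HC.
  apply (real_impl K (fun M r z => exists s, (forall i, (i < 3)%nat ->
    match i with 0 => A | 1 => B | _ => C end M r (s i)) /\ F M (s 0) (s 1) (s 2) z)).
  - intros M r z (s & H & Hf). exists (s 0), (s 1), (s 2).
    split; [apply (H 0); lia|]. split; [apply (H 1); lia|]. split; [apply (H 2); lia|auto].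
  - apply (real_comp 3 K _ (fun i => match i with 0 => A | 1 => B | _ => C end) HF).
    intros [|[|i]] _; auto.
Qed.

Lemma real_app1 K (F : forall M : pam, M -> M -> Prop) (A : task) :
  real 1 (fun M r z => F M (r 0) z) -> real K A ->
  real K (fun M r z => exists x, A M r x /\ F M x z).
Proof.
  intros HF HA.
  apply (real_impl K (fun M r z => exists s, (forall i, (i < 1)%nat -> A M r (s i)) /\ F M (s 0) z)).
  - intros M r z (s & H & Hf). exists (s 0). split; [apply (H 0); lia|auto].
  - apply (real_comp 1 K _ (fun i => A) HF). auto.
Qed.

Definition condM (M : pam) (n a b y : M) : Prop := (n = mz -> y = b) /\ (n <> mz -> y = a).

Lemma real_cond : real 3 (fun M r y => condM M (r 0) (r 1) (r 2) y).
Proof.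
  apply (real_rec 2 (fun M r y => y = r 1) (fun M e z => z = e 2)
    (fun M r n y => condM M n (r 0) (r 1) y)).
  - apply real_var; lia.
  - apply real_var; lia.
  - intros M r. unfold condM. dfn.
  - intros M r y ->. split; tauto.
  - intros M r n y z _ ->. split; [intros H; destruct (S_neq_0 M _ H)|reflexivity].
Qed.

Lemma real_add : real 2 (fun M r y => y = r 0 + r 1).
Proof.
  apply (real_rec 1 (fun M r y => y = r 0) (fun M e z => exists y, y = e 0 /\ z = ms y)
    (fun M r n y => y = n + r 0)).
  - apply real_var; lia.
  - apply real_ms, real_var; lia.
  - intros M r. dfn.
  - intros M r y ->. rewrite add_0_l. auto.
  - intros M r n y z -> (y' & -> & ->). cbn. rewrite add_S_l. auto.
Qed.

Lemma real_mul : real 2 (fun M r y => y = r 0 * r 1).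
Proof.
  apply (real_rec 1 (fun M r y => y = mz)
    (fun M e z => exists a b, a = e 0 /\ b = e 2 /\ z = a + b)
    (fun M r n y => y = n * r 0)).
  - apply real_zero.
  - apply (real_app2 3 (fun M x y z => z = x + y)); [apply real_add| |]; apply real_var; lia.
  - intros M r. dfn.
  - intros M r y ->. rewrite mul_0_l. auto.
  - intros M r n y z -> (a & b & -> & -> & ->). cbn. rewrite mul_S_l. auto.
Qed.

Lemma real_pred : real 1 (fun M r y => (r 0 = mz /\ y = mz) \/ r 0 = ms y).
Proof.
  apply (real_rec 0 (fun M r y => y = mz) (fun M e z => z = e 1)
    (fun M r n y => (n = mz /\ y = mz) \/ n = ms y)).
  - apply real_zero.
  - apply real_var; lia.
  - intros M r. dfn.
  - auto.
  - intros M r n y z _ ->. auto.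
Qed.

Definition subM (M : pam) (n x y : M) : Prop := y + n = x \/ (y = mz /\ x <= n).

Lemma real_sub : real 2 (fun M r y => subM M (r 0) (r 1) y).
Proof.
  apply (real_rec 1 (fun M r y => y = r 0)
    (fun M e z => exists y, y = e 0 /\ ((y = mz /\ z = mz) \/ y = ms z))
    (fun M r n y => subM M n (r 0) y)).
  - apply real_var; lia.
  - apply (real_app1 3 (fun M x z => (x = mz /\ z = mz) \/ x = ms z)); [apply real_pred|].
    apply real_var; lia.
  - intros M r. unfold subM. dfn.
  - intros M r y ->. left. apply add_0_r.
  - intros M r n y z H (y' & -> & H'). cbn in H'. unfold subM in *.
    destruct H' as [[E ->]|E], H as [H|[H L]]; rewrite E in *.
    + right. split; auto. rewrite <- H, add_0_l. apply le_S.
    + right. split; auto. eapply le_trans; [exact L|apply le_S].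
    + left. rewrite <- H, add_S_r, add_S_l. auto.
    + destruct (S_neq_0 M _ H).
Qed.

Definition decM (A : Prop) (M : pam) (y : M) : Prop := (A /\ y = one) \/ (~ A /\ y = mz).

Definition decided (K : nat) (P : rel) : Prop := real K (fun M r y => decM (P M r) M y).

Lemma decided_iff K (P P' : rel) : (forall M r, P M r <-> P' M r) -> decided K P -> decided K P'.
Proof.
  intros E. apply real_impl. intros M r y. unfold decM. rewrite E. tauto.
Qed.

Lemma one_neq_0 (M : pam) : @one M <> mz.
Proof. apply S_neq_0. Qed.

Lemma real_one K : real K (fun M r y => y = one).
Proof. apply (real_nm K 1). Qed.

Lemma real_term K t : tbounded K t -> real K (fun M r y => y = ev M r t).
Proof.
  induction t; simpl; intros H.
  - apply real_var, H.
  - apply real_zero.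
  - apply (real_impl K (fun M r z => exists y, y = ev M r t /\ z = ms y)).
    + intros M r z (y & -> & ->). auto.
    + apply real_ms, IHt, H.
  - apply (real_impl K (fun M r z => exists x y, x = ev M r t1 /\ y = ev M r t2 /\ z = x + y)).
    + intros M r z (x & y & -> & -> & ->). auto.
    + apply (real_app2 K (fun M x y z => z = x + y)); [apply real_add|apply IHt1, H|apply IHt2, H].
  - apply (real_impl K (fun M r z => exists x y, x = ev M r t1 /\ y = ev M r t2 /\ z = x * y)).
    + intros M r z (x & y & -> & -> & ->). auto.
    + apply (real_app2 K (fun M x y z => z = x * y)); [apply real_mul|apply IHt1, H|apply IHt2, H].
Qed.

Lemma decided_le K s t : tbounded K s -> tbounded K t ->
  decided K (fun M r => ev M r s <= ev M r t).
Proof.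
  intros Hs Ht.
  apply (real_impl K (fun M r z => exists x y u,
    (exists a b, a = ev M r t /\ b = ev M r s /\ subM M a b x) /\ y = mz /\ u = one /\ condM M x y u z)).
  - intros M r z (x & y & u & (a & b & -> & -> & Hx) & -> & -> & [C1 C2]). unfold decM.
    destruct (classic (x = mz)) as [E|E].
    + left. split; auto. subst x. destruct Hx as [Hx|[_ Hx]]; auto.
      rewrite add_0_l in Hx. rewrite Hx. apply le_refl.
    + right. split; auto. intros L. destruct Hx as [Hx|[Hx _]]; auto.
      rewrite <- Hx in L. destruct (zero_or_S M x) as [|[x' ->]]; [auto|].
      apply (lt_not_le M (ev M r t) (ms x' + ev M r t)); auto.
      exists x'. rewrite add_S_l, add_S_r. auto.
  - apply (real_app3 K condM); [apply real_cond| |apply real_zero|apply real_one].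
    apply (real_app2 K subM); [apply real_sub|apply real_term, Ht|apply real_term, Hs].
Qed.

Lemma decided_imp K P P' : decided K P -> decided K P' -> decided K (fun M r => P M r -> P' M r).
Proof.
  intros H H'.
  apply (real_impl K (fun M r z => exists x y u,
    decM (P M r) M x /\ decM (P' M r) M y /\ u = one /\ condM M x y u z)).
  - intros M r z (x & y & u & [[A ->]|[A ->]] & [[B ->]|[B ->]] & -> & [C1 C2]); unfold decM;
      try rewrite C2 by apply one_neq_0; try rewrite C1 by reflexivity; tauto.
  - apply (real_app3 K condM); auto using real_cond, real_one.
Qed.

Lemma decided_eq K s t : tbounded K s -> tbounded K t ->
  decided K (fun M r => ev M r s = ev M r t).
Proof.
  intros Hs Ht.
  apply (decided_iff K (fun M r => (ev M r s <= ev M r t -> (ev M r t <= ev M r s -> False)) -> False)).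
  - intros M r. split.
    + intros H. apply NNPP. intros Hn. apply H. intros A B. apply Hn, le_antisym; auto.
    + intros ->. intros H. apply H; apply le_refl.
  - assert (F : decided K (fun M r => False)).
    { apply (real_impl K (fun M r y => y = mz)); [|apply real_zero].
      intros M r y ->. right. auto. }
    apply decided_imp; auto. apply decided_imp; [apply decided_le; auto|].
    apply decided_imp; auto. apply decided_le; auto.
Qed.

(** Bounded quantification, by recursion on the bound. *)
Lemma decided_ball K p t : bounded (S K) p -> decided (S K) (fun M r => st M r p) -> tbounded K t ->
  decided K (fun M r => forall x, x <= ev M r t -> st M (scons x r) p).
Proof.
  intros Hb HP Ht.
  assert (H : real (S K) (fun M e y => decM (forall x, x < e 0 -> st M (scons x (fun i => e (S i))) p) M y)).
  { apply (real_rec K (fun M r y => y = one)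
      (fun M e z => exists x y u, x = e 0 /\ (decM (st M (fun i => e (S i)) p) M y) /\ u = mz /\ condM M x y u z)
      (fun M r n y => decM (forall x, x < n -> st M (scons x r) p) M y)).
    - apply real_one.
    - apply (real_app3 (S (S K)) condM); [apply real_cond|apply real_var; lia| |apply real_zero].
      destruct HP as [e He]. exists (pair 6 (pair e (pair 4 0))). intros M r.
      destruct (He M (fun i => r (S i))) as (y & Hy & Hd). exists y. split; auto.
      rewrite !nm_pair. eapply comp_comp; [|exact Hy]. apply comp_snd.
    - intros M r. unfold decM. dfn.
    - intros M r y ->. left. split; auto. intros x Hx. destruct (lt_0_r M _ Hx).
    - intros M r n y z H (x & y' & u & -> & Hp & -> & [C1 C2]). cbn [scons] in *.
      assert (E : (forall x, x < ms n -> st M (scons x r) p) <->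
        (forall x, x < n -> st M (scons x r) p) /\ st M (scons n r) p).
      { split.
        - intros A. split; [intros x Hx|]; apply A; [apply lt_or_eq; auto|apply lt_S].
        - intros [A B] x Hx. apply lt_or_eq in Hx. destruct Hx as [Hx| ->]; auto. }
      unfold decM in *. rewrite E.
      change (fun i : nat => scons n r i) with (scons n r) in Hp.
      destruct H as [[A ->]|[A ->]].
      + rewrite C2 by apply one_neq_0. destruct Hp as [[B ->]|[B ->]]; tauto.
      + rewrite C1 by reflexivity. tauto. }
  set (B := fun i => match i return task with
    | 0 => fun M r y => exists x, x = ev M r t /\ y = ms x
    | S j => fun M r y => y = r j
    end).
  apply (real_impl K (fun M r z => exists s : nat -> M, (forall i, (i < S K)%nat -> B i M r (s i)) /\
     decM (forall x, x < s 0 -> st M (scons x (fun i => s (S i))) p) M z)).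
  - intros M r z (s & Hs & Hz).
    assert (E : (forall x, x <= ev M r t -> st M (scons x r) p) <->
      (forall x, x < s 0 -> st M (scons x (fun i => s (S i))) p)).
    { destruct (Hs 0) as (b & -> & ->); [lia|].
      assert (Ea : forall x, st M (scons x r) p <-> st M (scons x (fun i => s (S i))) p).
      { intros x. apply (st_agree M p (S K)); auto. intros [|i] Hi; simpl; auto.
        symmetry. apply (Hs (S i) Hi). }
      split; intros A x Hx; apply Ea, A; [apply lt_succ_le|apply le_lt_succ]; auto. }
    unfold decM in *. rewrite E. exact Hz.
  - apply (real_comp (S K) K (fun M e y => decM (forall x, x < e 0 -> st M (scons x (fun i => e (S i))) p) M y) B); auto.
    intros [|j] Hj; [apply real_ms, real_term, Ht|apply real_var; lia].
Qed.

Lemma tbounded_tlift K t : tbounded (S K) (tlift t) -> tbounded K t.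
Proof. unfold tlift. induction t; simpl; auto; try lia; tauto. Qed.

Lemma decided_delta0 p : delta0 p -> forall K, bounded K p -> decided K (fun M r => st M r p).
Proof.
  induction 1 as [|s t|s t|p q _ IHp _ IHq|t p _ IH]; intros K Hb.
  - apply (real_impl K (fun M r y => y = mz)); [|apply real_zero].
    intros M r y ->. right. auto.
  - apply (decided_eq K s t); apply Hb.
  - apply (decided_iff K (fun M r => ev M r s <= ev M r t)).
    + intros M r. symmetry. apply st_Le.
    + simpl in Hb. apply decided_le; apply tbounded_tlift; tauto.
  - apply (decided_imp K (fun M r => st M r p) (fun M r => st M r q)); [apply IHp|apply IHq]; apply Hb.
  - apply (decided_iff K (fun M r => forall x, x <= ev M r t -> st M (scons x r) p)).
    + intros M r. symmetry. apply (sem_all M r (Imp (Le (Var 0) (tlift t)) p)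
        (fun x => x <= ev M r t -> st M (scons x r) p)). intros x. cbn [st]. rewrite st_Le.
      unfold tlift. rewrite ev_subst. cbn [ev scons].
      rewrite (ev_ext M (fun i => r i) r) by auto. tauto.
    + apply decided_ball; [|apply IH|].
      * simpl in Hb. tauto.
      * simpl in Hb. tauto.
      * simpl in Hb. destruct Hb as [Hb _].
        apply tbounded_tlift, (tbounded_tlift (S K)). tauto.
Qed.

Lemma decided_bin E : class0 E -> decided 2 (fun M r => bin E M (r 0) (r 1)).
Proof.
  intros (p & Hp & H).
  apply (decided_iff 2 (fun M r => st M r (cut 2 p))).
  - intros M r. unfold cut. rewrite st_subst, H. unfold bin.
    rewrite <- !H. apply st_ext. intros [|[|i]]; reflexivity.
  - apply decided_delta0; [apply delta0_subst, Hp|apply bounded_cut].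
Qed.

(** ** Notations for limits *)

(** A program for the constant [n] is obtained by composing [n] successors. *)
Lemma real_const : real 1 (fun M r c => isConst M (r 0) c).
Proof.
  apply (real_rec 0 (fun M r c => c = nm M (pair 0 0))
    (fun M e z => exists f g, (exists a b, a = nm M 6 /\ (exists a' b', a' = nm M (pair 1 0) /\ b' = e 0 /\ b = pr M a' b') /\ f = a /\ g = b) /\ z = pr M f g)
    (fun M r n y => isConst M n y)).
  - apply real_nm.
  - apply (real_impl 2 (fun M e z => exists a b, a = nm M 6 /\ (exists a' b', a' = nm M (pair 1 0) /\ b' = e 0 /\ b = pr M a' b') /\ z = pr M a b)).
    + intros M e z (a & b & Ha & Hb & ->). exists a, b. split; auto. exists a, b. auto.
    + apply real_pr; [apply real_nm|]. apply real_pr; [apply real_nm|apply real_var; lia].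
  - intros M r. dfn.
  - intros M r y -> z. rewrite nm_pair. apply comp_zero.
  - intros M r n y z H (f & g & (a & b & -> & (a' & b' & -> & -> & ->) & -> & ->) & ->) x.
    cbn [scons]. apply comp_comp with n; [apply H|]. rewrite nm_pair. apply comp_succ.
Qed.

Lemma real_pow b : real 1 (fun M r y => powM M b (r 0) y).
Proof.
  apply (real_rec 0 (fun M r y => y = nm M 1)
    (fun M e z => exists x y, x = nm M b /\ y = e 0 /\ z = x * y)
    (fun M r n y => powM M b n y)).
  - apply real_nm.
  - apply (real_app2 2 (fun M x y z => z = x * y)); [apply real_mul|apply real_nm|apply real_var; lia].
  - intros M r. dfn.
  - intros M r y ->. apply pow_0.
  - intros M r n y z H (x & y' & -> & -> & ->). apply pow_S, H.
Qed.

(** The parameters of a program, beginning with its own index. *)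
Definition param (M : pam) (d t b : M) : M := pr M d (pr M t (pr M b mz)).

(** [a] is [3 * 5 ^ e], where [{e}(m) = {d}(d, t, b, m)]. As [d] is one of the
    parameters, a program can refer to notations obtained from itself. *)
Definition isLim (M : pam) (d t b a : M) : Prop := exists c p,
  isConst M (param M d t b) c /\
  powM M 5 (jComp M d (jPair M c (jId M))) p /\ a = nm M 3 * p.

Lemma real_lim : real 3 (fun M r a => isLim M (r 0) (r 1) (r 2) a).
Proof.
  set (X := (fun M r z => exists x y, x = r 0 /\ (exists x1 y1, x1 = r 1 /\
    (exists x2 y2, x2 = r 2 /\ y2 = mz /\ y1 = pr M x2 y2) /\ y = pr M x1 y1) /\ z = pr M x y) : task).
  set (Cn := (fun M r c => exists x, X M r x /\ isConst M x c) : task).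
  set (Ix := (fun M r z => exists x y, x = nm M 6 /\ (exists x1 y1, x1 = r 0 /\
    (exists x2 y2, x2 = nm M 5 /\ (exists x3 y3, Cn M r x3 /\ y3 = nm M (pair 2 0) /\ y2 = pr M x3 y3) /\
      y1 = pr M x2 y2) /\ y = pr M x1 y1) /\ z = pr M x y) : task).
  apply (real_impl 3 (fun M r z => exists x y, x = nm M 3 /\ (exists e, Ix M r e /\ powM M 5 e y) /\ z = x * y)).
  - intros M r a (x & p & -> & (e & He & Hp) & ->).
    destruct He as (? & ? & -> & (? & ? & -> & (? & ? & -> & (c & ? & Hc & -> & ->) & ->) & ->) & ->).
    destruct Hc as (x & (? & ? & -> & (? & ? & -> & (? & ? & -> & -> & ->) & ->) & ->) & Hc).
    exists c, p. split; [exact Hc|]. split; auto. rewrite nm_pair in Hp. exact Hp.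
  - assert (HX : real 3 X).
    { apply real_pr; [apply real_var; lia|]. apply real_pr; [apply real_var; lia|].
      apply real_pr; [apply real_var; lia|apply real_zero]. }
    assert (HC : real 3 Cn) by (apply (real_app1 3 (isConst)); [apply real_const|apply HX]).
    assert (HI : real 3 Ix).
    { apply real_pr; [apply real_nm|]. apply real_pr; [apply real_var; lia|].
      apply real_pr; [apply real_nm|]. apply real_pr; [apply HC|apply real_nm]. }
    apply (real_app2 3 (fun M x y z => z = x * y)); [apply real_mul|apply real_nm|].
    apply (real_app1 3 (fun M e y => powM M 5 e y)); [apply real_pow|apply HI].
Qed.

Lemma lim_comp (M : pam) (d t b a : M) : isLim M d t b a -> exists e p,
  powM M 5 e p /\ a = nm M 3 * p /\
  forall m y, compM M d (pr M (param M d t b) m) y -> compM M e m y.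
Proof.
  intros (c & p & Hc & Hp & ->). eexists _, p. split; [exact Hp|]. split; [reflexivity|].
  intros m y H. eapply comp_comp; [|exact H]. apply comp_pair; [apply Hc|apply comp_id].
Qed.

End Functions.

(** ** Notations for graphs *)

Section GraphNotation.
Variable E : rel.
Hypothesis HE : class0 E.
Local Open Scope pa_scope.

(** The next member of the fundamental sequence after [y], at stage [m]: a
    notation for the successor [m] of [t], if it is one, is put after [y]. *)
Definition next (M : pam) (d t m y z : M) : Prop :=
  (bin E M t m /\ exists a, isLim M d m y a /\ powM M 2 a z) \/
  (~ bin E M t m /\ powM M 2 y z).

Lemma real_next : real 5 (fun M e z => next M (e 2) (e 3) (e 1) (e 0) z).
Proof.
  apply (real_impl 5 (fun M e z => exists x, (exists n a b, decM (bin E M (e 3) (e 1)) M n /\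
     (exists d m y, d = e 2 /\ m = e 1 /\ y = e 0 /\ isLim M d m y a) /\ b = e 0 /\ condM M n a b x) /\
     powM M 2 x z)).
  - intros M e z (x & (n & a & b & Hn & (d & m & y & -> & -> & -> & Ha) & -> & [C1 C2]) & Hz).
    destruct Hn as [[Hb ->]|[Hb ->]].
    + left. split; auto. rewrite C2 in Hz by apply one_neq_0. eauto.
    + right. split; auto. rewrite C1 in Hz by reflexivity. auto.
  - apply (real_app1 5 (fun M x z => powM M 2 x z)); [apply real_pow|].
    apply (real_app3 5 condM); [apply real_cond| | |apply real_var; lia].
    + apply (real_impl 5 (fun M e z => exists t m, t = e 3 /\ m = e 1 /\ decM (bin E M t m) M z)).
      * intros M e z (t & m & -> & -> & H). exact H.
      * apply (real_app2 5 (fun M t m z => decM (bin E M t m) M z)); [apply decided_bin, HE| |]; apply real_var; lia.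
    + apply (real_app3 5 isLim); [apply real_lim| | |]; apply real_var; lia.
Qed.

(** The recursion theorem in a simple case: as the index is a parameter, [R] applied to
    [R] refers to itself. *)
Lemma graph_code : exists R : nat, forall (M : pam) (t b : M),
  compM M (nm M R) (pr M (param M (nm M R) t b) mz) b /\
  (forall m y, compM M (nm M R) (pr M (param M (nm M R) t b) m) y -> exists z,
     compM M (nm M R) (pr M (param M (nm M R) t b) (ms m)) z /\ next M (nm M R) t m y z).
Proof.
  destruct (rec_code 3 (fun M r y => y = r 2) (fun M e z => next M (e 2) (e 3) (e 1) (e 0) z)) as [R HR].
  - apply real_var; lia.
  - apply real_next.
  - exists R. intros M t b.
    destruct (HR M (scons (nm M R) (scons t (scons b (fun _ => mz))))) as [(y & Hy & ->) H].
    split; [exact Hy|exact H].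
Qed.

End GraphNotation.

(** ** Descending sequences of notations *)

Lemma udef_st (p : form) (s : nat -> forall M : pam, (nat -> M) -> M) :
  (forall i, poly (s i)) -> udef (fun M e => st M (fun i => s i M e) p).
Proof.
  intros H. apply (g_subst closed_udef (fun M e => st M e p) s); auto. exists p. tauto.
Qed.

Lemma udef_comp f g h : poly f -> poly g -> poly h ->
  udef (fun M e => compM M (f M e) (g M e) (h M e)).
Proof.
  intros Hf Hg Hh.
  apply (g_iff closed_udef (fun M e => st M (fun i => scons (f M e) (scons (g M e) (scons (h M e) nil0)) i) Comp)).
  - intros M e. apply sem_Comp.
  - apply (udef_st Comp (fun i M e => scons (f M e) (scons (g M e) (scons (h M e) nil0)) i)).
    unfold nil0. intros i. poly_tac.
Qed.

Lemma udef_pow b f g : poly f -> poly g -> udef (fun M e => powM M b (f M e) (g M e)).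
Proof.
  intros Hf Hg.
  apply (g_iff closed_udef (fun M e => st M (fun i => scons (f M e) (scons (g M e) nil0) i) (Pow b))).
  - intros M e. apply sem_Pow.
  - apply (udef_st (Pow b) (fun i M e => scons (f M e) (scons (g M e) nil0) i)).
    unfold nil0. intros i. poly_tac.
Qed.

Section Descent.
Variables (E P : rel) (R : nat).
Hypothesis HP : udef P.
Hypothesis Hpath : path E P.
Hypothesis HR : forall (M : pam) (t b : M),
  compM M (nm M R) (pr M (param M (nm M R) t b) mz) b /\
  (forall m y, compM M (nm M R) (pr M (param M (nm M R) t b) m) y -> exists z,
     compM M (nm M R) (pr M (param M (nm M R) t b) (ms m)) z /\ next E M (nm M R) t m y z).

(** The notations of the nodes of the path. Along the path they descend: the notation of
    a successor occurs in the fundamental sequence. *)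
Definition descending (M : pam) (a : M) : Prop :=
  exists t b, un P M t /\ isLim M (nm M R) t b a.

Lemma udef_descending : udef (fun M e => descending M (e 0)).
Proof.
  unfold descending, isLim, isConst, un, nil0. ud; unfold jComp, jPair, jId, param.
  - apply udef_comp; poly_tac.
  - apply udef_pow; poly_tac.
Qed.

Lemma descending_next (M : pam) (a : M) : descending M a ->
  exists b z, descending M b /\ powM M 2 b z /\ belowM M z a.
Proof.
  intros (t & b & Ht & Ha). destruct (Hpath M t Ht) as (m & Hm & He).
  destruct (HR M t b) as [H0 HS].
  destruct (lim_comp M _ _ _ _ Ha) as (e & p & Hp & -> & Hc).
  assert (T : forall m, exists y, compM M (nm M R) (pr M (param M (nm M R) t b) m) y).
  { apply induct; [dfn|eauto|]. intros m' [y Hy]. destruct (HS m' y Hy) as (z & Hz & _). eauto. }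
  destruct (T m) as [y Hy]. destruct (HS m y Hy) as (z & Hz & [(_ & a' & Ha' & Hz')|[Hn _]]); [|contradiction].
  exists a', z. split; [exists m, y; auto|]. split; auto.
  right. exists e, p, (ms m). auto.
Qed.

End Descent.

(** * The standard model and Kleene's O *)

Fixpoint const_code (n : nat) : nat :=
  match n with 0 => pair 0 0 | S n => pair 6 (pair (pair 1 0) (const_code n)) end.

Lemma isConst_std (M : pam) n : isConst M (nm M n) (nm M (const_code n)).
Proof.
  induction n as [|n IH]; intros z; cbn [const_code].
  - rewrite nm_pair. apply comp_zero.
  - rewrite !nm_pair. apply comp_comp with (nm M n); [apply IH|apply comp_succ].
Qed.

Lemma powM_std (M : pam) b n : powM M b (nm M n) (nm M (b ^ n)).
Proof.
  induction n as [|n IH].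
  - apply pow_0.
  - rewrite Nat.pow_succ_r', nm_mul. apply pow_S, IH.
Qed.

Definition lim_code (d t b : nat) : nat :=
  pair 6 (pair d (pair 5 (pair (const_code (pair d (pair t (pair b 0)))) (pair 2 0)))).

Lemma isLim_std (M : pam) d t b :
  isLim M (nm M d) (nm M t) (nm M b) (nm M (3 * 5 ^ lim_code d t b)).
Proof.
  exists (nm M (const_code (pair d (pair t (pair b 0))))), (nm M (5 ^ lim_code d t b)).
  split; [|split].
  - pose proof (isConst_std M (pair d (pair t (pair b 0)))) as H. rewrite !nm_pair in H. exact H.
  - pose proof (powM_std M 5 (lim_code d t b)) as H. unfold lim_code in H at 1.
    rewrite !nm_pair in H. exact H.
  - apply nm_mul.
Qed.

Lemma NM_strong (P : NM -> Prop) : (forall x, (forall y, lt y x -> P y) -> P x) -> forall x, P x.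
Proof.
  intros H x. apply (well_founded_ind lt_wf P). intros y IH. apply H.
  intros z Hz. apply IH, NM_lt, Hz.
Qed.

(** In the standard model derivations have standard length, so that the arithmetized
    computations are computations. *)
Lemma comp_sound (e x y : nat) : compM NM e x y -> computes e x y.
Proof.
  intros H.
  enough (K : forall w, lfpM NM (CompR NM) w -> forall e x y, w = pr3 NM e x y -> computes e x y)
    by exact (K _ H e x y eq_refl).
  clear. intros w.
  apply (lfp_ind NM (fun w => forall e x y, w = pr3 NM e x y -> computes e x y));
    [apply fin_mono, fin_Comp|apply NM_strong|].
  clear w. intros w H e x y ->. unfold CompR in H.
  repeat match goal with
  | H : _ \/ _ |- _ => destruct H
  | H : exists x, _ |- _ => destruct H
  | H : _ /\ _ |- _ => destruct H
  end;
  repeat match goal with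
  | H : forall e x y, pr3 NM ?a ?b ?c = _ -> _ |- _ => specialize (H a b c eq_refl)
  end;
  match goal with H : pr3 NM _ _ _ = pr3 NM _ _ _ |- _ =>
    apply pr_inj in H; destruct H as [-> H]; apply pr_inj in H; destruct H as [-> ->]
  end.
  - apply c_zero.
  - apply c_succ.
  - apply c_id.
  - apply c_fst.
  - apply c_snd.
  - eapply c_pair; eauto.
  - eapply c_comp; eauto.
  - eapply c_rec0; eauto.
  - eapply c_recS; eauto.
  - eapply c_mu0; eauto.
  - eapply c_muS; eauto.
Qed.

Lemma pow_sound b (n y : nat) : powM NM b n y -> y = b ^ n.
Proof.
  intros H.
  enough (K : forall w, lfpM NM (PowR NM b) w -> forall n y, w = pr NM n y -> y = b ^ n)
    by exact (K _ H n y eq_refl).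
  clear. intros w.
  apply (lfp_ind NM (fun w => forall n y, w = pr NM n y -> y = b ^ n));
    [apply fin_mono, fin_Pow|apply NM_strong|].
  clear w. intros w [H|(m & z & H & ->)] n y E.
  - subst w. apply pr_inj in E. destruct E as [<- <-]. reflexivity.
  - apply pr_inj in E. destruct E as [<- <-]. specialize (H m z eq_refl). subst z.
    cbn [mm natm pm NM]. rewrite NM_nm. cbn [ms natm pm NM]. rewrite Nat.pow_succ_r'. reflexivity.
Qed.

Lemma lim_sound (d t b a : nat) : isLim NM d t b a -> exists e, a = 3 * 5 ^ e /\
  forall m y, compM NM d (pr NM (param NM d t b) m) y -> computes e m y.
Proof.
  intros H. destruct (lim_comp NM d t b a H) as (e & p & Hp & -> & Hc).
  exists e. split.
  - apply pow_sound in Hp. rewrite Hp, NM_nm. reflexivity.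
  - intros m y Hm. apply comp_sound, Hc, Hm.
Qed.

(** * Ordinal arithmetic *)

Lemma ole_refl x : ole x x.
Proof.
  induction x as [|x IH|f IH]; constructor; auto. intros n. apply ole_member with n; auto.
Qed.

(** The inner inductions descend into the members of a supremum until the relevant
    successor or member appears. *)
Lemma ole_trans x y z : ole x y -> ole y z -> ole x z.
Proof.
  intros H; revert z. induction H as [y|x y H IH|f y H IH|x f n H IH]; intros z Hz.
  - constructor.
  - remember (osucc y) as y' eqn:Ey. revert Ey. induction Hz as [|y1 z Hz _|g z Hz _|y1 g n Hz IHz]; intros Ey.
    + discriminate.
    + injection Ey as ->. constructor; auto.
    + discriminate.
    + apply ole_member with n; auto.
  - constructor; auto.
  - apply IH. clear IH H. remember (osup f) as s eqn:Es. revert Es.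
    induction Hz as [|y1 z Hz _|g z Hz _|y1 g m Hz IHz]; intros Es; try discriminate.
    + injection Es as ->. auto.
    + apply ole_member with m; auto.
Qed.

Lemma ole_succ_r x : ole x (osucc x).
Proof.
  induction x as [|x IH|f IH]; constructor; auto.
  intros n. apply ole_trans with (osucc (f n)); auto. constructor.
  apply ole_member with n, ole_refl.
Qed.

Lemma ole_total x : forall y, ole x y \/ ole (osucc y) x.
Proof.
  induction x as [|x IH|f IH]; intros y.
  - left; constructor.
  - induction y as [|y IHy|g IHg].
    + right. constructor. constructor.
    + destruct (IH y) as [H|H]; [left; constructor; auto|right; constructor; auto].
    + destruct (classic (exists n, ole (osucc x) (g n))) as [[n Hn]|Hn].
      * left. apply ole_member with n; auto.
      * right. constructor. constructor. intros n. destruct (IHg n) as [H|H].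
        -- destruct Hn; eauto.
        -- inversion H; auto.
  - destruct (classic (exists n, ole (osucc y) (f n))) as [[n Hn]|Hn].
    + right. apply ole_member with n; auto.
    + left. constructor. intros n. destruct (IH n y) as [H|H]; auto. destruct Hn; eauto.
Qed.

Lemma oadd_le_l x y : ole x (oadd x y).
Proof.
  induction y as [|y IH|f IH]; simpl.
  - apply ole_refl.
  - apply ole_trans with (oadd x y); auto using ole_succ_r.
  - apply ole_member with 0; auto.
Qed.

Lemma oadd_mono_r x y y' : ole y y' -> ole (oadd x y) (oadd x y').
Proof.
  induction 1; simpl.
  - apply oadd_le_l.
  - constructor; auto.
  - constructor; auto.
  - apply ole_member with n; auto.
Qed.

Lemma oadd_mono_l x x' y : ole x x' -> ole (oadd x y) (oadd x' y).
Proof.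
  intros H. induction y as [|y IH|f IH]; simpl; auto.
  - constructor; auto.
  - constructor. intros n. apply ole_member with n; auto.
Qed.

Lemma oadd_assoc x y z : oadd (oadd x y) z = oadd x (oadd y z).
Proof.
  induction z as [|z IH|f IH]; simpl; try congruence.
  f_equal. apply functional_extensionality. auto.
Qed.

Lemma oadd_0_l x : oadd ozero x = x.
Proof.
  induction x as [|x IH|f IH]; simpl; try congruence.
  f_equal. apply functional_extensionality. auto.
Qed.

Definition wk (k c : nat) : ord := omul (opow omega k) (ofin c).

Lemma wk_add k a b : oadd (wk k a) (wk k b) = wk k (a + b).
Proof.
  unfold wk. induction b as [|b IH]; simpl.
  - rewrite Nat.add_0_r. reflexivity.
  - rewrite Nat.add_succ_r. simpl. rewrite <- IH, oadd_assoc. reflexivity.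
Qed.

Lemma wk_le k c : ole (wk k c) (opow omega (S k)).
Proof. simpl. apply ole_member with c. apply ole_refl. Qed.

Lemma oadd_le_r x y : ole y (oadd x y).
Proof. rewrite <- (oadd_0_l y) at 1. apply oadd_mono_l. constructor. Qed.

(** An ordinal below a power of omega is below one of its multiples of the preceding
    power, and adding this to the members of the sequence shifts the sequence. *)
Lemma absorbed k x : ole (osucc x) (opow omega (S k)) ->
  ole (oadd (osucc x) (opow omega (S k))) (opow omega (S k)).
Proof.
  intros H. simpl in H. inversion H as [| | |x' f c Hc]; subst. constructor. intros m.
  apply ole_trans with (oadd (wk k c) (wk k m)); [apply oadd_mono_l, Hc|].
  rewrite wk_add. apply wk_le.
Qed.

Lemma wk_1 k : wk k 1 = opow omega k.
Proof. unfold wk. simpl. apply oadd_0_l. Qed.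

Lemma opow_pos k : ole (ofin 1) (opow omega k).
Proof.
  induction k as [|k IH]; simpl; [apply ole_refl|].
  apply ole_member with 1. simpl. rewrite oadd_0_l. exact IH.
Qed.

Lemma wk_succ k c x : ole x (wk k c) -> ole (osucc x) (wk k (S c)).
Proof.
  intros H. apply ole_trans with (oadd x (ofin 1)); [apply ole_refl|].
  apply ole_trans with (oadd (wk k c) (ofin 1)); [apply oadd_mono_l, H|].
  apply oadd_mono_r, opow_pos.
Qed.

Fixpoint sums (B : nat -> ord) (m : nat) : ord :=
  match m with 0 => ozero | S m => oadd (sums B m) (B m) end.

Lemma sums_wk k (c : nat -> nat) m : exists d, sums (fun i => wk k (c i)) m = wk k d.
Proof.
  induction m as [|m [d IH]]; [exists 0; reflexivity|].
  exists (d + c m). simpl. rewrite IH. apply wk_add.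
Qed.

Lemma sums_bound k (c : nat -> nat) : ole (osup (sums (fun i => wk k (c i)))) (opow omega (S k)).
Proof.
  constructor. intros m. destruct (sums_wk k c m) as [d ->]. apply wk_le.
Qed.

(** The small terms that follow the large ones add up to at most one more power. *)
Lemma sums_bound_almost k N (c : nat -> nat) : exists d,
  ole (osup (sums (fun i => wk (if lt_dec i N then S k else k) (c i)))) (wk (S k) d).
Proof.
  set (B := fun i => wk (if lt_dec i N then S k else k) (c i)).
  assert (H1 : forall m, m <= N -> sums B m = sums (fun i => wk (S k) (c i)) m).
  { induction m as [|m IH]; intros Hm; simpl; auto. rewrite IH by lia.
    unfold B at 1. destruct (lt_dec m N); [reflexivity|lia]. }
  destruct (sums_wk (S k) c N) as [d Hd].
  assert (H2 : forall j, exists d', sums B (N + j) = oadd (wk (S k) d) (wk k d')).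
  { induction j as [|j [d' IH]].
    - exists 0. rewrite Nat.add_0_r, H1, Hd by lia. reflexivity.
    - rewrite Nat.add_succ_r. simpl. rewrite IH. unfold B at 1.
      destruct (lt_dec (N + j) N); [lia|]. exists (d' + c (N + j)).
      rewrite oadd_assoc, wk_add. reflexivity. }
  assert (H3 : forall m j, ole (sums B m) (sums B (m + j))).
  { intros m j. induction j as [|j IH]; [rewrite Nat.add_0_r; apply ole_refl|].
    rewrite Nat.add_succ_r. simpl. eapply ole_trans; [exact IH|apply oadd_le_l]. }
  exists (d + 1). rewrite <- wk_add, wk_1. constructor. intros m.
  apply ole_trans with (sums B (N + m)).
  - rewrite Nat.add_comm. apply H3.
  - destruct (H2 m) as [d' ->]. apply oadd_mono_r, wk_le.
Qed.

(** * Notations in the standard model *)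

Lemma limit_notation e (f : nat -> nat) :
  (forall n, computes e n (f n)) -> (forall n, kleeneO (f n)) ->
  (forall n, ltO (f n) (f (S n))) ->
  kleeneO (3 * 5 ^ e) /\ forall n, ltO (f n) (3 * 5 ^ e).
Proof.
  intros H1 H2 H3. assert (H : kleeneO (3 * 5 ^ e)) by (apply O_lim with f; auto).
  split; auto. intros n. apply ltO_lim with n; auto.
Qed.

(** Whether [y] is a notation is left open, as the values of a program at irrelevant
    arguments need not be notations. *)
Definition above (B : ord) (y z : nat) : Prop := forall o, kleeneO y -> denotes y o ->
  kleeneO z /\ ltO y z /\ exists o', denotes z o' /\ ole o' (oadd o B).

Lemma above_limit e (f : nat -> nat) (B : nat -> ord) :
  (forall n, computes e n (f n)) -> (forall n, above (B n) (f n) (f (S n))) ->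
  above (osup (sums B)) (f 0) (3 * 5 ^ e).
Proof.
  intros Hc HB o HO Ho.
  assert (K : forall n, { o' | kleeneO (f n) /\ denotes (f n) o' /\ ole o' (oadd o (sums B n)) }).
  { intros n. apply constructive_indefinite_description. induction n as [|n (o' & A & D & L)].
    - exists o. split; auto. split; auto. apply ole_refl.
    - destruct (HB n o' A D) as (A' & _ & o2 & D2 & L2). exists o2. split; auto. split; auto.
      eapply ole_trans; [exact L2|]. simpl. rewrite <- oadd_assoc. apply oadd_mono_l, L. }
  set (g := fun n => proj1_sig (K n)).
  assert (Kg : forall n, kleeneO (f n) /\ denotes (f n) (g n) /\ ole (g n) (oadd o (sums B n)))
    by (intros n; apply (proj2_sig (K n))).
  destruct (limit_notation e f Hc) as [A L].
  - apply Kg.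
  - intros n. destruct (Kg n) as (A & D & _). apply (HB n _ A D).
  - split; auto. split; auto. exists (osup g). split.
    + apply denotes_lim with f; auto. apply Kg.
    + constructor. intros n. simpl. apply ole_member with n. apply Kg.
Qed.

Lemma above_le B B' y z : ole B B' -> above B y z -> above B' y z.
Proof.
  intros H A o HO Ho. destruct (A o HO Ho) as (A1 & A2 & o' & A3 & A4).
  split; auto. split; auto. exists o'. split; auto.
  eapply ole_trans; [exact A4|]. apply oadd_mono_r, H.
Qed.

Lemma above_succ k c y z : above (wk k c) y z -> above (wk k (S c)) y (2 ^ z).
Proof.
  intros A o HO Ho. destruct (A o HO Ho) as (A1 & A2 & o' & A3 & A4).
  split; [constructor; auto|]. split.
  - eapply ltO_trans; [exact A2|]. constructor; auto.
  - exists (osucc o'). split; [constructor; auto|].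
    apply ole_trans with (osucc (oadd o (wk k c))); [constructor; auto|].
    change (osucc (oadd o (wk k c))) with (oadd o (osucc (wk k c))).
    apply oadd_mono_r, wk_succ, ole_refl.
Qed.

Lemma above_two k c y : above (wk k (S c)) y (2 ^ y).
Proof.
  intros o HO Ho. split; [constructor; auto|]. split; [constructor; auto|].
  exists (osucc o). split; [constructor; auto|].
  change (osucc o) with (oadd o (osucc ozero)). apply oadd_mono_r, wk_succ. constructor.
Qed.

(** Programs compute relations whose values are not known to be unique; a sequence of
    values along the recursion is chosen. *)
Lemma iterate_choice (C : nat -> nat -> Prop) (Q : nat -> nat -> nat -> Prop) (y0 : nat) :
  C 0 y0 -> (forall m y, C m y -> exists z, C (S m) z /\ Q m y z) ->
  exists f, f 0 = y0 /\ (forall m, C m (f m)) /\ forall m, Q m (f m) (f (S m)).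
Proof.
  intros H0 HS.
  assert (F : forall m y, C m y -> { z | C (S m) z /\ Q m y z })
    by (intros; apply constructive_indefinite_description; auto).
  set (step := fun m (s : { y | C m y }) =>
    exist (C (S m)) (proj1_sig (F m (proj1_sig s) (proj2_sig s)))
      (proj1 (proj2_sig (F m (proj1_sig s) (proj2_sig s))))).
  set (s := nat_rect (fun m => { y | C m y }) (exist _ y0 H0) step).
  exists (fun m => proj1_sig (s m)). split; [reflexivity|]. split.
  - intros m. exact (proj2_sig (s m)).
  - intros m. change (s (S m)) with (step m (s m)). unfold step. cbn [proj1_sig].
    exact (proj2 (proj2_sig (F m (proj1_sig (s m)) (proj2_sig (s m))))).
Qed.

Section GraphNotations.
Variables (E : rel) (R : nat).
Hypothesis HR : forall (M : pam) (t b : M),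
  compM M (nm M R) (pr M (param M (nm M R) t b) mz) b /\
  (forall m y, compM M (nm M R) (pr M (param M (nm M R) t b) m) y -> exists z,
     compM M (nm M R) (pr M (param M (nm M R) t b) (ms m)) z /\ next E M (nm M R) t m y z).

Lemma fundamental (t b a : nat) : isLim NM R t b a -> exists e f,
  a = 3 * 5 ^ e /\ f 0 = b /\ (forall m, computes e m (f m)) /\
  forall m, next E NM R t m (f m) (f (S m)).
Proof.
  intros Ha. destruct (lim_sound R t b a Ha) as (e & -> & He).
  specialize (HR NM t b). rewrite NM_nm in HR. destruct HR as [H0 HS].
  destruct (iterate_choice (fun m y => compM NM R (pr NM (param NM R t b) m) y)
    (next E NM R t) b H0 HS) as (f & F0 & FC & FN).
  exists e, f. auto.
Qed.

(** The fundamental sequence puts the successors of [t] on top of each other, so that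
    their bounds are added. One more unit accounts for the successor notation. *)
Lemma above_steps (t b a : nat) (k : nat -> nat) (c : nat -> nat) :
  (forall m y z, bin E NM t m -> isLim NM R m y z -> above (wk (k m) (c m)) y z) ->
  isLim NM R t b a -> above (osup (sums (fun m => wk (k m) (S (c m))))) b a.
Proof.
  intros H Ha. destruct (fundamental t b a Ha) as (e & f & -> & <- & Hc & Hn).
  apply above_limit; auto. intros m. destruct (Hn m) as [(He & z & Hz & Hp)|(_ & Hp)];
    apply pow_sound in Hp; rewrite Hp.
  - apply above_succ. apply H; auto.
  - apply above_two.
Qed.

Lemma choose_bounds (Q : nat -> nat -> Prop) : (forall m, exists c, Q m c) -> exists c, forall m, Q m (c m).
Proof.
  intros H. exists (fun m => proj1_sig (constructive_indefinite_description _ (H m))).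
  intros m. apply proj2_sig.
Qed.

(** Adding up sizes along the fundamental sequence: finitely many successors have size
    at most [omega ^ (k + 1) * c], the others at most [omega ^ k * c]. *)
Lemma small_above k : forall t, small (bin E NM) k t ->
  exists c, forall b a, isLim NM R t b a -> above (wk (S k) c) b a.
Proof.
  induction k as [k IHk] using lt_wf_ind. intros t H. rewrite small_eq in H.
  induction H as [t N H1 IH H2].
  destruct (choose_bounds (fun m c => bin E NM t m -> forall y z, isLim NM R m y z ->
     above (wk (if lt_dec m N then S k else k) c) y z)) as [c Hc].
  { intros m. destruct (classic (bin E NM t m)) as [Hm|Hm]; [|exists 0; tauto].
    destruct (lt_dec m N) as [L|L].
    - destruct (IH m Hm L) as [c Hc]. eauto.
    - specialize (H2 m Hm ltac:(lia)). destruct k as [|k]; [destruct H2|].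
      destruct (IHk k ltac:(lia) m H2) as [c Hc]. eauto. }
  destruct (sums_bound_almost k N (fun m => S (c m))) as [d Hd].
  exists d. intros b a Ha. eapply above_le; [exact Hd|].
  apply (above_steps t b a (fun m => if lt_dec m N then S k else k)); auto.
Qed.

Lemma root_above n : (forall m, bin E NM 0 m -> below_small (bin E NM) n m) ->
  forall b a, isLim NM R 0 b a -> above (opow omega (S n)) b a.
Proof.
  intros H.
  destruct (choose_bounds (fun m c => bin E NM 0 m -> forall y z, isLim NM R m y z ->
     above (wk n c) y z)) as [c Hc].
  { intros m. destruct (classic (bin E NM 0 m)) as [Hm|Hm]; [|exists 0; tauto].
    specialize (H m Hm). destruct n as [|n]; [destruct H|].
    destruct (small_above n m H) as [c Hc]. eauto. }
  intros b a Ha. eapply above_le; [apply (sums_bound n (fun m => S (c m)))|].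
  apply (above_steps 0 b a (fun _ => n)); auto.
Qed.

End GraphNotations.

(** ** Adding a power of omega to a notation *)

Definition exactly (B : ord) (y z : nat) : Prop := forall o, kleeneO y -> denotes y o ->
  kleeneO z /\ ltO y z /\ exists o', denotes z o' /\ oeq o' (oadd o B).

Lemma exactly_limit e (f : nat -> nat) k :
  (forall n, computes e n (f n)) -> (forall n, exactly (opow omega k) (f n) (f (S n))) ->
  exactly (opow omega (S k)) (f 0) (3 * 5 ^ e).
Proof.
  intros Hc HB o HO Ho.
  assert (K : forall n, { o' | kleeneO (f n) /\ denotes (f n) o' /\ oeq o' (oadd o (wk k n)) }).
  { intros n. apply constructive_indefinite_description. induction n as [|n (o' & A & D & L1 & L2)].
    - exists o. split; auto. split; auto. split; apply ole_refl.
    - destruct (HB n o' A D) as (A' & _ & o2 & D2 & L3 & L4). exists o2. split; auto. split; auto.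
      unfold wk. simpl. rewrite <- oadd_assoc. split.
      + eapply ole_trans; [exact L3|]. apply oadd_mono_l, L1.
      + eapply ole_trans; [|exact L4]. apply oadd_mono_l, L2. }
  set (g := fun n => proj1_sig (K n)).
  assert (Kg : forall n, kleeneO (f n) /\ denotes (f n) (g n) /\ oeq (g n) (oadd o (wk k n)))
    by (intros n; apply (proj2_sig (K n))).
  destruct (limit_notation e f Hc) as [A L].
  - apply Kg.
  - intros n. destruct (Kg n) as (A & D & _). apply (HB n _ A D).
  - split; auto. split; auto. exists (osup g). split.
    + apply denotes_lim with f; auto. apply Kg.
    + split; constructor; intros n; apply ole_member with n; apply (Kg n).
Qed.

(** The notation is the limit of the [omega] fold iteration of the preceding case. For
    [k] other than [0] its fundamental sequence starts at [y] itself, so that the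
    iterate [y] is contained in the iterate [z]. *)
Lemma add_power k : exists A : forall M : pam, M -> M -> Prop,
  real 1 (fun M r z => A M (r 0) z) /\ (forall y z : nat, A NM y z -> exactly (opow omega k) y z /\
    (k <> 0 -> exists e, z = 3 * 5 ^ e /\ computes e 0 y)).
Proof.
  induction k as [|k (A & HA & HN)].
  - exists (fun M y z => powM M 2 y z). split; [apply real_pow|].
    intros y z H. apply pow_sound in H. subst z. split; [|tauto]. intros o HO Ho.
    split; [constructor; auto|]. split; [constructor; auto|].
    exists (osucc o). split; [constructor; auto|]. split; apply ole_refl.
  - destruct (rec_code 3 (fun M r y => y = r 2) (fun M e z => exists x, x = e 0 /\ A M x z)) as [D HD].
    { apply real_var; lia. }
    { apply (real_app1 5 (fun M x z => A M x z)); [exact HA|apply real_var; lia]. }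
    exists (fun M y z => isLim M (nm M D) mz y z). split.
    + apply (real_impl 1 (fun M r z => exists d t b, d = nm M D /\ t = mz /\ b = r 0 /\ isLim M d t b z)).
      * intros M r z (d & t & b & -> & -> & -> & H). exact H.
      * apply (real_app3 1 isLim); [apply real_lim|apply real_nm|apply real_zero|apply real_var; lia].
    + intros y z H. rewrite NM_nm in H.
      destruct (lim_sound D 0 y z H) as (e & -> & He).
      destruct (HD NM (scons D (scons 0 (scons y (fun _ => 0))))) as [(y0 & H0 & E0) HS].
      rewrite NM_nm in *. cbn [scons] in E0. subst y0.
      destruct (iterate_choice (fun m u => compM NM D (pr NM (param NM D 0 y) m) u)
        (fun m u v => A NM u v) y H0) as (f & <- & FC & FN).
      { intros m u Hu. destruct (HS m u Hu) as (v & Hv & u' & -> & Ha). eauto. }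
      split.
      * apply exactly_limit; auto. intros m. apply HN, FN.
      * intros _. exists e. auto.
Qed.

(** * The theorem *)

Lemma st_NM p : forall r, st NM r p <-> sat r p.
Proof.
  assert (Ev : forall t (r : nat -> nat), ev NM r t = eval r t).
  { induction t; simpl; intros r; auto; try rewrite IHt; try (rewrite IHt1, IHt2); reflexivity. }
  induction p as [|s t|p IHp q IHq|p IH]; intros r; simpl.
  - tauto.
  - rewrite !Ev. tauto.
  - rewrite IHp, IHq. tauto.
  - split; intros H x; apply (IH (scons x r)), H.
Qed.

Lemma provable_mono (T T' : theory) p : (forall q, T q -> T' q) -> provable T p -> provable T' p.
Proof.
  intros H D. induction D; [apply provable_log|apply provable_ax|eapply provable_mp|apply provable_gen]; eauto.
Qed.

(** The notation of the root is bounded by [omega ^ (n + 1)], but it may denote less. *)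
Lemma completeness_at_limit n phi : sentence phi -> isPi (2 * n + 1) phi -> true_in_N phi ->
  exists e o, let L := 3 * 5 ^ e in
    kleeneO L /\ denotes L o /\ ole o (opow omega (n + 1)) /\ provable (RFN_PA (2 ^ L)) phi.
Proof.
  intros hsent hPi htrue.
  destruct (isPi_level n phi hPi) as (Q & HQ & Hphi).
  destruct (graph n Q HQ) as (E & P & HE & HP & Hpath & Hroot & Hsmall).
  destruct (graph_code E HE) as [R HR].
  assert (Hnil : forall (M : pam) r, ~ st M r phi -> exists x, un Q M x).
  { intros M r H. apply (Hphi M nil0). intros H'. apply H.
    apply (st_agree M phi 0 nil0 r); auto. intros; lia. }
  set (e := lim_code R 0 1). set (L := 3 * 5 ^ e).
  assert (HL : isLim NM R 0 1 L).
  { pose proof (isLim_std NM R 0 1) as H. rewrite !NM_nm in H. exact H. }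
  destruct (root_above E R HR n) with (b := 1) (a := L) (o := ozero) as (A & _ & o & Ho & Hle); auto.
  - apply Hsmall. intros x Hx. assert (Hn : ~ st NM nil0 phi) by (apply Hphi; exists x; exact Hx).
    apply Hn, st_NM, htrue.
  - apply O_one.
  - apply denotes_one.
  - exists e, o. fold L. split; auto. split; auto. split.
    { rewrite oadd_0_l in Hle. rewrite Nat.add_1_r. exact Hle. }
    destruct (udef_descending P R HP) as [S HS].
    assert (Hh : forall (M : pam) (a : M), holds S M a <-> descending P R M a).
    { intros M a. apply (HS M (scons a (fun _ => mz))). }
    apply (reflection_excludes_descent S) with (L := L).
    + intros M a Ha. apply Hh in Ha. destruct (descending_next E P R Hpath HR M a Ha) as (b & z & Hb & Hz & Hl).
      exists b, z. split; auto. apply Hh, Hb.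
    + intros M r Hr. apply Hh. exists mz, (nm M 1). split; [apply Hroot; eauto|].
      apply (isLim_std M R 0 1).
    + intros q Hq. apply RFN_succ. left. apply RFN_lim_PA, Hq.
    + intros p Hp. apply RFN_succ. right. eauto.
Qed.

Theorem theorem22 (n : nat) (phi : form)
  (hsent : sentence phi) (hPi : isPi (2 * n + 1) phi) (htrue : true_in_N phi) :
  exists a : nat,
    kleeneO a /\
    has_ordinal a (oadd (opow omega (n + 1)) (ofin 1)) /\
    provable (RFN_PA a) phi.
Proof.
  destruct (completeness_at_limit n phi hsent hPi htrue) as (e & o & HO & Ho & Hle & Hp).
  set (L := 3 * 5 ^ e) in *.
  destruct (ole_total (opow omega (n + 1)) o) as [Hge|Hlt].
  - exists (2 ^ L). split; [apply O_succ, HO|]. split; auto.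
    exists (osucc o). split; [apply denotes_succ, Ho|]. split; constructor; auto.
  - destruct (add_power (n + 1)) as (A & [c Hc] & HA).
    destruct (Hc NM (fun _ => 2 ^ L)) as (z & _ & Hz).
    destruct (HA _ _ Hz) as [Hx Hs]. destruct Hs as (e' & -> & He'); [lia|].
    destruct (Hx (osucc o)) as (A1 & _ & o' & Ho' & L1 & L2); [apply O_succ, HO|apply denotes_succ, Ho|].
    (* The ordinal [o + 1] of [2 ^ L] is absorbed by the power that is added to it. *)
    exists (2 ^ (3 * 5 ^ e')). split; [apply O_succ, A1|]. split.
    + exists (osucc o'). split; [apply denotes_succ, Ho'|].
      rewrite Nat.add_1_r in *. split; constructor; simpl.
      * eapply ole_trans; [exact L1|]. apply absorbed, Hlt.
      * eapply ole_trans; [|exact L2]. apply oadd_le_r.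
    + apply (provable_mono (RFN_PA (2 ^ L))); auto.
      intros q Hq. apply RFN_succ. left. apply (RFN_lim He'). left. exact Hq.
Qed.
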